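(* The following two statements are equivalent: (i) every connected plane graph $G$ satisfies $\chi_c(G) \leq \lfloor \frac{3}{2}\Delta^*(G)\rfloor$; (ii) every plane graph $G$ that is a subdivision of a simple $3$-connected plane graph satisfies $\chi_c(G) \leq \lfloor \frac{3}{2}\Delta^*(G)\rfloor$.
   Context: Plane graphs may have multiple edges but no loops; a simple graph has no multiple edges. The degree of a face is the number of vertices incident with it; $\Delta^*(G)$ is the maximum face degree. A cyclic coloring of a plane graph is a vertex coloring in which any two distinct vertices incident with a common face receive distinct colors; $\chi_c(G)$ is the minimum number of colors in a cyclic coloring of $G$. A subdivision of a graph is obtained by a sequence of operations each replacing an edge $uv$ by a path $u,w,v$ through a new vertex $w$. *)

(* Defs.v *)
From mathcomp Require Export all_boot.

Set Implicit Arguments.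
Unset Strict Implicit.
Unset Printing Implicit Defensive.

(* Finite loopless multigraphs.  Each edge is a pair {d, flip d} of opposite
   darts, d running from [source d] to [source (flip d)].  [flip] has no fixed point,
   because of [loopless]. *)
Record graph := Graph {
  vertex : finType;
  dart : finType;
  source : dart -> vertex;
  flip : dart -> dart;
  flipK : involutive flip;
  loopless : forall d, source (flip d) != source d
}.

Definition target (G : graph) (d : dart G) : vertex G := source (flip d).

Definition adj (G : graph) : rel (vertex G) :=
  [rel u v | [exists d : dart G, (source d == u) && (target d == v)]].

Definition simple_graph (G : graph) : Prop :=
  forall d e : dart G, source d = source e -> target d = target e -> d = e.

(* G - S is nonempty and connected. *)
Definition connected_minus (G : graph) (S : {set vertex G}) : Prop :=
  (exists v, v \notin S) /\
  (forall u v, u \notin S -> v \notin S ->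
     connect [rel x y | [&& x \notin S, y \notin S & adj x y]] u v).

Definition connected_graph (G : graph) : Prop :=
  connected_minus (set0 : {set vertex G}).

Definition three_connected (G : graph) : Prop :=
  3 < #|vertex G| /\
  (forall S : {set vertex G}, #|S| < 3 -> connected_minus S).

Definition graph_iso (G H : graph) : Prop :=
  exists (fV : vertex G -> vertex H) (fD : dart G -> dart H),
    [/\ bijective fV, bijective fD,
        (forall d, source (fD d) = fV (source d)) &
        (forall d, flip (fD d) = fD (flip d))].

(* Replacing the edge {d0, flip d0} by a path through the new vertex None:
   d0 and flip d0 now end at None, and their flips are the new darts
   inr false and inr true. *)
Definition subdivide_source (G : graph) (x : dart G + bool) : option (vertex G) :=
  match x with inl d => Some (source d) | inr _ => None end.

Definition subdivide_flip (G : graph) (d0 : dart G) (x : dart G + bool) :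
    dart G + bool :=
  match x with
  | inl d => if d == d0 then inr false
             else if d == flip d0 then inr true else inl (flip d)
  | inr false => inl d0
  | inr true => inl (flip d0)
  end.

Lemma subdivide_flipK (G : graph) (d0 : dart G) : involutive (subdivide_flip d0).
Proof.
have neq : (flip d0 == d0) = false.
  by apply/eqP => e; have := loopless d0; rewrite e eqxx.
case=> [d|[]] /=; rewrite ?neq ?eqxx //.
case: (altP (d =P d0)) => [-> //|d1]; case: (altP (d =P flip d0)) => [-> //|d2] /=.
have /negPf-> : flip d != d0 by apply: contraNneq d2 => <-; rewrite flipK.
have /negPf-> : flip d != flip d0 by rewrite (inj_eq (can_inj (@flipK G))).
by rewrite flipK.
Qed.

Lemma subdivide_loopless (G : graph) (d0 : dart G) (x : dart G + bool) :
  subdivide_source (subdivide_flip d0 x) != subdivide_source x.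
Proof.
case: x => [d|[]] //=; case: ifP => // _; case: ifP => // _ /=.
exact: loopless.
Qed.

Definition subdivide (G : graph) (d0 : dart G) : graph :=
  @Graph (option (vertex G)) (dart G + bool)%type (@subdivide_source G)
    (subdivide_flip d0) (subdivide_flipK d0) (subdivide_loopless d0).

Inductive subdivision_of (H : graph) : graph -> Prop :=
| Subdivision_refl G : graph_iso H G -> subdivision_of H G
| Subdivision_step G (d : dart G) G' :
    subdivision_of H G -> graph_iso (subdivide d) G' -> subdivision_of H G'.

(* Combinatorial description of a graph embedded in a surface.
   [rot] lists the darts leaving each vertex in cyclic order: by [rotP] it
   permutes the darts with a given source in a single cycle.
   The boundary walks of the faces are then the orbits of d |-> rot (flip d);
   [side d] is the face bordered by the walk through d.  Distinct walks may
   border the same face, as happens when the graph is disconnected.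
   [home v] is the face containing v when v is isolated; it is not used for
   other vertices. *)
Record embedded_graph := EmbeddedGraph {
  underlying :> graph;
  rot : dart underlying -> dart underlying;
  rotP : forall d e, fconnect rot d e = (source d == source e);
  face : finType;
  side : dart underlying -> face;
  sideP : forall d, side (rot (flip d)) = side d;
  home : vertex underlying -> face
}.

Definition isolated (G : graph) (v : vertex G) : bool :=
  [forall d : dart G, source d != v].

Definition incident (G : embedded_graph) (v : vertex G) (f : face G) : bool :=
  [exists d : dart G, (source d == v) && (side d == f)]
  || isolated v && (home v == f).

Definition incidence_rel (G : embedded_graph) : rel (vertex G + face G) :=
  fun x y => match x, y with
             | inl v, inr f | inr f, inl v => incident v f
             | _, _ => false
             end.

(* Embeddings in the sphere, hence plane graphs (which face is the unbounded
   one plays no role).  The surface is connected, and Euler's formula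
   |V| - |E| + |F| = 1 + c holds, c being the number of components of the graph.
   Let B be the number of boundary walks (an isolated vertex counting for one)
   and g >= 0 the sum of the genera of the components.  Then
   |V| - |E| + B = 2c - 2g, and connectedness gives B >= c + |F| - 1; so Euler's
   formula forces both g = 0 and a tree-like arrangement of the components
   inside each other's faces.  For a connected graph it says that each face has
   exactly one boundary walk and that the genus is 0. *)
Definition spherical (G : embedded_graph) : Prop :=
  (forall x y : vertex G + face G, connect (@incidence_rel G) x y) /\
  #|vertex G| + #|face G| = #|dart G|./2 + n_comp (@adj G) predT + 1.

Record plane_graph := PlaneGraph {
  embedding :> embedded_graph;
  plane_spherical : spherical embedding
}.

Definition face_degree (G : plane_graph) (f : face G) : nat :=
  #|[set v | incident v f]|.

Definition max_face_degree (G : plane_graph) : nat :=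
  \max_(f : face G) face_degree f.

Definition cyclic_coloring (G : plane_graph) (k : nat)
    (c : {ffun vertex G -> 'I_k}) : bool :=
  [forall f : face G, forall u, forall v,
     [&& u != v, incident u f & incident v f] ==> (c u != c v)].

Definition cyclically_colorable (G : plane_graph) (k : nat) : bool :=
  [exists c : {ffun vertex G -> 'I_k}, cyclic_coloring c].

Lemma cyclically_colorable_exists (G : plane_graph) :
  exists k, cyclically_colorable G k.
Proof.
exists #|vertex G|; apply/existsP; exists [ffun v => enum_rank v].
apply/forallP => f; apply/forallP => u; apply/forallP => v.
by apply/implyP => /and3P[uv _ _]; rewrite !ffunE (inj_eq enum_rank_inj).
Qed.

Definition cyclic_chromatic_number (G : plane_graph) : nat :=
  ex_minn (cyclically_colorable_exists G).

(* Main.v *)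
Require Import Defs.
From mathcomp Require Import all_boot all_fingroup zify.

Set Implicit Arguments.
Unset Strict Implicit.
Unset Printing Implicit Defensive.

Import GroupScope.

(** Only (ii) => (i) needs work.  A connected plane graph is treated as a map: two
    permutations of its darts, the flip [t] and the rotation [r]; vertices are the
    orbits of [r], faces those of [t * r], and a dart [x] stands for the corner where
    its vertex meets its face.  Multiplying [r] by [tperm x y] splits or merges at
    the same time the vertices and the faces of the corners [x] and [y]; watching
    Euler's formula under these moves gives the Jordan curve theorem.

    Let [m] be the maximum face degree and [k = floor (3m/2)].  The map is colored with
    [k] colors by induction.
    - If a vertex occurs twice on a face, cutting there separates the map into two
      smaller ones, whose colorings are glued after permuting the colors.
    - If two faces share two vertices [u], [v] and there are other faces on both sides
      of the resulting closed curve, take such a curve with as few corners as possible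
      on one side.  That side [B] then has at most [m] outer corners, all at distinct
      vertices, so [B] itself is colored by induction.  In the other side, [B] is
      replaced by an edge [uv].  If the two faces have [p1], [q1] vertices strictly
      inside the other side and [p2], [q2] inside [B], the colorings can be glued as
      soon as [p2 + q2 + min p1 q1 + 2 <= k], which follows from
      [p1 + p2 + 2 <= m], [q1 + q2 + 2 <= m] and [p2 + q2 + 2 <= m].
    - Otherwise, if there are at most three faces, then there are at most [3m/2]
      vertices since each lies on two faces; if there are more, suppressing the vertices
      of degree two leaves a simple 3-connected plane graph, and (ii) applies. *)

(** * Orbits of a permutation *)

(** The dart set never changes. What is cut away becomes fixed by the rotation, and a removed edge
    then is a component of its own, with two vertices and one face; it keeps Euler's formula
    balanced and needs only two colors. As every move multiplies by transpositions, the planarity of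
    the smaller maps and the separation by closed curves both reduce to counting orbits.

    The constant 3/2 enters twice. In the gluing, a color not given to [u] or [v] is unusable for
    both faces inside [B] only if it occurs on both faces in the other side, whence the term
    [min p1 q1]; adding the three inequalities gives [2 * (p2 + q2 + min p1 q1) + 6 <= 3 * m]. With
    three faces, twice the number of vertices is at most the number of corners, which is at most
    [3 * m].

    The obstacle in the gluing is a vertex inside [B] that lies on both faces, since it would have
    to avoid the colors of both. Choosing the curve so that [B] has few outer corners excludes it:
    the curve could be rerouted through such a vertex. *)

Section Orbits.
Variable T : finType.
Implicit Types (s : {perm T}) (A : {set T}).

Definition stable (f : T -> T) A := forall x, x \in A -> f x \in A.

Lemma porbit_step s x : porbit s (s x) = porbit s x.
Proof. by rewrite -[RHS](porbit_perm s 1) expg1. Qed.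

Lemma porbit_eq s x y : y \in porbit s x -> porbit s x = porbit s y.
Proof. by rewrite porbit_sym -eq_porbit_mem => /eqP. Qed.

Lemma stable_porbit s A x : stable s A -> x \in A -> porbit s x \subset A.
Proof.
move=> sA xA; apply/subsetP => y /porbitP[i ->].
by elim: i => [|i IHi]; rewrite ?expg0 ?perm1 // expgSr permM sA.
Qed.

Lemma stable_mem s A x : stable s A -> (s x \in A) = (x \in A).
Proof.
move=> sA; apply/idP/idP => [sxA|]; last exact: sA.
apply: (subsetP (stable_porbit sA sxA)); rewrite porbit_sym.
by rewrite -eq_porbit_mem porbit_step.
Qed.

Lemma stableC s A : stable s A -> stable s (~: A).
Proof. by move=> sA x; rewrite !inE stable_mem. Qed.

Lemma stableI s A B : stable s A -> stable s B -> stable s (A :&: B).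
Proof. by move=> sA sB x; rewrite !inE => /andP[/sA-> /sB->]. Qed.

Lemma stableU s A B : stable s A -> stable s B -> stable s (A :|: B).
Proof. by move=> sA sB x; rewrite !inE => /orP[/sA->|/sB->]; rewrite ?orbT. Qed.

Lemma stable_porbit_self s x : stable s (porbit s x).
Proof.
by move=> y; rewrite -!eq_porbit_mem porbit_step.
Qed.

Lemma porbit_exit s A x y :
  x \in A -> y \in porbit s x -> y \notin A ->
  exists a, [/\ a \in porbit s x, a \in A & s a \notin A].
Proof.
move=> xA yx yA.
have [/existsP[a /and3P[ax aA saA]]|/existsPn nex] :=
  boolP [exists a, [&& a \in porbit s x, a \in A & s a \notin A]]; first by exists a.
have st : stable s (porbit s x :&: A).
  move=> a; rewrite inE => /andP[ax aA]; rewrite inE (stable_porbit_self ax) /=.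
  by have := nex a; rewrite !negb_and ax aA /= negbK.
have /subsetP/(_ y yx) : porbit s x \subset porbit s x :&: A.
  by apply: stable_porbit => //; rewrite inE porbit_id.
by rewrite inE (negPf yA) andbF.
Qed.

(** Inversion carries this to multiplication by the transposition on the left, where
    [porbits_mul_tperm] applies, and it does not change the orbits. *)
Lemma card_porbits_mulr s x y :
  #|porbits (s * tperm x y)| + (x \notin porbit s y).*2 = #|porbits s| + (x != y).
Proof.
have := porbits_mul_tperm s^-1 x y; rewrite /= porbitV porbitsV => <-.
by rewrite -porbitsV invMg tpermV.
Qed.

Lemma mulr_tpermK s x y : s * tperm x y * tperm x y = s.
Proof. by rewrite -mulgA tperm2 mulg1. Qed.

Lemma card_porbits_split s x y : x != y -> y \in porbit s x ->
  #|porbits (s * tperm x y)| = #|porbits s|.+1.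
Proof.
by move=> xy yx; have := card_porbits_mulr s x y; rewrite porbit_sym yx xy; lia.
Qed.

Lemma card_porbits_merge s x y : y \notin porbit s x ->
  #|porbits s| = #|porbits (s * tperm x y)|.+1.
Proof.
move=> yx; have xy : x != y by apply: contraNneq yx => ->; apply: porbit_id.
by have := card_porbits_mulr s x y; rewrite porbit_sym yx xy; lia.
Qed.

(** Otherwise multiplying twice by the same transposition would merge orbits both times, although
    the two factors cancel. *)
Lemma mem_porbit_merge s x y : y \notin porbit s x ->
  y \in porbit (s * tperm x y) x.
Proof.
move=> yx; apply: contraT => yx'.
have := card_porbits_merge yx; have := card_porbits_merge yx'.
by rewrite mulr_tpermK; lia.
Qed.

Lemma stable_tperm s A x y : (x \in A) = (y \in A) -> stable s A ->
  stable (s * tperm x y) A.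
Proof.
move=> xyA sA a aA; rewrite permM.
case: tpermP => [e|e|_ _]; last exact: sA.
  by rewrite -xyA -e sA.
by rewrite xyA -e sA.
Qed.

Lemma porbit_split s x y : y \in porbit s x ->
  porbit s x = porbit (s * tperm x y) x :|: porbit (s * tperm x y) y.
Proof.
move=> yx; apply/eqP; rewrite eqEsubset subUset; apply/and3P; split.
- apply: stable_porbit; last by rewrite inE porbit_id.
  rewrite -{1}(mulr_tpermK s x y); apply: stable_tperm.
    by rewrite !inE !porbit_id orbT.
  by apply: stableU; apply: stable_porbit_self.
- apply: stable_porbit (porbit_id s x); apply: stable_tperm.
    by rewrite yx porbit_id.
  exact: stable_porbit_self.
- apply: (stable_porbit _ yx); apply: stable_tperm.
    by rewrite yx porbit_id.
  exact: stable_porbit_self.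
Qed.

Lemma porbit_merge s x y : y \notin porbit s x ->
  porbit (s * tperm x y) x = porbit s x :|: porbit s y.
Proof.
by move=> yx; rewrite {1}(porbit_split (mem_porbit_merge yx)) mulr_tpermK.
Qed.

Lemma porbit_tperm_out s x y a : a \notin porbit s x -> a \notin porbit s y ->
  porbit (s * tperm x y) a = porbit s a.
Proof.
move=> ax ay; have st : stable (s * tperm x y) (porbit s a).
  apply: stable_tperm; last exact: stable_porbit_self.
  by rewrite ![_ \in porbit s a]porbit_sym (negPf ax) (negPf ay).
apply/eqP; rewrite eqEsubset stable_porbit ?porbit_id //=.
apply: stable_porbit; last exact: porbit_id.
rewrite -{1}(mulr_tpermK s x y); apply: stable_tperm.
  have sub := subsetP (stable_porbit st (porbit_id s a)).
  have nx : x \notin porbit (s * tperm x y) a.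
    by apply: contra ax => /sub; rewrite porbit_sym.
  have ny : y \notin porbit (s * tperm x y) a.
    by apply: contra ay => /sub; rewrite porbit_sym.
  by rewrite (negPf nx) (negPf ny).
exact: stable_porbit_self.
Qed.

(* The [s * u]-orbit of [e] enters [F] at [e] by a jump of [u], so it also leaves
   [F] by a jump of [u]. *)
Lemma porbit_reroute s u A (F : {set T}) e :
  stable (s * u) A -> stable s F -> e \in A -> e \in F -> u^-1 e \notin F ->
  exists b, [/\ b \in F, u b \in A & u b \notin F].
Proof.
move=> sA sF eA eF uF.
have [a [ae aF aF']] :
    exists a, [/\ a \in porbit (s * u) e, a \in F & (s * u) a \notin F].
  apply: (@porbit_exit _ _ _ ((s * u)^-1 e)) => //.
    by rewrite -porbitV -eq_porbit_mem porbit_step.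
  by apply: contra uF => /sF; rewrite invMg permM permKV.
have aA := subsetP (stable_porbit sA eA) _ ae.
by exists (s a); rewrite -permM sF ?sA.
Qed.

End Orbits.

(** * Euler's inequality for combinatorial maps *)

Import GroupScope.

Section ClassCount.
Variable T : finType.
Implicit Types e : rel T.

Definition nclass e := #|[set x | root e x == x]|.

Lemma nclass_le e e' : connect_sym e -> connect_sym e' ->
  subrel e (connect e') -> nclass e' <= nclass e.
Proof.
move=> se se' ee'; pose h x := root e x.
have hinj : {in [set x | root e' x == x] &, injective h}.
  move=> a b; rewrite !inE => /eqP ra /eqP rb /(rootP se) cab.
  by rewrite -ra -rb; apply/(rootP se')/(connect_sub ee').
rewrite /nclass -(card_in_imset hinj); apply/subset_leq_card/subsetP => _ /imsetP[a _ ->].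
by rewrite inE /h root_root.
Qed.

(** Each root of [e'] is sent to its [e]-root. The classes of [x] and [y] for [e] are distinct parts
    of one class of [e'], and that class has only one root, so one of the two is missed. *)
Lemma nclass_lt e e' x y : connect_sym e -> connect_sym e' ->
  subrel e (connect e') -> connect e' x y -> ~~ connect e x y ->
  nclass e' < nclass e.
Proof.
move=> se se' ee' xy' nxy; pose h x := root e x.
have cee' := connect_sub ee'.
have hinj : {in [set x | root e' x == x] &, injective h}.
  move=> a b; rewrite !inE => /eqP ra /eqP rb /(rootP se) cab.
  by rewrite -ra -rb; apply/(rootP se')/cee'.
rewrite /nclass -(card_in_imset hinj); apply/proper_card/properP; split.
  by apply/subsetP => _ /imsetP[a _ ->]; rewrite inE /h root_root.
have rootI u : root e u \in h @: [set x | root e' x == x] ->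
    exists a, [/\ root e' a = a, root e a = root e u & connect e' a u].
  move=> /imsetP[a]; rewrite inE => /eqP ra /esym rau.
  by exists a; split=> //; apply/cee'/(rootP se).
have [/rootI[a [ra rax cax]]|] := boolP (root e x \in h @: [set x | root e' x == x]);
  last by exists (root e x); rewrite ?inE ?root_root.
have [/rootI[b [rb rby cby]]|] := boolP (root e y \in h @: [set x | root e' x == x]);
  last by exists (root e y); rewrite ?inE ?root_root.
case/negP: nxy; apply/(rootP se); rewrite -rax -rby -ra -rb.
congr (root e _); apply/(rootP se'); apply: connect_trans cax _.
by apply: connect_trans xy' _; rewrite se'.
Qed.

(** Call a point near if [e'] connects it to [x] or [y]. Points connected by [e] are connected by
    [e'] or are both near, so once the class of [y] is discarded, the roots of [e'] lie in distinct
    classes of [e]. *)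
Lemma nclass_link e e' x y : connect_sym e -> connect_sym e' ->
  (forall a b, e a b -> connect e' a b \/
    exists u v, [/\ u \in [:: x; y], v \in [:: x; y], connect e' a u & connect e' v b]) ->
  nclass e' <= (nclass e).+1.
Proof.
move=> se se' ee'; pose h x := root e x.
pose near a := connect e' a x || connect e' a y.
have near_conn a b : connect e' a b -> near a = near b.
  by move=> cab; rewrite /near !(same_connect se' cab).
have cK a b : connect e a b -> connect e' a b \/ near a /\ near b.
  move=> /connectP[p pth ->] {b}; elim: p a pth => [|b p IHp] a /=; first by left.
  case/andP => eab /IHp pb; case: (ee' _ _ eab) => [cab|].
    case: pb => [|[nb nl]]; first by left; apply: connect_trans cab _.
    by right; rewrite (near_conn _ _ cab).
  move=> [u [v [uxy vxy cau cvb]]]; right.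
  have na : near a by move: uxy cau; rewrite !inE /near => /orP[]/eqP -> ->; rewrite ?orbT.
  have nb : near b.
    by move: vxy cvb; rewrite !inE /near se' => /orP[]/eqP -> ->; rewrite ?orbT.
  by case: pb => [/near_conn <-|[]].
have [/eqP y0|] := boolP (0 == #|[set x | root e' x == x] :\ root e' y|).
  rewrite /nclass (cardsD1 (root e' y)) -y0 addn0.
  by case: (_ \in _).
move=> _; pose R := [set x | root e' x == x] :\ root e' y.
have hinj : {in R &, injective h}.
  move=> a b; rewrite !inE => /andP[ay /eqP ra] /andP[by_ /eqP rb] /(rootP se)/cK cab.
  rewrite -ra -rb; apply/(rootP se'); case: cab => // -[/= na nb].
  have nx c : root e' c = c -> c != root e' y -> connect e' c x || connect e' c y -> connect e' c x.
    by move=> rc cy /orP[// | /(rootP se') e1]; rewrite -rc e1 eqxx in cy.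
  by apply: connect_trans (nx a ra ay na) _; rewrite se'; apply: nx.
rewrite /nclass (cardsD1 (root e' y)) -/R -add1n leq_add //; first by case: (_ \in _).
rewrite -(card_in_imset hinj); apply/subset_leq_card/subsetP => _ /imsetP[a _ ->].
by rewrite inE /h root_root.
Qed.

Lemma nclassE e : connect_sym e ->
  nclass e = #|[set [set y | connect e x y] | x in T]|.
Proof.
move=> se; rewrite /nclass; pose k x := [set y | connect e x y].
have kinj : {in [set x | root e x == x] &, injective k}.
  move=> a b; rewrite !inE => /eqP ra /eqP rb kab.
  rewrite -ra -rb; apply/(rootP se).
  by have := connect0 e b; rewrite -[connect e b b]in_set -/(k b) -kab inE.
rewrite -(card_in_imset kinj); apply: eq_card => A; apply/imsetP/imsetP.
  by case=> a _ ->; exists a.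
case=> a _ ->; exists (root e a); first by rewrite inE root_root.
by apply/setP => b; rewrite !inE (same_connect se (connect_root e a)).
Qed.

End ClassCount.

Section Maps.
Variables (D : finType) (t : {perm D}).
Implicit Types (r : {perm D}) (x y d : D) (S : {set D}).

Definition step r : rel D := [rel a b | (b == t a) || (b == r a)].
Definition conn r := connect (step r).

Lemma stable_conn r S x y : stable t S -> stable r S -> x \in S -> conn r x y -> y \in S.
Proof.
move=> tS rS xS /connectP[p pth ->]; elim: p x xS pth => //= a p IHp x xS.
by case/andP => /orP[]/eqP -> /IHp; apply; [apply: tS | apply: rS].
Qed.

Lemma conn_t r x : conn r x (t x).
Proof. by apply: connect1; rewrite /step /= eqxx. Qed.

Lemma conn_r r x : conn r x (r x).
Proof. by apply: connect1; rewrite /step /= eqxx orbT. Qed.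

Definition component r x := [set y | conn r x y].

Lemma component_t r x : stable t (component r x).
Proof. by move=> a; rewrite !inE => c; apply: connect_trans c (conn_t r a). Qed.

Lemma component_r r x : stable r (component r x).
Proof. by move=> a; rewrite !inE => c; apply: connect_trans c (conn_r r a). Qed.

Lemma component_id r x : x \in component r x.
Proof. by rewrite inE; apply: connect0. Qed.

(** Steps only go forward; symmetry holds because the complement of a set stable under a permutation
    is stable again. *)
Lemma conn_sym r : connect_sym (step r).
Proof.
have sub x y : conn r x y -> conn r y x.
  move=> cxy.
  suff: x \in component r y by rewrite inE.
  rewrite -[x \in _]negbK; apply/negP => nx.
  have : y \in ~: component r y.
    apply: (@stable_conn r _ x) cxy; last by rewrite inE.
      exact: stableC (@component_t r y).
    exact: stableC (@component_r r y).
  by rewrite inE component_id.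
by move=> x y; apply/idP/idP; apply: sub.
Qed.

Lemma stable_phi r S : stable t S -> stable r S -> stable (t * r) S.
Proof. by move=> tS rS x xS; rewrite permM; apply/rS/tS. Qed.

Lemma conn_porbit r x y : y \in porbit r x -> conn r x y.
Proof.
move=> yx; suff: y \in component r x by rewrite inE.
by apply: (subsetP (stable_porbit (@component_r r x) _)) yx; apply: component_id.
Qed.

Lemma conn_face r x y : y \in porbit (t * r) x -> conn r x y.
Proof.
move=> yx; suff: y \in component r x by rewrite inE.
apply: (subsetP (stable_porbit _ (component_id r x))) yx.
exact: stable_phi (@component_t r x) (@component_r r x).
Qed.

Lemma tperm_step r x y a b : step (r * tperm x y) a b ->
  conn r a b \/
  exists u v, [/\ u \in [:: x; y], v \in [:: x; y], conn r a u & conn r v b].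
Proof.
case/orP=> /eqP ->; first by left; apply: conn_t.
rewrite permM; case: tpermP => [e|e|_ _]; last by left; apply: conn_r.
  right; exists x, y; rewrite !inE !eqxx orbT; split=> //; last exact: connect0.
  by rewrite -e; apply: conn_r.
right; exists y, x; rewrite !inE !eqxx orbT; split=> //; last exact: connect0.
by rewrite -e; apply: conn_r.
Qed.

Lemma nclass_tperm r x y : nclass (step (r * tperm x y)) <= (nclass (step r)).+1.
Proof.
apply: (@nclass_link _ _ _ x y); try exact: conn_sym.
by move=> a b; rewrite -{1}(mulr_tpermK r x y) => /tperm_step.
Qed.

Lemma sub_conn_tperm r x y : conn (r * tperm x y) x y ->
  subrel (step r) (conn (r * tperm x y)).
Proof.
move=> cxy a b; rewrite -{1}(mulr_tpermK r x y) => /tperm_step[//|].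
have cyx : conn (r * tperm x y) y x by rewrite [conn _ _ _]conn_sym.
move=> [u [v [uxy vxy cau cvb]]]; apply: connect_trans cau _.
apply: connect_trans cvb.
by move: uxy vxy; rewrite !inE => /orP[]/eqP-> /orP[]/eqP-> //; apply: connect0.
Qed.

Lemma nclass_tperm_conn r x y : conn (r * tperm x y) x y ->
  nclass (step (r * tperm x y)) <= nclass (step r).
Proof. by move=> cxy; apply: nclass_le (sub_conn_tperm cxy); apply: conn_sym. Qed.

Lemma phi_tperm r x y : t * (r * tperm x y) = t * r * tperm x y.
Proof. exact: mulgA. Qed.

(* [planar] is the half [|V| - |E| + |F| >= 2c] of Euler's formula that is not
   automatic; the other half is [euler_le]. *)
Definition euler a r :=
  #|D|./2 + (nclass (step r)).*2 + a <= #|porbits r| + #|porbits (t * r)|.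
Definition planar r := euler 0 r.

(** The numbers of vertices and of faces change by one each. Two splits pay for one new component;
    after a split and a merge [x] and [y] are connected, so no component is added; two merges are
    paid for by the component that disappears. The excluded move, two merges within one component,
    is the one that adds a handle. *)
Lemma euler_tperm n r x y : euler n r -> x != y ->
  [|| y \in porbit r x, y \in porbit (t * r) x | ~~ conn r x y] ->
  euler n (r * tperm x y).
Proof.
rewrite /euler phi_tperm => pl xy.
have [rxy _|nrxy] := boolP (y \in porbit r x).
  have Vs := card_porbits_split xy rxy.
  have [fxy|nfxy] := boolP (y \in porbit (t * r) x).
    have Fs := card_porbits_split xy fxy.
    by have := nclass_tperm r x y; lia.
  have Fm := card_porbits_merge nfxy.
  suff /nclass_tperm_conn : conn (r * tperm x y) x y by lia.
  by apply: conn_face; rewrite phi_tperm mem_porbit_merge.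
have cxy : conn (r * tperm x y) x y by apply/conn_porbit/mem_porbit_merge.
have Vm := card_porbits_merge nrxy; have Cl := nclass_tperm_conn cxy.
have [fxy _|nfxy ncxy] := boolP (y \in porbit (t * r) x).
  by have Fs := card_porbits_split xy fxy; lia.
have Fm := card_porbits_merge nfxy.
have Cm : nclass (step (r * tperm x y)) < nclass (step r).
  by apply: nclass_lt (sub_conn_tperm cxy) cxy ncxy; apply: conn_sym.
by lia.
Qed.

Lemma restr_in S r d : stable r S -> d \in S -> restr_perm S r d = r d.
Proof. by move=> rS dS; apply: restr_permE => //; apply/astabsP => x /=; apply: stable_mem. Qed.

Lemma restr_out S r d : d \notin S -> restr_perm S r d = d.
Proof. exact: out_perm (restr_perm_on S r). Qed.

Lemma stable_restr S r A : stable r S -> stable r A -> stable (restr_perm S r) A.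
Proof.
move=> rS rA d dA; have [dS|dS] := boolP (d \in S); last by rewrite restr_out.
by rewrite restr_in ?rA.
Qed.

(* The darts outside [S] are split off one at a time. *)
Lemma euler_restr n r S : stable r S -> euler n r -> euler n (restr_perm S r).
Proof.
have [m] := ubnP #|[set d in ~: S | r d != d]|; elim: m r => // m IHm r.
rewrite ltnS => cnt rS er.
have [/eqP e0|/set0Pn[x]] := boolP ([set d in ~: S | r d != d] == set0).
  suff -> : restr_perm S r = r by [].
  apply/permP => d; have [dS|dS] := boolP (d \in S); first exact: restr_in.
  by have := in_set0 d; rewrite -e0 !inE restr_out // dS /= => /negbFE/eqP ->.
rewrite !inE => /andP[xS rx]; pose r' := r * tperm x (r x).
have rxS : r x \notin S by rewrite stable_mem.
have r'S : stable r' S by apply: stable_tperm => //; rewrite (negPf xS) (negPf rxS).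
have -> : restr_perm S r = restr_perm S r'.
  apply/permP => d; have [dS|dS] := boolP (d \in S); last by rewrite !restr_out.
  rewrite !restr_in // permM tpermD //.
    by apply: contraNneq xS => ->; apply: rS.
  by apply: contraNneq rxS => ->; apply: rS.
apply: IHm => //; last first.
  apply: euler_tperm => //; first by rewrite eq_sym.
  by rewrite -eq_porbit_mem porbit_step eqxx.
apply: leq_trans cnt; apply/proper_card/properP; split.
  apply/subsetP => d; rewrite !inE => /andP[-> /=]; apply: contra => /eqP rd.
  rewrite permM rd; case: tpermP => // dx; first by rewrite -dx rd.
  by case/negP: rx; apply/eqP/(@perm_inj _ r); rewrite -dx.
by exists x; rewrite !inE ?xS ?rx // permM tpermR eqxx andbF.
Qed.

Hypotheses (tK : involutive t) (tN : forall d, t d != d).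

Lemma porbit_invol (s : {perm D}) x : s (s x) = x -> porbit s x = [set x; s x].
Proof.
move=> sx; apply/eqP; rewrite eqEsubset; apply/andP; split.
  apply: stable_porbit; last by rewrite !inE eqxx.
  by move=> a; rewrite !inE => /orP[]/eqP ->; rewrite ?sx eqxx ?orbT.
apply/subsetP => a; rewrite !inE => /orP[]/eqP ->; first exact: porbit_id.
by rewrite -eq_porbit_mem porbit_step.
Qed.

Lemma porbit_partition (s : {perm D}) S : stable s S -> partition (porbit s @: S) S.
Proof.
move=> sS; apply/and3P; split.
- rewrite cover_imset; apply/eqP/setP => x; apply/bigcupP/idP => [[y yS]|xS].
    by apply: (subsetP (stable_porbit _ _)).
  by exists x => //; apply: porbit_id.
- apply/trivIsetP => _ _ /imsetP[x _ ->] /imsetP[y _ ->] nxy.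
  rewrite -setI_eq0; apply: contraNT nxy => /set0Pn[z]; rewrite inE => /andP[].
  by move=> /porbit_eq-> /porbit_eq->.
- apply/negP => /imsetP[x _ e]; have := porbit_id s x.
  by rewrite -e inE.
Qed.

Lemma card_porbits_invol (s : {perm D}) S : stable s S ->
  (forall x, x \in S -> s (s x) = x /\ s x != x) -> #|porbit s @: S|.*2 = #|S|.
Proof.
move=> sS inv; rewrite -muln2; apply/esym; apply: card_uniform_partition.
  move=> _ /imsetP[x /inv[ssx sx] ->].
  by rewrite porbit_invol // cards2 eq_sym sx.
exact: porbit_partition.
Qed.

Lemma card_porbits_t : #|porbits t|.*2 = #|D|.
Proof.
have <- : porbit t @: [set: D] = porbits t.
  by apply/setP => A; apply/imsetP/imsetP => -[x _ ->]; exists x.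
rewrite card_porbits_invol ?cardsT // => x _; rewrite ?inE ?tK ?tN //.
Qed.

(** A violation would say [euler 1 r], and this survives restriction to the empty set, that is, to
    the rotation [1]. There every component is a single edge with two vertices and one face, and the
    slack is zero. *)
Lemma euler_le r : #|porbits r| + #|porbits (t * r)| <= #|D|./2 + (nclass (step r)).*2.
Proof.
rewrite leqNgt; apply/negP => lt.
have st : stable r set0 by move=> d; rewrite inE.
have /(euler_restr st) : euler 1 r by rewrite /euler addn1.
have -> : restr_perm set0 r = 1 by apply/permP => d; rewrite restr_out ?inE ?perm1.
rewrite /euler mulg1 nclassE; last exact: conn_sym.
have -> : #|[set [set y | connect (step 1) x y] | x in D]| = #|porbits t|.
  apply: eq_card => A.
  have cE x : [set y | connect (step 1) x y] = porbit t x.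
    apply/eqP; rewrite eqEsubset; apply/andP; split.
      apply/subsetP => y; rewrite inE => /stable_conn; apply; last exact: porbit_id.
        exact: stable_porbit_self.
      by move=> a; rewrite perm1.
    apply/subsetP => y yx; rewrite inE.
    by apply: conn_face; rewrite mulg1.
  by apply/imsetP/imsetP => -[x _ ->]; exists x.
have := card_porbits_t.
have : #|porbits (1 : {perm D})| <= #|D| by apply: leq_imset_card.
by lia.
Qed.

Lemma planar_eq r : planar r ->
  #|porbits r| + #|porbits (t * r)| = #|D|./2 + (nclass (step r)).*2.
Proof. by rewrite /planar /euler addn0 => pl; apply/eqP; rewrite eqn_leq euler_le. Qed.

(* Jordan's theorem for the closed curve that runs inside a face from the corner [x]
   to the corner [y] of the same vertex. *)
Lemma jordan1 r x y : planar r -> x != y ->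
  y \in porbit r x -> y \in porbit (t * r) x -> ~~ conn (r * tperm x y) x y.
Proof.
move=> /planar_eq pl xy rxy fxy; apply/negP => /nclass_tperm_conn.
have := euler_le (r * tperm x y); rewrite phi_tperm.
by rewrite (card_porbits_split xy rxy) (card_porbits_split xy fxy); lia.
Qed.

End Maps.

(** * Colorings of maps *)

(** Along [h], [G] distinguishes at least as much as [F]. This serves to compare numbers of
    vertices, faces or colors between different maps. *)
Lemma card_imset_le (A1 A2 B1 B2 : finType) (F : A1 -> B1) (G : A2 -> B2)
    (S1 : {set A1}) (S2 : {set A2}) (h : A1 -> A2) :
  (forall a, a \in S1 -> h a \in S2) ->
  (forall a b, a \in S1 -> b \in S1 -> G (h a) = G (h b) -> F a = F b) ->
  #|F @: S1| <= #|G @: S2|.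
Proof.
move=> hS hFG; pose R := [set [set a in S1 | G (h a) == y] | y in G @: S2].
apply: (@leq_trans #|R|); last exact: leq_imset_card.
have [->|/set0Pn[a0 a0S]] := eqVneq S1 set0; first by rewrite imset0 cards0.
pose pk (X : {set A1}) := F (odflt a0 [pick a in X]).
apply: leq_trans (leq_imset_card pk _).
apply/subset_leq_card/subsetP => _ /imsetP[a aS ->].
apply/imsetP; exists [set b in S1 | G (h b) == G (h a)].
  by apply/imsetP; exists (G (h a)) => //; apply: imset_f; apply: hS.
rewrite /pk; case: pickP => [b|/(_ a)]; rewrite !inE ?aS ?eqxx //.
by case/andP => bS /eqP e; apply: hFG.
Qed.

Lemma perm_matching (T : finType) (s1 s2 : seq T) :
  uniq s1 -> uniq s2 -> size s1 = size s2 ->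
  exists p : {perm T}, map p s1 = s2.
Proof.
elim: s1 s2 => [|a s1 IHs] [|b s2] //=; first by exists 1.
case/andP=> as1 us1 /andP[bs2 us2] [/(IHs _ us1 us2)[p ps]].
exists (p * tperm (p a) b); rewrite permM tpermL; congr (_ :: _).
rewrite -[RHS]ps; apply/eq_in_map => c cs.
rewrite permM tpermD //; first by rewrite (inj_eq perm_inj); apply: contraNneq as1 => ->.
by apply: contraNneq bs2 => ->; rewrite -ps map_f.
Qed.

Lemma ex_subset_card (T : finType) (A : {set T}) n :
  n <= #|A| -> exists2 B : {set T}, B \subset A & #|B| = n.
Proof.
move=> nA; exists [set x in take n (enum A)].
  by apply/subsetP => x; rewrite inE => /mem_take; rewrite mem_enum.
by rewrite cardsE (card_uniqP _) ?take_uniq ?enum_uniq // size_takel // -cardE.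
Qed.

(** Hall's condition for two sets: [A'] takes as much as it can outside [B], so it takes from
    [A :&: B] only what is unavoidable. *)
Lemma ex_disjoint_subsets (T : finType) (A B : {set T}) m n :
  m <= #|A| -> n <= #|B| -> m + n <= #|A :|: B| ->
  exists A' B' : {set T},
    [/\ A' \subset A, B' \subset B, [disjoint A' & B'], #|A'| = m & #|B'| = n].
Proof.
move=> mA nB mnAB; have [le|lt] := leqP m #|A :\: B|.
  have [A' sA' cA'] := ex_subset_card le; have [B' sB' cB'] := ex_subset_card nB.
  exists A', B'; split=> //; first by apply: subset_trans sA' (subsetDl _ _).
  rewrite disjoint_subset; apply/subsetP => a /(subsetP sA'); rewrite !inE => /andP[aB _].
  by apply: contra aB => /(subsetP sB').
have cAD := cardsID B A.
have /ex_subset_card[A1 sA1 cA1] : m - #|A :\: B| <= #|A :&: B| by lia.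
pose A' := (A :\: B) :|: A1.
have cA' : #|A'| = m.
  rewrite cardsU cA1; suff -> : (A :\: B) :&: A1 = set0 by rewrite cards0; lia.
  apply/setP => a; rewrite !inE; apply/negP => /andP[/andP[aB _] /(subsetP sA1)].
  by rewrite inE (negPf aB) andbF.
have sA' : A' \subset A.
  by rewrite subUset subsetDl (subset_trans sA1) ?subsetIl.
have eAB : A :|: B = A' :|: B :\: A'.
  apply/setP => a; rewrite !inE; case: (boolP (a \in A1)) => [/(subsetP sA1)|_].
    by rewrite inE => /andP[-> ->]; rewrite orbT.
  by case: (a \in A); case: (a \in B).
have /ex_subset_card[B' sB' cB'] : n <= #|B :\: A'|.
  have := cardsUI A' (B :\: A'); rewrite -eAB.
  by move: (leq_addr #|A' :&: (B :\: A')| #|A :|: B|); lia.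
exists A', B'; split=> //; first by apply: subset_trans sB' (subsetDl _ _).
by rewrite disjoint_sym disjoint_subset; apply/subsetP => b /(subsetP sB'); rewrite !inE => /andP[].
Qed.

Section Colorings.
Variables (D : finType) (t : {perm D}).
Hypotheses (tK : involutive t) (tN : forall d, t d != d).
Variables (k m : nat).
Hypothesis (km : k = (3 * m) %/ 2).
Implicit Types (r : {perm D}) (x y d : D) (S : {set D}).

Definition loopless_map r := forall d, t d \notin porbit r d.
Definition proper_map r (c : D -> 'I_k) :=
  (forall d, c (r d) = c d) /\
  (forall d e, e \in porbit (t * r) d -> c d = c e -> e \in porbit r d).
Definition colorable r := exists c, proper_map r c.
(** Vertices are counted, not corners: a vertex that occurs twice on the face counts once, as in
    [face_degree]. *)
Definition degree r d := #|porbit r @: porbit (t * r) d|.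
Definition good r := [/\ planar t r, loopless_map r & forall d, degree r d <= m].
Definition moved r := [set d | r d != d].

Lemma leq_mk : m <= k.
Proof. by rewrite km; lia. Qed.

Lemma proper_orbit r c d e : proper_map r c -> e \in porbit r d -> c e = c d.
Proof.
case=> cr _ /porbitP[i ->]; elim: i => [|i IHi]; first by rewrite expg0 perm1.
by rewrite expgSr permM cr.
Qed.

Lemma proper_face r c d e : proper_map r c -> e \in porbit (t * r) d ->
  (c d == c e) = (e \in porbit r d).
Proof.
move=> pc fe; apply/eqP/idP; first by case: pc => _; apply.
by move=> /(proper_orbit pc).
Qed.

Lemma mem_face_step r d : r (t d) \in porbit (t * r) d.
Proof. by rewrite -permM -eq_porbit_mem porbit_step. Qed.

Lemma good_ge2 r d : good r -> 1 < m.
Proof.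
case=> _ ll /(_ d); apply: leq_trans; rewrite /degree.
have -> : 2 = #|[set porbit r d; porbit r (t d)]|.
  by rewrite cards2 eq_porbit_mem porbit_sym (negPf (ll d)).
apply/subset_leq_card/subsetP => A; rewrite !inE => /orP[]/eqP->.
  by rewrite imset_f ?porbit_id.
by rewrite -porbit_step imset_f ?mem_face_step.
Qed.

Section Restriction.
Variables (r : {perm D}) (S : {set D}).
Hypotheses (tS : stable t S) (rS : stable r S).
Let rs := restr_perm S r.

Lemma eq_porbit_stable (s s' : {perm D}) (A : {set D}) d :
  stable s A -> {in A, s =1 s'} -> d \in A -> porbit s' d = porbit s d.
Proof.
move=> sA eqs dA.
have s'A : stable s' A by move=> a aA; rewrite -eqs // sA.
have st : stable s' (porbit s d).
  move=> a ad; rewrite -eqs; first exact: stable_porbit_self.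
  exact: (subsetP (stable_porbit sA dA)).
have st' : stable s (porbit s' d).
  move=> a ad; rewrite eqs; first exact: stable_porbit_self.
  exact: (subsetP (stable_porbit s'A dA)).
by apply/eqP; rewrite eqEsubset !stable_porbit ?porbit_id.
Qed.

Lemma restr_porbit d : d \in S -> porbit rs d = porbit r d.
Proof.
by apply: eq_porbit_stable => // a aS; rewrite /rs restr_in.
Qed.

Lemma restr_face d : d \in S -> porbit (t * rs) d = porbit (t * r) d.
Proof.
apply: eq_porbit_stable; first exact: stable_phi.
by move=> a aS; rewrite !permM restr_in ?tS.
Qed.

Lemma restr_porbit_out d : d \notin S -> porbit rs d = [set d].
Proof. by move=> dS; rewrite porbit_invol !restr_out // setUid. Qed.

Lemma restr_face_out d : d \notin S -> porbit (t * rs) d = [set d; t d].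
Proof.
by move=> dS; rewrite porbit_invol !permM !restr_out ?stable_mem // tK.
Qed.

(** Outside [S] every edge becomes a component whose only face has two vertices; this is what
    [1 < m] pays for. *)
Lemma restr_good : 1 < m -> planar t r -> loopless_map r ->
  (forall d, d \in S -> degree r d <= m) -> good rs.
Proof.
move=> m2 pl ll deg; split; first exact: euler_restr.
  move=> d; have [dS|dS] := boolP (d \in S); first by rewrite restr_porbit.
  by rewrite restr_porbit_out // inE tN.
move=> d; rewrite /degree; have [dS|dS] := boolP (d \in S).
  rewrite restr_face //; apply: leq_trans (deg d dS).
  suff -> : porbit rs @: porbit (t * r) d = porbit r @: porbit (t * r) d by [].
  apply: eq_in_imset => a ad; rewrite restr_porbit //.
  by apply: (subsetP (stable_porbit _ dS)) ad; apply: stable_phi.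
rewrite restr_face_out //; apply: leq_trans m2.
by rewrite (leq_trans (leq_imset_card _ _)) // cards2; case: (d != t d).
Qed.

Lemma moved_restr : moved rs \subset moved r :&: S.
Proof.
apply/subsetP => d; rewrite !inE; have [dS|dS] := boolP (d \in S).
  by rewrite restr_in // andbT.
by rewrite restr_out ?eqxx.
Qed.

End Restriction.

Lemma proper_glue r S c1 c2 : stable t S -> stable r S ->
  proper_map (restr_perm S r) c1 -> proper_map (restr_perm (~: S) r) c2 ->
  proper_map r (fun d => if d \in S then c1 d else c2 d).
Proof.
move=> tS rS p1 p2; have tS' := stableC tS; have rS' := stableC rS.
have fS := stable_phi tS rS.
split=> [d|d e fe].
  rewrite stable_mem //; case: ifPn => dS.
    by rewrite -(proj1 p1 d) restr_in.
  by rewrite -(proj1 p2 d) restr_in ?inE.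
have eS : (e \in S) = (d \in S).
  apply/idP/idP => h; last exact: (subsetP (stable_porbit fS h)).
  by apply: (subsetP (stable_porbit fS h)); rewrite porbit_sym.
rewrite eS; case: ifPn => dS; move/eqP.
  by rewrite (proper_face p1) ?restr_face // restr_porbit.
by rewrite (proper_face p2) ?restr_face ?inE // restr_porbit ?inE.
Qed.

Lemma proper_recolor r c (p : {perm 'I_k}) : proper_map r c -> proper_map r (fun d => p (c d)).
Proof.
case=> cr cf; split=> [d|d e fe]; first by rewrite cr.
by move/perm_inj/cf; apply.
Qed.

Lemma colorable_disconnected r x y : good r ->
  (forall r', good r' -> #|moved r'| < #|moved r| -> colorable r') ->
  x \in moved r -> y \in moved r -> ~~ conn t r x y -> colorable r.
Proof.
move=> gr IH xm ym nxy; have m2 := good_ge2 x gr; case: gr => pl ll deg.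
pose S := component t r x; have tS : stable t S := @component_t _ t r x.
have rS : stable r S := @component_r _ t r x.
have [c1 p1] : colorable (restr_perm S r).
  apply: IH; first exact: restr_good.
  apply/proper_card; apply: sub_proper_trans (moved_restr rS) _.
  apply/properP; split; first exact: subsetIl.
  by exists y => //; rewrite in_setI [y \in S]inE (negPf nxy) andbF.
have [c2 p2] : colorable (restr_perm (~: S) r).
  have [tS' rS'] := (stableC tS, stableC rS).
  apply: IH; first exact: restr_good.
  apply/proper_card; apply: sub_proper_trans (moved_restr rS') _.
  apply/properP; split; first exact: subsetIl.
  by exists x; rewrite // in_setI in_setC component_id andbF.
by eexists; apply: proper_glue p1 p2.
Qed.

Lemma split_porbit_sub r x y d : y \in porbit r x ->
  porbit (r * tperm x y) d \subset porbit r d.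
Proof.
move=> yx; apply: stable_porbit; last exact: porbit_id.
apply: stable_tperm; last exact: stable_porbit_self.
by rewrite ![_ \in porbit r d]porbit_sym -!eq_porbit_mem (porbit_eq yx).
Qed.

Lemma moved_tperm r x y : r x != x -> r y != y -> moved (r * tperm x y) \subset moved r.
Proof.
move=> rx ry; apply/subsetP => d; rewrite !inE; apply: contra => /eqP rd.
by rewrite permM rd tpermD //; apply/eqP => e; rewrite e rd eqxx in rx ry.
Qed.

Lemma orbit_moved r x y : y \in porbit r x -> x != y -> r x != x.
Proof.
move=> yx; apply: contra => /eqP rx; move: yx.
by rewrite porbit_invol ?rx // setUid inE eq_sym.
Qed.

(** Cutting the vertex between its corners [x] and [y] separates the map, by [jordan1], and divides
    the face into [f1] and [f2]. Apart from the cut vertex, no vertex is on both. So the numbers of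
    colors on [f1] and on the rest of [f2] add up to at most the degree of the face, and permuting
    colors makes the two sets disjoint. *)
Lemma colorable_repeated r x y : good r ->
  (forall r', good r' -> #|moved r'| < #|moved r| -> colorable r') ->
  x != y -> y \in porbit r x -> y \in porbit (t * r) x -> colorable r.
Proof.
move=> gr IH xy ryx fyx; have m2 := good_ge2 x gr; case: gr => pl ll deg.
pose r1 := r * tperm x y; have phi1 : t * r1 = t * r * tperm x y by rewrite phi_tperm.
have pl1 : planar t r1 by apply: euler_tperm => //; rewrite ryx.
pose S := component t r1 x; have tS : stable t S := @component_t _ t r1 x.
have r1S : stable r1 S := @component_r _ t r1 x.
have [tS' r1S'] := (stableC tS, stableC r1S).
have xS : x \in S := component_id t r1 x.
have yS : y \notin S by rewrite inE; apply: jordan1.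
have rx := orbit_moved ryx xy.
have ry : r y != y by apply: (@orbit_moved _ _ x); rewrite 1?porbit_sym 1?eq_sym.
have ll1 : loopless_map r1.
  by move=> d; apply: contra (ll d); apply: (subsetP (split_porbit_sub _ ryx)).
(* The two parts of the cut vertex lie on different sides, so corners of one side that shared a
   vertex still do. *)
have vS a b : (a \in S) = (b \in S) -> b \in porbit r a -> b \in porbit r1 a.
  move=> abS ba; have [ax|ax] := boolP (a \in porbit r x); last first.
    rewrite porbit_tperm_out //.
    by rewrite -(porbit_eq ryx).
  have bx : b \in porbit r x by rewrite (porbit_eq ax).
  have out c d : c \in porbit r1 d -> (c \in S) = (d \in S).
    move=> cd; apply/idP/idP => h; last exact: (subsetP (stable_porbit r1S h)).
    by apply: (subsetP (stable_porbit r1S h)); rewrite porbit_sym.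
  move: ax bx; rewrite (porbit_split ryx) -/r1 !inE.
  case/orP => ha /orP[] hb; move: (out _ _ ha) (out _ _ hb) abS;
    rewrite ?xS ?(negPf yS) => -> -> // _; by rewrite -(porbit_eq ha).
have f1sub d : porbit (t * r1) d \subset porbit (t * r) d by rewrite phi1 split_porbit_sub.
have deg1 d : degree r1 d <= m.
  apply: leq_trans (deg d); apply: (@card_imset_le _ _ _ _ _ _ _ _ id).
    exact/subsetP.
  move=> a b ad bd /= e; apply/eqP; rewrite eq_porbit_mem porbit_sym.
  apply: vS; last by rewrite e porbit_id.
  have sm c : c \in porbit (t * r1) d -> (c \in S) = (d \in S).
    move=> cd; have fS := stable_phi tS r1S; apply/idP/idP => h.
      by apply: (subsetP (stable_porbit fS h)); rewrite porbit_sym.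
    exact: (subsetP (stable_porbit fS h)).
  by rewrite !sm.
have [c1 p1] : colorable (restr_perm S r1).
  apply: IH; first exact: restr_good.
  apply/proper_card; apply: sub_proper_trans (moved_restr r1S) _.
  apply/properP; split; first by rewrite subIset ?moved_tperm.
  by exists y; rewrite ?in_setI ?(negPf yS) ?andbF // inE.
have [c2 p2] : colorable (restr_perm (~: S) r1).
  apply: IH; first exact: restr_good.
  apply/proper_card; apply: sub_proper_trans (moved_restr r1S') _.
  apply/properP; split; first by rewrite subIset ?moved_tperm.
  by exists x; rewrite ?in_setI ?in_setC ?xS ?andbF // inE.
pose f1 := porbit (t * r1) x; pose f2 := porbit (t * r1) y.
have f1S a : a \in f1 -> a \in S.
  exact: (subsetP (stable_porbit (stable_phi tS r1S) xS)).
have f2S a : a \in f2 -> a \notin S.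
  move=> af; have := subsetP (stable_porbit (stable_phi tS' r1S') _) a af.
  by rewrite !in_setC => ->.
have r1r a b : b \in porbit r1 a -> b \in porbit r a.
  exact: (subsetP (split_porbit_sub _ ryx)).
pose C1 := c1 @: f1; pose C2 := c2 @: f2 :\ c2 y.
have c1S a b : a \in S -> b \in porbit r1 a -> c1 a = c1 b.
  by move=> aS ba; apply/esym/(proper_orbit p1); rewrite restr_porbit.
have c2S a b : a \notin S -> b \in porbit r1 a -> c2 a = c2 b.
  by move=> aS ba; apply/esym/(proper_orbit p2); rewrite restr_porbit ?in_setC.
have cC1 : #|C1| <= #|porbit r @: f1|.
  apply: (@card_imset_le _ _ _ _ _ _ _ _ id) => // a b af bf /= e.
  by apply: c1S; rewrite ?f1S // vS ?f1S // e porbit_id.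
have cC2 : #|C2| <= #|porbit r @: (f2 :\: porbit r x)|.
  have -> : C2 = c2 @: (f2 :\: porbit r x).
    apply/setP => c; rewrite !inE; apply/andP/imsetP.
      case=> cy /imsetP[a af e]; exists a => //; rewrite inE af andbT.
      apply: contra cy => ax; rewrite e; apply/eqP/esym.
      apply: c2S => //; apply: vS; first by rewrite (negPf (f2S _ af)) (negPf yS).
      by rewrite -(porbit_eq ryx).
    case=> a; rewrite inE => /andP[ax af] ->; split; last exact: imset_f.
    apply: contra ax; rewrite eq_sym (proper_face p2) ?restr_porbit ?in_setC //.
      by rewrite (porbit_eq ryx); apply: r1r.
    by rewrite restr_face ?in_setC.
  apply: (@card_imset_le _ _ _ _ _ _ _ _ id) => // a b.
  rewrite !inE => /andP[_ af] /andP[_ bf] /= e.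
  by apply: c2S; rewrite ?f2S // vS ?e ?porbit_id // (negPf (f2S _ af)) (negPf (f2S _ bf)).
have cC : #|C1| + #|C2| <= k.
  apply: (@leq_trans m); last exact: leq_mk.
  apply: leq_trans (deg x); apply: leq_trans (leq_add cC1 cC2) _.
  rewrite -cardsUI (_ : _ :&: _ = set0) ?cards0 ?addn0.
    rewrite /degree (porbit_split fyx) -phi1 -imsetU.
    by apply/subset_leq_card/imsetS/setUS/subsetDl.
  apply/setP => A; rewrite !inE; apply/negP => /andP[/imsetP[a af ->] /imsetP[b]].
  rewrite inE => /andP[bx bf] e.
  have ab : b \in porbit r a by rewrite e porbit_id.
  have ax : a \notin porbit r x by rewrite -eq_porbit_mem e eq_porbit_mem.
  have : b \in S; last by rewrite (negPf (f2S _ bf)).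
  have : porbit r1 a \subset S by apply: stable_porbit => //; apply: f1S.
  by move/subsetP; apply; rewrite porbit_tperm_out // -(porbit_eq ryx).
have /ex_subset_card[B sB cB] : #|C2| <= #|~: C1|.
  by move: cC (cardsC C1); rewrite card_ord; clear; lia.
(* The cut vertex takes its color from the side of [x]; the other colors of [f2] go to colors that
   do not occur on [f1]. *)
have [p] : exists p : {perm 'I_k}, map p (c2 y :: enum C2) = c1 x :: enum B.
  apply: perm_matching; rewrite /= ?enum_uniq ?andbT ?mem_enum //.
  - by rewrite !inE eqxx.
  - by apply/negP => /(subsetP sB); rewrite inE imset_f ?porbit_id.
  - by rewrite -!cardE cB.
case=> py pC2.
have pC a : a \in f2 -> a \notin porbit r1 y -> p (c2 a) \notin C1.
  move=> af ay; have : p (c2 a) \in B.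
    rewrite -mem_enum -pC2 map_f // mem_enum !inE imset_f ?andbT //.
    rewrite eq_sym (proper_face p2) ?restr_porbit ?restr_face ?in_setC //.
  by move/(subsetP sB); rewrite inE.
have pr1 := proper_glue tS r1S p1 (proper_recolor p p2).
set c := fun d => _ in pr1; exists c; split=> [d|d e de].
  have cxy : c x = c y by rewrite /c xS (negPf yS) py.
  rewrite -(proj1 pr1 d) permM; case: tpermP => // ->; rewrite cxy //.
have glue a b : a \in f1 -> b \in f2 -> c a = c b -> a \in porbit r x /\ b \in porbit r x.
  move=> af bf; rewrite /c (f1S _ af) (negPf (f2S _ bf)) => cab.
  have by_ : b \in porbit r1 y.
    by apply: contraT => /(pC _ bf); rewrite -cab imset_f.
  have : c1 x == c1 a by rewrite cab -py; apply/eqP; congr (p _); apply: c2S.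
  rewrite (proper_face p1) ?restr_porbit ?restr_face // => ax; split; first exact: r1r.
  by rewrite (porbit_eq ryx); apply: r1r.
have [dx|dx] := boolP (d \in porbit (t * r) x); last first.
  move=> cde; apply/r1r; apply: (proj2 pr1) cde.
  by rewrite phi1 porbit_tperm_out // -(porbit_eq fyx).
have ex : e \in porbit (t * r) x by rewrite (porbit_eq dx).
have same u v w : u \in porbit (t * r1) w -> v \in porbit (t * r1) w ->
    c u = c v -> v \in porbit r u.
  by move=> uw vw cuv; apply/r1r/(proj2 pr1) => //; rewrite -(porbit_eq uw).
move: dx ex; rewrite (porbit_split fyx) -phi1 !inE => /orP[] df /orP[] ef.
- exact: same df ef.
- by case/(glue _ _ df ef) => dx ex; rewrite -(porbit_eq dx).
- by move/esym => /(glue _ _ ef df)[ex dx]; rewrite -(porbit_eq dx).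
- exact: same df ef.
Qed.

End Colorings.

(** * Cutting along a curve through two vertices *)

Section Quads.
Variables (D : finType) (t : {perm D}).
Hypotheses (tK : involutive t) (tN : forall d, t d != d).
Implicit Types (r : {perm D}) (x y z w d : D) (S : {set D}).

(* [x] and [y] are corners of one vertex, [z] and [w] of another one;
   [x] and [z] are corners of one face, [y] and [w] of another one.
   [cut2] cuts the surface along the closed curve through these two vertices
   and these two faces. *)
Definition quad r x y z w :=
  [&& y \in porbit r x, w \in porbit r z, z \notin porbit r x,
      z \in porbit (t * r) x, w \in porbit (t * r) y & y \notin porbit (t * r) x].
Definition swap2 x y z w : {perm D} := tperm x y * tperm z w.
Definition cut2 r x y z w := r * tperm x y * tperm z w.
(** A side may be any union of components of the cut map that separates [x] from [y], so that
    complements of sides are sides. *)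
Definition separated r x y z w S :=
  [/\ quad r x y z w, stable t S, stable (cut2 r x y z w) S, x \in S & y \notin S].

Lemma quadE r x y z w : quad r x y z w =
  [&& porbit r y == porbit r x, porbit r w == porbit r z, porbit r z != porbit r x,
      porbit (t * r) z == porbit (t * r) x, porbit (t * r) w == porbit (t * r) y
    & porbit (t * r) y != porbit (t * r) x].
Proof. by rewrite !eq_porbit_mem. Qed.

Lemma quad_sym r x y z w : quad r x y z w -> quad r y x w z.
Proof.
rewrite !quadE => /and5P[/eqP-> /eqP-> n /eqP-> /andP[/eqP-> n']].
by rewrite !eqxx n eq_sym n'.
Qed.

Lemma quad_flip r x y z w : quad r x y z w -> quad r z w x y.
Proof.
rewrite !quadE => /and5P[/eqP-> /eqP-> n /eqP-> /andP[/eqP-> n']].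
by rewrite !eqxx n' eq_sym n.
Qed.

Lemma quad_neq r x y z w : quad r x y z w ->
  [/\ x != y, z != w, x != z & [/\ x != w, y != z & y != w]].
Proof.
rewrite quadE => /and5P[/eqP e1 /eqP e2 n /eqP e3 /andP[/eqP e4 n']].
split; [| | |split]; apply/eqP => e; move: n n'.
- by rewrite e eqxx.
- by rewrite -e4 -e3 e eqxx.
- by rewrite e eqxx.
- by rewrite e -e2 eqxx.
- by rewrite -e1 e eqxx.
- by rewrite -e2 -e e1 eqxx.
Qed.

Lemma cut2_sym r x y z w : cut2 r y x w z = cut2 r x y z w.
Proof. by rewrite /cut2 tpermC [tperm w z]tpermC. Qed.

Lemma cut2_flip r x y z w : quad r x y z w -> cut2 r z w x y = cut2 r x y z w.
Proof.
move=> /quad_neq[xy zw xz [xw yz yw]]; rewrite /cut2 -!mulgA; congr (r * _).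
by rewrite conjgC tpermJ !tpermD // eq_sym.
Qed.

Section OneQuad.
Variables (r : {perm D}) (x y z w : D).
Hypothesis q : quad r x y z w.
Let f := porbit (t * r) x.
Let g := porbit (t * r) y.
Let r2 := cut2 r x y z w.

Lemma cut2_phi : t * r2 = t * r * swap2 x y z w.
Proof. by rewrite /r2 /cut2 /swap2 !mulgA. Qed.

Lemma cut2_phiE : t * r2 = t * r * tperm x y * tperm z w.
Proof. by rewrite /r2 /cut2 !mulgA. Qed.

Lemma swap2V : (swap2 x y z w)^-1 = swap2 x y z w.
Proof.
have [xy zw xz [xw yz yw]] := quad_neq q; rewrite /swap2 invMg !tpermV.
by rewrite conjgC tpermJ !tpermD // eq_sym.
Qed.

Lemma swap2E :
  [/\ swap2 x y z w x = y, swap2 x y z w y = x, swap2 x y z w z = w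
    & swap2 x y z w w = z].
Proof.
have [xy zw xz [xw yz yw]] := quad_neq q.
split; rewrite permM ?tpermL ?tpermR.
- by rewrite tpermD // eq_sym.
- by rewrite tpermD // eq_sym.
- by rewrite (@tpermD _ x y) ?tpermL // eq_sym.
- by rewrite (@tpermD _ x y) ?tpermR // eq_sym.
Qed.

Lemma swap2D d : d \notin [:: x; y; z; w] -> swap2 x y z w d = d.
Proof.
rewrite !inE !negb_or => /and4P[dx dy dz dw].
by rewrite permM !tpermD //; rewrite eq_sym.
Qed.

Lemma quad_faces :
  [/\ x \in f, z \in f, y \in g, w \in g & [/\ y \notin f, w \notin f, x \notin g & z \notin g]].
Proof.
move: q; rewrite quadE => /and5P[_ _ _ /eqP fz /andP[/eqP fw nf]].
rewrite /f /g -!eq_porbit_mem fz fw !eqxx nf.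
by rewrite ![_ == porbit _ y]eq_sym nf.
Qed.

Lemma disjoint_faces d : d \in f -> d \in g -> False.
Proof.
have [_ _ _ _ [nyf _ _ _]] := quad_faces.
move=> df dg; case/negP: nyf; rewrite /f (porbit_eq df) porbit_sym.
exact: dg.
Qed.

Lemma cut2_face1 : porbit (t * r * tperm x y) x = f :|: g.
Proof.
by have [_ _ _ _ [nyf _ _ _]] := quad_faces; rewrite porbit_merge.
Qed.

(** The first transposition merges the faces [f] and [g]; the second splits the result again, into
    the outer faces of the two sides. *)
Lemma cut2_outer : f :|: g = porbit (t * r2) z :|: porbit (t * r2) w.
Proof.
have [_ zf _ wg _] := quad_faces.
have zo : z \in porbit (t * r * tperm x y) x by rewrite cut2_face1 inE zf.
rewrite cut2_phiE -cut2_face1 (porbit_eq zo); apply: porbit_split.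
by rewrite -(porbit_eq zo) cut2_face1 inE wg orbT.
Qed.

Lemma cut2_face d : d \notin f -> d \notin g -> porbit (t * r2) d = porbit (t * r) d.
Proof.
move=> df dg; rewrite cut2_phiE.
have [_ zf _ wg _] := quad_faces.
have d1 : d \notin porbit (t * r * tperm x y) x by rewrite cut2_face1 inE negb_or df.
have zo : z \in porbit (t * r * tperm x y) x by rewrite cut2_face1 inE zf.
have wo : w \in porbit (t * r * tperm x y) x by rewrite cut2_face1 inE wg orbT.
by rewrite porbit_tperm_out -?(porbit_eq zo) -?(porbit_eq wo) // porbit_tperm_out.
Qed.

Let r1 := r * tperm x y.

Lemma cut2_step1 : porbit r1 z = porbit r z.
Proof.
move: q; rewrite quadE => /and5P[/eqP e1 _ n _ _].
by rewrite porbit_tperm_out // -eq_porbit_mem ?e1.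
Qed.

Lemma cut2_vertex_out d : d \notin porbit r x -> d \notin porbit r z ->
  porbit r2 d = porbit r d.
Proof.
move: q; rewrite quadE => /and5P[/eqP e1 /eqP e2 n _ _] dx dz.
have dr1 : porbit r1 d = porbit r d by rewrite porbit_tperm_out // e1.
have wr1 : porbit r1 w = porbit r1 z.
  rewrite porbit_tperm_out ?cut2_step1 //; rewrite -eq_porbit_mem e2 ?e1 //.
rewrite porbit_tperm_out //; first by rewrite cut2_step1.
by rewrite wr1 cut2_step1.
Qed.

Lemma cut2_vertex_sub d : porbit r2 d \subset porbit r d.
Proof.
case/and5P: q => yx wz zx _ _.
apply: subset_trans (split_porbit_sub _ _) (split_porbit_sub _ yx).
by rewrite cut2_step1.
Qed.

Hypothesis pl : planar t r.

Lemma cut2_planar1 : planar t r1.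
Proof.
case/and5P: q => yx wz zx _ _; have [xy _ _ _] := quad_neq q.
by apply: euler_tperm => //; rewrite yx.
Qed.

Lemma cut2_same_face1 : w \in porbit (t * r1) z.
Proof.
have [_ zf _ wg _] := quad_faces; rewrite phi_tperm.
have zo : z \in porbit (t * r * tperm x y) x by rewrite cut2_face1 inE zf.
by rewrite -(porbit_eq zo) cut2_face1 inE wg orbT.
Qed.

Lemma cut2_planar : planar t r2.
Proof.
have [_ zw _ _] := quad_neq q; apply: euler_tperm => //; first exact: cut2_planar1.
by rewrite cut2_same_face1 orbT.
Qed.

(** After the first transposition [z] and [w] still share a vertex and now also share a face, so
    [jordan1] applies to the second. *)
Lemma cut2_separates : ~~ conn t r2 z w.
Proof.
case/and5P: q => yx wz zx _ _; have [_ zw _ _] := quad_neq q.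
apply: jordan1 => //; first exact: cut2_planar1.
  by rewrite cut2_step1.
exact: cut2_same_face1.
Qed.

End OneQuad.

Lemma cut2_separates' r x y z w : planar t r -> quad r x y z w ->
  ~~ conn t (cut2 r x y z w) x y.
Proof. by move=> pl q; rewrite -(cut2_flip q); apply/cut2_separates/pl/quad_flip. Qed.

Lemma quad_separated r x y z w : planar t r -> quad r x y z w ->
  exists S, separated r x y z w S.
Proof.
move=> pl q; exists (component t (cut2 r x y z w) x); split=> //.
- exact: component_t.
- exact: component_r.
- exact: component_id.
- by rewrite inE cut2_separates'.
Qed.

Lemma separated_sym r x y z w S : separated r x y z w S -> separated r y x w z (~: S).
Proof.
case=> q tS rS xS yS; split; rewrite 1?cut2_sym ?in_setC ?xS //.
- exact: quad_sym.
- exact: stableC.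
- exact: stableC.
Qed.

(** The boundary walk of the cut map enters the face of [x] by the jump from [y] to [x], so it also
    leaves this face by a jump landing in [S]. The only candidates are [x] to [y] and [z] to [w],
    and [y] is not in [S]. *)
Lemma separated_w r x y z w S : separated r x y z w S -> w \in S.
Proof.
case=> q tS rS xS yS; have [sx sy sz sw] := swap2E q.
have [xf zf yg wg [yf wf xg zg]] := quad_faces q.
have [b [bf]] : exists b, [/\ b \in porbit (t * r) x, swap2 x y z w b \in S
    & swap2 x y z w b \notin porbit (t * r) x].
  apply: (@porbit_reroute _ (t * r) _ _ _ x) => //.
  - by rewrite -cut2_phi; apply: stable_phi.
  - exact: stable_porbit_self.
  - by rewrite (swap2V q) sx.
have [bq|/swap2D->] := boolP (b \in [:: x; y; z; w]); last by rewrite bf.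
move: bq; rewrite !inE => /or4P[]/eqP eb; move: bf; rewrite eb ?sx ?sy ?sz ?sw.
- by rewrite (negPf yS).
- by rewrite (negPf yf).
- by [].
- by rewrite (negPf wf).
Qed.

Lemma separated_z r x y z w S : separated r x y z w S -> z \notin S.
Proof. by move=> /separated_sym/separated_w; rewrite in_setC. Qed.

Section Separated.
Variables (r : {perm D}) (x y z w : D) (S : {set D}).
Hypothesis sep : separated r x y z w S.
Let f := porbit (t * r) x.
Let g := porbit (t * r) y.
Let r2 := cut2 r x y z w.

Lemma separated_outer : porbit (t * r2) x = (f :|: g) :&: S.
Proof.
have wS := separated_w sep; have zS := separated_z sep.
case: sep => q tS rS xS yS; have fS := stable_phi tS rS.
have fS' := stable_phi (stableC tS) (stableC rS).
have [xf zf yg wg [yf wf xg zg]] := quad_faces q.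
have oz : porbit (t * r2) z \subset ~: S by apply: stable_porbit; rewrite ?in_setC.
have ow : porbit (t * r2) w \subset S by apply: stable_porbit.
have eqw : porbit (t * r2) w = (f :|: g) :&: S.
  apply/setP => a; rewrite (cut2_outer q) in_setI in_setU.
  apply/idP/andP => [aw|[/orP[az|//] aS]]; first by rewrite aw orbT (subsetP ow).
  by have := subsetP oz a az; rewrite in_setC aS.
have xw : x \in porbit (t * r2) w by rewrite eqw in_setI in_setU xf.
by rewrite -eqw (porbit_eq xw).
Qed.

Lemma separated_face d : d \notin f -> d \notin g -> porbit (t * r2) d = porbit (t * r) d.
Proof. by case: sep => q _ _ _ _; apply: cut2_face. Qed.

End Separated.

End Quads.

(** * Curves with further faces on both sides *)

Section Reducing.
Variables (D : finType) (t : {perm D}).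
Hypotheses (tK : involutive t) (tN : forall d, t d != d).
Implicit Types (r : {perm D}) (x y z w d : D) (S : {set D}).

Definition nonrepeating r := forall x y, y \in porbit r x -> y \in porbit (t * r) x -> x = y.

(** Only moved darts qualify: a removed edge has a face of its own, which must not count as a third
    face. *)
Definition third r x y d :=
  [&& d \in moved r, d \notin porbit (t * r) x & d \notin porbit (t * r) y].

Definition reducing r x y z w S :=
  [/\ separated t r x y z w S, exists2 d, d \in S & third r x y d
    & exists2 d, d \notin S & third r x y d].

(** The number of corners on the outer face of the complement of [S], the side that will be replaced
    by an edge. *)
Definition outer_size r x y S := #|(porbit (t * r) x :|: porbit (t * r) y) :\: S|.

Lemma third_sym r x y d : third r y x d = third r x y d.
Proof. by rewrite /third [X in _ && X]andbC. Qed.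

Lemma reducing_sym r x y z w S : reducing r x y z w S -> reducing r y x w z (~: S).
Proof.
case=> sep [d1 d1S t1] [d2 d2S t2]; split; first exact: separated_sym.
  by exists d2; rewrite ?in_setC 1?third_sym.
by exists d1; rewrite ?in_setC ?d1S 1?third_sym.
Qed.

Lemma tperm_comm (a b c d : D) : a != c -> a != d -> b != c -> b != d ->
  tperm a b * tperm c d = tperm c d * tperm a b.
Proof. by move=> ac ad bc bd; rewrite conjgC tpermJ !tpermD // eq_sym. Qed.

(* A vertex that lies on both faces cuts the side in two pieces, and one of them
   keeps the third face. *)
Lemma reducing_smaller r x y z w S e e' :
  nonrepeating r -> planar t r -> reducing r x y z w S ->
  e \in porbit (t * r) x -> e \notin S -> e != z ->
  e' \in porbit (t * r) y -> e' \notin S -> e' \in porbit r e ->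
  exists x' y' z' w' S', reducing r x' y' z' w' S' /\
    outer_size r x' y' S' < outer_size r x y S.
Proof.
move=> nr pl [sep [d1 d1S t1] [d2 d2S t2]] ef eS ez e'g e'S ee'.
have wS := separated_w sep; have zS := separated_z sep.
have [q tS r2S xS yS] := sep; set r2 := cut2 r x y z w in r2S.
have [xf zf yg wg [yf wf xg zg]] := quad_faces q.
have [yx wz nzx _ _] := and5P q; have [sx sy sz sw] := swap2E q.
have ex : e \notin porbit r x.
  by apply: contra eS => ex; rewrite -(nr _ _ ex ef).
have enz : e \notin porbit r z.
  apply: contra ez => enz; rewrite eq_sym; apply/eqP/nr => //.
  by rewrite -(porbit_eq zf).
have e'f : e' \notin porbit (t * r) x.
  by apply/negP => e'f; apply: (disjoint_faces q e'f).
have eg : e \notin porbit (t * r) y by apply/negP => /(disjoint_faces q ef).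
have neq a b : a \notin porbit r b ->
    forall a' b', a' \in porbit r a -> b' \in porbit r b -> a' != b'.
  move=> ab a' b' aa bb; apply: contraNneq ab => e1.
  by rewrite (porbit_eq bb) -e1 porbit_sym.
have eqin := neq _ _ ex; have ezin := neq _ _ enz.
have e_id := porbit_id r e; have x_id := porbit_id r x; have z_id := porbit_id r z.
have ne_e : e != e' by apply: contraNneq e'f => <-.
(* A third cut: [e] and [e'] are corners of one vertex and of the outer face of the complement of
   [S], so it divides this complement into [T], containing [e], and [T'], containing [e']. *)
pose r4 := r2 * tperm e e'.
have pl2 : planar t r2 := cut2_planar q pl.
have rv : e' \in porbit r2 e by rewrite (cut2_vertex_out q).
have O2 : porbit (t * r2) y = (porbit (t * r) y :|: porbit (t * r) x) :&: ~: S.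
  by rewrite /r2 -cut2_sym; apply: separated_outer (separated_sym sep).
have ey2 : e \in porbit (t * r2) y by rewrite O2 in_setI in_setU in_setC ef eS orbT.
have fv : e' \in porbit (t * r2) e.
  by rewrite -(porbit_eq ey2) O2 in_setI in_setU in_setC e'g e'S.
have ncon : ~~ conn t r4 e e' by apply: jordan1.
have r4S : stable r4 S by apply: stable_tperm => //; rewrite (negPf eS) (negPf e'S).
pose T := component t r4 e; have tT : stable t T := @component_t _ t r4 e.
have r4T : stable r4 T := @component_r _ t r4 e.
have eT : e \in T := component_id t r4 e.
have e'T : e' \notin T by rewrite inE.
have TS a : a \in T -> a \notin S.
  rewrite inE => c; have : a \in ~: S; last by rewrite in_setC.
  by apply: (stable_conn (stableC tS) (stableC r4S) _ c); rewrite in_setC.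
pose T' := ~: S :&: ~: T.
have tT' : stable t T' by apply: stableI; apply: stableC.
have r4T' : stable r4 T' by apply: stableI; apply: stableC.
have e'T' : e' \in T' by rewrite !in_setI !in_setC e'S.
pose s4 := swap2 x y z w * tperm e e'.
have phi4 : t * r4 = t * r * s4 by rewrite /r4 phi_tperm cut2_phi // -mulgA.
have e'x : e' \notin [:: x; y; z; w].
  rewrite !inE !negb_or (eqin e' x) ?(eqin e' y) ?(ezin e' z) ?(ezin e' w) //.
have e4 : e \notin [:: x; y; z; w].
  by rewrite !inE !negb_or (eqin e x) ?(eqin e y) ?(ezin e z) ?(ezin e w).
have s4e : s4 e = e' by rewrite permM (swap2D e4) tpermL.
have s4e' : s4 e' = e by rewrite permM (swap2D e'x) tpermR.
have nin a : a \in [:: x; y; z; w] -> tperm e e' a = a.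
  by move=> aq; rewrite tpermD //; apply: contraTneq aq => <-.
have [s4x s4y s4z s4w] : [/\ s4 x = y, s4 y = x, s4 z = w & s4 w = z].
  by split; rewrite permM ?sx ?sy ?sz ?sw nin // !inE eqxx ?orbT.
have s4D a : a \notin [:: x; y; z; w; e; e'] -> s4 a = a.
  rewrite -[[:: x; _; _; _; _; _]]/([:: x; y; z; w] ++ [:: e; e']) mem_cat negb_or.
  case/andP=> aq ae; rewrite permM (swap2D aq) tpermD //; apply: contraNneq ae => <-.
    by rewrite !inE eqxx.
  by rewrite !inE eqxx orbT.
have cases a : a \notin [:: x; y; z; w; e; e'] \/
    [\/ a = x, a = y, a = z | [\/ a = w, a = e | a = e']].
  have [|_] := boolP (a \in _); last by left.
  rewrite !inE => /or4P[]; [move/eqP..|] => h; right;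
    try by [constructor 1|constructor 2|constructor 3].
  by constructor 4; case/or3P: h => /eqP; [constructor 1|constructor 2|constructor 3].
(* The boundary walk through [e] enters the face of [x] by a jump from [e'], so it leaves this face
   by a jump landing in [T]; only the one from [x] to [y] can do so. *)
have yT : y \in T.
  have [b [bf]] : exists b, [/\ b \in porbit (t * r) x, s4 b \in T & s4 b \notin porbit (t * r) x].
    apply: (@porbit_reroute _ (t * r) _ _ _ e) => //.
    - by rewrite -phi4; apply: stable_phi.
    - exact: stable_porbit_self.
    - by rewrite -{1}s4e' permK.
  case: (cases b) => [/s4D->|]; first by rewrite bf.
  case=> [||| []] eb; move: bf; rewrite eb ?s4x ?s4y ?s4z ?s4w ?s4e ?s4e' //.
  - by rewrite (negPf yf).
  - by move=> _ /TS; rewrite wS.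
  - by rewrite (negPf wf).
  - by rewrite (negPf e'T).
  - by rewrite (negPf e'f).
have zT' : z \in T'.
  have [b [bf]] : exists b, [/\ b \in porbit (t * r) y, s4 b \in T' & s4 b \notin porbit (t * r) y].
    apply: (@porbit_reroute _ (t * r) _ _ _ e') => //.
    - by rewrite -phi4; apply: stable_phi.
    - exact: stable_porbit_self.
    - by rewrite -{1}s4e permK.
  case: (cases b) => [/s4D->|]; first by rewrite bf.
  case=> [||| []] eb; move: bf; rewrite eb ?s4x ?s4y ?s4z ?s4w ?s4e ?s4e' //.
  - by rewrite (negPf xg).
  - by rewrite !in_setI !in_setC xS.
  - by rewrite (negPf zg).
  - by rewrite (negPf eg).
  - by rewrite !in_setI !in_setC eT andbF.
have zT : z \notin T by move: zT'; rewrite !in_setI !in_setC => /andP[].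
have comm1 : tperm z w * tperm e e' = tperm e e' * tperm z w.
  by apply: tperm_comm; rewrite eq_sym ?ezin.
have comm2 : tperm x y * tperm e e' = tperm e e' * tperm x y.
  by apply: tperm_comm; rewrite eq_sym ?eqin.
(* The part that contains [d2] becomes the new complement: its curve goes through the vertices of
   [x] and [e] for [T], of [e] and [z] for [T']. The outer corner [z] is lost in the first case, [y]
   in the second. *)
have [d2T|d2T] := boolP (d2 \in T).
  exists x, y, e, e', (~: T); split.
    split; [split| |].
    - by rewrite /quad yx ee' ex ef e'g yf.
    - exact: stableC.
    - apply: stableC.
      have -> : cut2 r x y e e' = r4 * tperm z w.
        rewrite /r4 /r2 /cut2 -!mulgA; congr (r * (_ * _)).
        by rewrite mulgA comm1 mulr_tpermK.
      apply: stable_tperm => //; rewrite (negPf zT); apply/esym/negP => /TS.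
      by rewrite wS.
    - by rewrite in_setC; apply/negP => /TS; rewrite xS.
    - by rewrite in_setC yT.
    - by exists d1 => //; rewrite in_setC; apply/negP => /TS; rewrite d1S.
    - by exists d2; rewrite ?in_setC ?d2T.
  apply/proper_card/properP; split.
    by apply/subsetP => a; rewrite !in_setD !in_setC negbK => /andP[/TS -> ->].
  by exists z; rewrite in_setD in_setU ?in_setC ?negbK ?zf ?zT ?(negPf zT) ?zS.
exists e, e', z, w, (~: T').
have pe := porbit_eq ef; have pe' := porbit_eq e'g.
split.
  split; [split| |].
  - rewrite /quad ee' wz -pe -pe' zf wg e'f porbit_sym enz //.
  - exact: stableC.
  - apply: stableC.
    have -> : cut2 r e e' z w = r4 * tperm x y.
      have comm3 : tperm x y * tperm z w = tperm z w * tperm x y.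
        by have [? ? ? [? ? ?]] := quad_neq q; apply: tperm_comm.
      rewrite /r4 /r2 /cut2 -!mulgA; congr (r * _).
      rewrite -comm1 mulgA comm3 -mulgA; congr (_ * _).
      by rewrite mulgA comm2 -mulgA tperm2 mulg1.
    apply: stable_tperm => //.
    by rewrite /T' !in_setI !in_setC xS yT andbF.
  - by rewrite !in_setC !in_setI !in_setC eT andbF.
  - by rewrite in_setC e'T'.
  - exists d1; first by rewrite in_setC in_setI in_setC d1S.
    by rewrite /third -pe -pe'.
  - exists d2; first by rewrite in_setC negbK in_setI !in_setC d2S.
    by rewrite /third -pe -pe'.
apply/proper_card/properP; split; rewrite -?pe -?pe'.
  apply/subsetP => a; rewrite !in_setD !in_setC !in_setI !in_setC negbK.
  by case/andP=> /andP[-> _] ->.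
by exists y; rewrite in_setD in_setU ?in_setC ?in_setI ?in_setC ?yg ?yS ?yT ?orbT ?andbF.
Qed.

End Reducing.

(** * Replacing one side of a curve by an edge *)

Section Gluing.
Variables (D : finType) (t : {perm D}).
Hypotheses (tK : involutive t) (tN : forall d, t d != d).
Variables (k m : nat).
Hypothesis (km : k = (3 * m) %/ 2).

Lemma card_face_le (r : {perm D}) d : degree t r d <= #|porbit (t * r) d|.
Proof. exact: leq_imset_card. Qed.

Lemma nonrepeating_face r d : good t m r -> nonrepeating t r -> #|porbit (t * r) d| <= m.
Proof.
case=> _ _ deg nr; apply: leq_trans (deg d); rewrite /degree card_in_imset //.
move=> a b ad bd e; apply: nr; first by rewrite e porbit_id.
by rewrite -(porbit_eq ad).
Qed.

(** If [t d] were the only corner of its vertex, the face walk would turn around there and meet the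
    vertex of [d] at both corners [d] and [r d]. *)
Lemma nonrepeating_moved r d : nonrepeating t r -> d \in moved r -> t d \in moved r.
Proof.
rewrite !inE => nr; apply: contra => /eqP rtd; apply/eqP/esym/nr.
  by rewrite -eq_porbit_mem porbit_step.
have e1 : porbit (t * r) (t d) = porbit (t * r) d by rewrite -{1}rtd -permM porbit_step.
have e2 : porbit (t * r) (r d) = porbit (t * r) (t d).
  by rewrite -[RHS]porbit_step permM tK.
by rewrite -eq_porbit_mem e2 e1.
Qed.

Section OneSide.
Variables (r : {perm D}) (x y z w : D) (S : {set D}).
Hypotheses (gr : good t m r) (nr : nonrepeating t r) (sep : separated t r x y z w S).
Let f := porbit (t * r) x.
Let g := porbit (t * r) y.
Let r2 := cut2 r x y z w.
Let rs := restr_perm S r2.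
Let ra := rs * tperm x y.

(* The side [S] with the other side replaced by the edge [{y, t y}], [y] at the
   vertex of [x] and [t y] at that of [w]. *)
Definition shrink : {perm D} := ra * tperm w (t y).
Let r3 := shrink.

Let q : quad t r x y z w. Proof. by case: sep. Qed.
Let tS : stable t S. Proof. by case: sep. Qed.
Let r2S : stable r2 S. Proof. by case: sep. Qed.
Let xS : x \in S. Proof. by case: sep. Qed.
Let yS : y \notin S. Proof. by case: sep. Qed.
Let wS : w \in S. Proof. exact: separated_w sep. Qed.
Let zS : z \notin S. Proof. exact: separated_z sep. Qed.
Let tyS : t y \notin S. Proof. by rewrite stable_mem. Qed.
Let pl : planar t r. Proof. by case: gr. Qed.
Let ll : loopless_map t r. Proof. by case: gr. Qed.

Lemma side_neq a b : a \in S -> b \notin S -> a != b.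
Proof. by move=> aS; apply: contraNneq => <-. Qed.

Let xyN : x != y. Proof. exact: side_neq. Qed.
Let xtyN : x != t y. Proof. exact: side_neq. Qed.
Let wyN : w != y. Proof. exact: side_neq. Qed.
Let wtyN : w != t y. Proof. exact: side_neq. Qed.
Let xwN : x != w. Proof. by have [_ _ _ [? _ _]] := quad_neq q. Qed.

Lemma side_outer : porbit (t * rs) x = (f :|: g) :&: S.
Proof. by rewrite restr_face // (separated_outer sep). Qed.

Let rsy : porbit (t * rs) y = [set y; t y].
Proof. exact: restr_face_out. Qed.

Let phia : porbit (t * ra) x = ((f :|: g) :&: S) :|: [set y; t y].
Proof.
rewrite phi_tperm porbit_merge side_outer ?rsy // in_setI (negPf yS) andbF //.
Qed.

Let wO : w \in (f :|: g) :&: S.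
Proof. by have [_ _ _ wg _] := quad_faces q; rewrite in_setI in_setU wg orbT wS. Qed.

Let tya : t y \in porbit (t * ra) w.
Proof.
have wa : w \in porbit (t * ra) x by rewrite phia in_setU wO.
by rewrite -(porbit_eq wa) phia !inE eqxx !orbT.
Qed.

(** Under [rs] the edge of [y] is a separate component, so [y] may be attached at [x]. Then [t y]
    and [w] are corners of one face, so [t y] may be attached at [w]. *)
Lemma shrink_planar : planar t r3.
Proof.
apply: euler_tperm => //; last by rewrite tya orbT.
apply: euler_tperm => //.
  by apply: euler_restr => //; apply: cut2_planar q pl.
apply/or3P; apply: Or33; apply/negP => c.
have := stable_conn tS (stable_restr r2S r2S) xS c.
by rewrite (negPf yS).
Qed.

Let phi3E d : (t * r3) d = tperm w (t y) (tperm x y (rs (t d))).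
Proof. by rewrite !permM. Qed.

Let phi3S d : d \in S -> (t * r3) d = tperm w (t y) (tperm x y (swap2 x y z w ((t * r) d))).
Proof.
move=> dS; rewrite phi3E restr_in ?tS //.
suff -> : r2 (t d) = swap2 x y z w ((t * r) d) by [].
by rewrite -[RHS]permM -cut2_phi [RHS]permM.
Qed.

Let phi2S d : d \in S -> swap2 x y z w ((t * r) d) \in S.
Proof. by move=> dS; rewrite -permM -cut2_phi; apply: stable_phi. Qed.

Let quad_cases a : a \notin [:: x; y; z; w] \/ [\/ a = x, a = y, a = z | a = w].
Proof.
have [|_] := boolP (a \in _); last by left.
by rewrite !inE => /or4P[] /eqP->; right; constructor.
Qed.

(** Where the old walk continues at [z], the cut redirects it to [w] and the new edge to [t y], from
    which it returns to [x]. *)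
Let face3x_sub : porbit (t * r3) x \subset (f :&: S) :|: [set t y].
Proof.
have [xf zf yg wg [yf wf xg zg]] := quad_faces q; have [sx sy sz sw] := swap2E q.
apply: stable_porbit; last by rewrite in_setU in_setI xf xS.
move=> d; rewrite in_setU in_setI in_set1 => /orP[/andP[df dS]|/eqP->]; last first.
  rewrite phi3E tK restr_out // tpermR tpermD ?in_setU ?in_setI ?xf ?xS // eq_sym //.
have pf : (t * r) d \in f by apply: stable_porbit_self.
rewrite phi3S // in_setU in_setI in_set1; have pS := phi2S dS; move: pf pS.
case: (quad_cases ((t * r) d)) => [nq|[]->]; rewrite ?sx ?sy ?sz ?sw.
- rewrite (swap2D nq) => pf pS; move: nq; rewrite !inE !negb_or => /and4P[nx ny _ nw].
  rewrite (@tpermD _ x y) 1?eq_sym // tpermD ?pf ?pS //; first by rewrite eq_sym.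
  by rewrite eq_sym side_neq.
- by rewrite (negPf yS).
- by rewrite (negPf yf).
- by move=> _ _; rewrite (@tpermD _ x y) 1?[y == _]eq_sym // tpermL eqxx orbT.
- by rewrite (negPf wf).
Qed.

Let face3w_sub : porbit (t * r3) w \subset (g :&: S) :|: [set y].
Proof.
have [xf zf yg wg [yf wf xg zg]] := quad_faces q; have [sx sy sz sw] := swap2E q.
apply: stable_porbit; last by rewrite in_setU in_setI wg wS.
move=> d; rewrite in_setU in_setI in_set1 => /orP[/andP[df dS]|/eqP->]; last first.
  by rewrite phi3E restr_out // (@tpermD _ x y) ?tpermR ?in_setU ?in_setI ?wg ?wS // eq_sym.
have pf : (t * r) d \in g by apply: stable_porbit_self.
rewrite phi3S // in_setU in_setI in_set1; have pS := phi2S dS; move: pf pS.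
case: (quad_cases ((t * r) d)) => [nq|[]->]; rewrite ?sx ?sy ?sz ?sw.
- rewrite (swap2D nq) => pf pS; move: nq; rewrite !inE !negb_or => /and4P[nx ny _ nw].
  rewrite (@tpermD _ x y) 1?eq_sym // tpermD ?pf ?pS //; first by rewrite eq_sym.
  by rewrite eq_sym side_neq.
- by rewrite (negPf xg).
- by move=> _ _; rewrite tpermL tpermD ?eqxx ?orbT.
- by rewrite (negPf zg).
- by rewrite (negPf zS).
Qed.

Let face3_union : ((f :|: g) :&: S) :|: [set y; t y] = porbit (t * r3) w :|: porbit (t * r3) x.
Proof.
have wa : w \in porbit (t * ra) x by rewrite phia in_setU wO.
rewrite -phia (porbit_eq wa) (porbit_split tya) -phi_tperm; congr (_ :|: _).
rewrite -/shrink -/r3 -[LHS]porbit_step; congr (porbit _ _).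
by rewrite phi3E tK restr_out // tpermR tpermD // eq_sym.
Qed.

(** The faces of [x] and [w] are contained in two disjoint sets whose union is, by [face3_union],
    the union of the two faces; so both inclusions are equalities. *)
Lemma shrink_facex : porbit (t * r3) x = (f :&: S) :|: [set t y].
Proof.
apply/eqP; rewrite eqEsubset face3x_sub; apply/subsetP => a aX.
have : a \in porbit (t * r3) w :|: porbit (t * r3) x.
  rewrite -face3_union; move: aX; rewrite !inE => /orP[/andP[-> ->]//|->].
  by rewrite !orbT.
rewrite in_setU => /orP[/(subsetP face3w_sub)|//].
move: aX; rewrite !inE => /orP[/andP[af aS]|/eqP->].
  case/orP=> [/andP[ag _]|/eqP ay]; first by case: (disjoint_faces q af ag).
  by rewrite ay (negPf yS) in aS.
by rewrite (negPf tyS) andbF (negPf (tN y)).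
Qed.

Lemma shrink_facew : porbit (t * r3) w = (g :&: S) :|: [set y].
Proof.
apply/eqP; rewrite eqEsubset face3w_sub; apply/subsetP => a aX.
have : a \in porbit (t * r3) w :|: porbit (t * r3) x.
  rewrite -face3_union; move: aX; rewrite !inE => /orP[/andP[-> ->]//|->].
    by rewrite orbT.
  by rewrite !orbT.
rewrite in_setU => /orP[//|/(subsetP face3x_sub)].
move: aX; rewrite !inE => /orP[/andP[ag aS]|/eqP->].
  case/orP=> [/andP[af _]|/eqP ay]; first by case: (disjoint_faces q af ag).
  by rewrite ay (negPf tyS) in aS.
by rewrite (negPf yS) andbF eq_sym (negPf (tN y)).
Qed.

Lemma shrink_face_out d : d \notin (f :|: g) :&: S -> d \notin [set y; t y] ->
  porbit (t * r3) d = porbit (t * rs) d.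
Proof.
move=> dO dy.
have da : d \notin porbit (t * ra) w.
  have wa : w \in porbit (t * ra) x by rewrite phia in_setU wO.
  by rewrite -(porbit_eq wa) phia in_setU negb_or dO.
rewrite phi_tperm porbit_tperm_out -?(porbit_eq tya) //.
by rewrite phi_tperm porbit_tperm_out ?side_outer ?rsy.
Qed.

(** An invariant in place of the orbits of [r3] themselves: [vtx] reads [y] as a corner at [x] and
    [t y] as a corner at [w], and it is constant along [rs], [ra] and [r3]. *)
Let proj d := if d == y then x else if d == t y then w else d.
Let vtx d := porbit rs (proj d).

Let vtx_tperm1 d : vtx (tperm x y d) = vtx d.
Proof.
case: tpermP => // ->; rewrite /vtx /proj eqxx ?(negPf xyN) ?(negPf xtyN) //.
Qed.

Let vtx_tperm2 d : vtx (tperm w (t y) d) = vtx d.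
Proof.
case: tpermP => // ->; rewrite /vtx /proj eqxx ?(negPf wyN) ?(negPf wtyN) ?(negPf (tN y)) //.
Qed.

Let projS d : d \in S -> proj d = d.
Proof. by move=> dS; rewrite /proj !(negPf (side_neq dS _)). Qed.

Let vtx_rs d : vtx (rs d) = vtx d.
Proof.
have [dS|dS] := boolP (d \in S); last by rewrite /rs restr_out.
have rdS : rs d \in S by rewrite /rs restr_in ?r2S.
by rewrite /vtx !projS // porbit_step.
Qed.

Let vtx_orbit (s : {perm D}) a b : (forall d, vtx (s d) = vtx d) ->
  b \in porbit s a -> vtx b = vtx a.
Proof.
move=> vs /porbitP[i ->]; elim: i => [|i IHi]; first by rewrite expg0 perm1.
by rewrite expgSr permM vs.
Qed.

Let vtx_ra a b : b \in porbit ra a -> vtx b = vtx a.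
Proof. by apply: vtx_orbit => d; rewrite permM vtx_tperm1 vtx_rs. Qed.

Let vtx_r3 a b : b \in porbit r3 a -> vtx b = vtx a.
Proof. by apply: vtx_orbit => d; rewrite !permM vtx_tperm2 vtx_tperm1 vtx_rs. Qed.

Let rs_sub a b : a \in S -> porbit rs b = porbit rs a -> b \in porbit r a.
Proof.
move=> aS e; apply: (subsetP (cut2_vertex_sub q a)).
by rewrite -(restr_porbit r2S) // -/rs -e porbit_id.
Qed.

Let xw_rs : porbit rs x <> porbit rs w.
Proof.
move/rs_sub => /(_ wS) xw; case/and5P: q => _ wz /negP[].
by rewrite porbit_sym (porbit_eq wz).
Qed.

Lemma shrink_vertex a b : a \in S -> b \in S -> b \in porbit r3 a -> b \in porbit r a.
Proof. by move=> aS bS /vtx_r3; rewrite /vtx !projS //; apply: rs_sub. Qed.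

Let vtxy : vtx y = porbit rs x. Proof. by rewrite /vtx /proj eqxx. Qed.
Let vtxty : vtx (t y) = porbit rs w. Proof. by rewrite /vtx /proj (negPf (tN y)) eqxx. Qed.

Lemma shrink_vertex_y a : a \in S -> y \in porbit r3 a -> a \in porbit r x.
Proof.
move=> aS /vtx_r3; rewrite vtxy /vtx projS // => e.
by rewrite porbit_sym; apply: rs_sub.
Qed.

Lemma shrink_vertex_ty a : a \in S -> t y \in porbit r3 a -> a \in porbit r w.
Proof.
move=> aS /vtx_r3; rewrite vtxty /vtx projS // => e.
by rewrite porbit_sym; apply: rs_sub.
Qed.

Lemma shrink_xy : y \in porbit r3 x.
Proof.
have nx : x \notin porbit ra w.
  by apply/negP => /vtx_ra; rewrite /vtx !projS //; apply: xw_rs.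
have nx' : x \notin porbit ra (t y).
  by apply/negP => /vtx_ra; rewrite vtxty /vtx projS //; apply: xw_rs.
rewrite porbit_tperm_out // mem_porbit_merge // restr_porbit //.
by apply: contra yS; apply: (subsetP (stable_porbit r2S xS)).
Qed.

Lemma shrink_wty : t y \in porbit r3 w.
Proof.
apply: mem_porbit_merge.
rewrite porbit_tperm_out.
- by rewrite restr_porbit //; apply: contra tyS; apply: (subsetP (stable_porbit r2S wS)).
- by rewrite -eq_porbit_mem eq_sym; apply/eqP; apply: xw_rs.
- by rewrite restr_porbit_out // in_set1.
Qed.

Lemma shrink_loopless : loopless_map t r3.
Proof.
move=> d; apply/negP => h; have [dS|dS] := boolP (d \in S).
  by have := shrink_vertex dS (tS dS) h; rewrite (negPf (ll d)).
have [dy|ndy] := eqVneq d y.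
  move: h; rewrite dy => /vtx_r3; rewrite vtxy vtxty => /esym; exact: xw_rs.
have [dty|ndty] := eqVneq d (t y).
  by move: h; rewrite dty tK => /vtx_r3; rewrite vtxy vtxty; apply: xw_rs.
have tdy : t d != y by apply: contraNneq ndty => <-; rewrite tK.
have tdty : t d != t y by rewrite (inj_eq perm_inj).
move/vtx_r3: h; rewrite /vtx /proj (negPf ndy) (negPf ndty) (negPf tdy) (negPf tdty).
rewrite !restr_porbit_out ?stable_mem // => /set1_inj /eqP.
by rewrite (negPf (tN d)).
Qed.

(** On one face [t y] takes the place of the lost corner [z]; on the other, [y] itself comes back.
    Neither face grows. *)
Lemma shrink_good : good t m r3.
Proof.
split; [exact: shrink_planar|exact: shrink_loopless|move=> d].
have [xf zf yg wg [yf wf xg zg]] := quad_faces q.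
apply: leq_trans (card_face_le _ _) _.
have lef : #|porbit (t * r3) x| <= m.
  rewrite shrink_facex; apply: leq_trans (nonrepeating_face x gr nr); rewrite -/f.
  rewrite setUC cardsU1 in_setI (negPf tyS) andbF /= (cardsD1 z f) zf leq_add2l.
  apply/subset_leq_card/subsetP => a; rewrite !inE => /andP[-> aS].
  by rewrite (side_neq aS zS).
have leg : #|porbit (t * r3) w| <= m.
  rewrite shrink_facew; apply: leq_trans (nonrepeating_face y gr nr); rewrite -/g.
  rewrite setUC cardsU1 in_setI (negPf yS) andbF /= (cardsD1 y g) yg leq_add2l.
  apply/subset_leq_card/subsetP => a; rewrite !inE => /andP[-> aS].
  by rewrite (side_neq aS yS).
have [dO|dO] := boolP (d \in porbit (t * r3) w :|: porbit (t * r3) x).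
  by move: dO; rewrite in_setU => /orP[] /porbit_eq <-.
rewrite -face3_union in_setU negb_or in dO; case/andP: dO => dO dy.
rewrite shrink_face_out //; have [dS|dS] := boolP (d \in S).
  rewrite restr_face // (separated_face sep); first exact: nonrepeating_face.
    by apply: contra dO; rewrite in_setI in_setU dS => ->.
  by apply: contra dO; rewrite in_setI in_setU dS => ->; rewrite orbT.
rewrite restr_face_out //; apply: leq_trans (good_ge2 d gr).
by rewrite cards2; case: (_ != _).
Qed.

Lemma quad_moved : [/\ x \in moved r, y \in moved r, z \in moved r & w \in moved r].
Proof.
have [xy zw _ _] := quad_neq q; case/and5P: q => yx wz _ _ _.
rewrite !inE; split; [exact: orbit_moved yx xy| |exact: orbit_moved wz zw|].
  by apply: (@orbit_moved _ _ _ x); rewrite 1?porbit_sym 1?eq_sym.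
by apply: (@orbit_moved _ _ _ z); rewrite 1?porbit_sym 1?eq_sym.
Qed.

Lemma moved_cut2 : moved r2 \subset moved r.
Proof.
have [] := quad_moved; rewrite !inE => rx ry rz rw.
apply/subsetP => d; rewrite !inE; apply: contra => /eqP rd.
rewrite permM permM rd !tpermD //; apply/eqP => e; move: rx ry rz rw; rewrite e rd eqxx //.
Qed.

Lemma shrink_moved : (exists2 d, d \notin S & third t r x y d) -> #|moved r3| < #|moved r|.
Proof.
case=> d2 d2S /and3P[d2m d2x d2y]; have [mx my mz mw] := quad_moved.
have mty := nonrepeating_moved nr my.
have [xf zf yg wg [yf wf xg zg]] := quad_faces q.
have sub : moved r3 \subset (moved r :&: S) :|: [set y; t y].
  apply/subsetP => d dm; rewrite !in_setU in_setI !in_set1.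
  have [dy|ndy] := eqVneq d y; rewrite ?orbT //.
  have [dty|ndty] := eqVneq d (t y); rewrite ?orbT //= !orbF.
  have [dS|dS] := boolP (d \in S); last first.
    move: dm; rewrite inE !permM restr_out // tpermD ?tpermD ?eqxx // 1?eq_sym //;
    by rewrite eq_sym side_neq.
  rewrite andbT; apply: contraLR dm => ndm.
  have rsd : rs d = d.
    rewrite /rs restr_in //; apply/eqP; apply: contraNT ndm => h.
    by apply: (subsetP moved_cut2); rewrite inE.
  have nd a : a \in moved r -> a != d by apply: contraTneq => ->.
  by rewrite inE negbK !permM rsd (@tpermD _ x y) ?nd // tpermD ?eqxx // ?nd // eq_sym.
apply/proper_card; apply: sub_proper_trans sub _.
apply/properP; split.
  rewrite subUset subsetIl /=; apply/subsetP => a.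
  by rewrite in_set2 => /orP[]/eqP->.
(* The dart [z] is lost unless it belongs to the edge that is kept; in that case the dart on a third
   face is lost. *)
have [zty|nzty] := eqVneq z (t y).
  exists d2 => //; rewrite !in_setU in_setI (negPf d2S) andbF /= !in_set1 negb_or.
  apply/andP; split; first by apply: contraNneq d2y => ->.
  by apply: contraNneq d2x => ->; rewrite -zty.
exists z => //; rewrite !in_setU in_setI (negPf zS) andbF /= !in_set1 negb_or nzty andbT.
by apply: contraNneq zg => ->.
Qed.

End OneSide.
End Gluing.

(** * Matching the colorings of the two sides *)

Section Recoloring.
Variables (D : finType) (t : {perm D}).
Hypotheses (tK : involutive t) (tN : forall d, t d != d).
Variables (k m : nat).
Hypothesis (km : k = (3 * m) %/ 2).

Section OneReduction.
Variables (r : {perm D}) (x y z w : D) (S : {set D}).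
Hypotheses (gr : good t m r) (nr : nonrepeating t r) (sep : separated t r x y z w S).
Hypothesis small : outer_size t r x y S <= m.
Let f := porbit (t * r) x.
Let g := porbit (t * r) y.
Let r2 := cut2 r x y z w.
Let r3 := shrink t r x y z w S.
(** This is what the descent on the outer size achieves: a vertex strictly inside the complement has
    to avoid the colors of only one of the two faces. *)
Hypothesis no_common : forall e e', e \in f -> e \notin S -> e != z ->
  e' \in g -> e' \notin S -> e' \notin porbit r e.

Let q : quad t r x y z w. Proof. by case: sep. Qed.
Let tS : stable t S. Proof. by case: sep. Qed.
Let r2S : stable r2 S. Proof. by case: sep. Qed.
Let xS : x \in S. Proof. by case: sep. Qed.
Let yS : y \notin S. Proof. by case: sep. Qed.
Let wS : w \in S. Proof. exact: separated_w sep. Qed.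
Let zS : z \notin S. Proof. exact: separated_z sep. Qed.
Let xf : x \in f. Proof. by case: (quad_faces q). Qed.
Let zf : z \in f. Proof. by case: (quad_faces q). Qed.
Let yg : y \in g. Proof. by case: (quad_faces q). Qed.
Let wg : w \in g. Proof. by case: (quad_faces q). Qed.
Let ryx : y \in porbit r x. Proof. by case/and5P: q. Qed.
Let rwz : w \in porbit r z. Proof. by case/and5P: q. Qed.
Let rzx : z \notin porbit r x. Proof. by case/and5P: q. Qed.

Lemma other_side_good : good t m (restr_perm (~: S) r2).
Proof.
apply: restr_good => //; [exact: stableC|exact: stableC|exact: good_ge2 x gr| | |].
- by apply: cut2_planar q _; case: gr.
- by move=> d; case: gr => _ /(_ d) ll _; apply: contra ll; apply: (subsetP (cut2_vertex_sub q d)).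
move=> d; rewrite in_setC => dS; apply: leq_trans (card_face_le _ _ _) _.
have O2 : porbit (t * r2) y = (f :|: g) :\: S.
  by rewrite /r2 -cut2_sym (separated_outer (separated_sym sep)) setUC setDE.
have [dO|dO] := boolP (d \in (f :|: g)).
  have dy : d \in porbit (t * r2) y by rewrite O2 in_setD dS.
  by rewrite -(porbit_eq dy) O2.
move: dO; rewrite in_setU negb_or => /andP[df dg].
by rewrite (separated_face sep) //; apply: nonrepeating_face.
Qed.

Lemma other_side_moved : #|moved (restr_perm (~: S) r2)| < #|moved r|.
Proof.
have [mx _ _ _] := quad_moved sep.
apply/proper_card; apply: sub_proper_trans (moved_restr (stableC r2S)) _.
apply/properP; split; first by rewrite subIset // (moved_cut2 sep).
by exists x => //; rewrite in_setI in_setC xS andbF.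
Qed.

Variables (c1 c2 : D -> 'I_k).
Hypotheses (p1 : proper_map t r3 c1) (p2 : proper_map t (restr_perm (~: S) r2) c2).

Let c1y : c1 y = c1 x. Proof. exact: proper_orbit p1 (shrink_xy tN sep). Qed.
Let c1ty : c1 (t y) = c1 w. Proof. exact: proper_orbit p1 (shrink_wty sep). Qed.

Let c1_vertex d : d \in S -> c1 (r2 d) = c1 d.
Proof.
move=> dS; rewrite -(proj1 p1 d).
have -> : r3 d = tperm w (t y) (tperm x y (r2 d)).
  by rewrite /r3 /shrink permM permM restr_in.
have e1 a : c1 (tperm x y a) = c1 a by case: tpermP => // ->; rewrite c1y.
have e2 a : c1 (tperm w (t y) a) = c1 a by case: tpermP => // ->; rewrite c1ty.
by rewrite e2 e1.
Qed.

Let c2_vertex d : d \notin S -> c2 (r2 d) = c2 d.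
Proof.
move=> dS; rewrite -(proj1 p2 d) restr_in ?in_setC //; exact: stableC.
Qed.

Let c1_f d e : d \in f -> e \in f -> d \in S -> e \in S -> c1 d = c1 e -> e \in porbit r d.
Proof.
move=> df ef dS eS cde; apply: (shrink_vertex tN sep) => //.
have fx := shrink_facex tK tN sep; apply: (proj2 p1) cde.
have dx : d \in porbit (t * r3) x by rewrite fx in_setU in_setI df dS.
by rewrite -(porbit_eq dx) fx in_setU in_setI ef eS.
Qed.

Let c1_g d e : d \in g -> e \in g -> d \in S -> e \in S -> c1 d = c1 e -> e \in porbit r d.
Proof.
move=> df ef dS eS cde; apply: (shrink_vertex tN sep) => //.
have fx := shrink_facew tK tN sep; apply: (proj2 p1) cde.
have dx : d \in porbit (t * r3) w by rewrite fx in_setU in_setI df dS.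
by rewrite -(porbit_eq dx) fx in_setU in_setI ef eS.
Qed.

(** On this face of the shrunk map the corner [t y] stands for the lost corner [z]; this is what the
    new edge is for. *)
Let c1_f_w d : d \in f -> d \in S -> c1 d <> c1 w.
Proof.
move=> df dS; rewrite -c1ty => cde.
have fx := shrink_facex tK tN sep.
have dx : d \in porbit (t * r3) x by rewrite fx in_setU in_setI df dS.
have : t y \in porbit r3 d.
  by apply: (proj2 p1) cde; rewrite -(porbit_eq dx) fx in_setU in_set1 eqxx orbT.
move/(shrink_vertex_ty tN sep dS); rewrite -(porbit_eq rwz) => dz.
have zd : z = d by apply: nr => //; rewrite -[porbit _ z](porbit_eq zf).
by move: zS; rewrite zd dS.
Qed.

Let c1_g_x d : d \in g -> d \in S -> c1 d <> c1 x.
Proof.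
move=> df dS; rewrite -c1y => cde.
have fx := shrink_facew tK tN sep.
have dx : d \in porbit (t * r3) w by rewrite fx in_setU in_setI df dS.
have : y \in porbit r3 d.
  by apply: (proj2 p1) cde; rewrite -(porbit_eq dx) fx in_setU in_set1 eqxx orbT.
move/(shrink_vertex_y tN sep dS); rewrite (porbit_eq ryx) => dz.
have yd : y = d by apply: nr.
by move: yS; rewrite yd dS.
Qed.

Let c2_outer d e : d \in f :|: g -> e \in f :|: g -> d \notin S -> e \notin S ->
  c2 d = c2 e -> e \in porbit r d.
Proof.
move=> dO eO dS eS cde; apply: (subsetP (cut2_vertex_sub q d)).
have O2 : porbit (t * r2) y = (f :|: g) :\: S.
  by rewrite /r2 -cut2_sym (separated_outer (separated_sym sep)) setUC setDE.
have dy : d \in porbit (t * r2) y by rewrite O2 in_setD dS.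
have [tS' r2S'] := (stableC tS, stableC r2S).
rewrite -(restr_porbit r2S') ?in_setC //; apply: (proj2 p2) cde.
by rewrite restr_face ?in_setC // -(porbit_eq dy) O2 in_setD eS.
Qed.

Let face_f d e : d \in f -> e \in f -> e \in porbit r d -> d = e.
Proof. by move=> df ef; move/nr; apply; rewrite -(porbit_eq df). Qed.
Let face_g d e : d \in g -> e \in g -> e \in porbit r d -> d = e.
Proof. by move=> df ef; move/nr; apply; rewrite -(porbit_eq df). Qed.
Let inf d : d \in f -> d \in f :|: g. Proof. by rewrite in_setU => ->. Qed.
Let ing d : d \in g -> d \in f :|: g. Proof. by rewrite in_setU => ->; rewrite orbT. Qed.

(** The corners of the two faces other than those of the curve. The sizes of [F1], [G1], [F2], [G2]
    are the numbers [p1], [q1], [p2], [q2]. *)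
Let F1 := (f :&: S) :\ x.
Let G1 := (g :&: S) :\ w.
Let F2 := (f :\: S) :\ z.
Let G2 := (g :\: S) :\ y.

Lemma recoloring_sizes :
  [/\ #|F1| + #|F2| + 2 <= m, #|G1| + #|G2| + 2 <= m & #|F2| + #|G2| + 2 <= m].
Proof.
have hf : #|f| <= m := nonrepeating_face x gr nr.
have hg : #|g| <= m := nonrepeating_face y gr nr.
have disj : (f :\: S) :&: (g :\: S) = set0.
  apply/setP => a; rewrite !inE; apply/negP => /andP[/andP[_ af] /andP[_ ag]].
  exact: (disjoint_faces q af ag).
have ho : #|f :\: S| + #|g :\: S| <= m.
  by rewrite -cardsUI disj cards0 addn0 -setDUl.
have e1 : #|f :&: S| = #|F1|.+1 by rewrite (cardsD1 x) in_setI xf xS.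
have e2 : #|f :\: S| = #|F2|.+1 by rewrite (cardsD1 z) in_setD zf zS.
have e3 : #|g :&: S| = #|G1|.+1 by rewrite (cardsD1 w) in_setI wg wS.
have e4 : #|g :\: S| = #|G2|.+1 by rewrite (cardsD1 y) in_setD yg yS.
have ef : #|f :&: S| + #|f :\: S| = #|f| := cardsID S f.
have eg : #|g :&: S| + #|g :\: S| = #|g| := cardsID S g.
by move: hf hg ho e1 e2 e3 e4 ef eg; clear; split; lia.
Qed.

Lemma recoloring_perm : exists p : {perm 'I_k},
  [/\ p (c2 y) = c1 x, p (c2 z) = c1 w,
      forall d e, d \in F1 -> e \in F2 -> p (c2 e) <> c1 d,
      forall d e, d \in G1 -> e \in G2 -> p (c2 e) <> c1 d
    & forall e, e \in F2 :|: G2 -> p (c2 e) <> c1 x /\ p (c2 e) <> c1 w].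
Proof.
pose X := ~: (c1 @: F1) :\: [set c1 x; c1 w]; pose Y := ~: (c1 @: G1) :\: [set c1 x; c1 w].
have [s1 s2 s3] := recoloring_sizes.
have le2 : #|[set c1 x; c1 w]| <= 2 by rewrite cards2; case: (_ != _).
have mk := leq_mk km.
have cD (A : {set 'I_k}) : k <= #|~: A :\: [set c1 x; c1 w]| + #|A| + 2.
  have h1 : #|A| + #|~: A| = k by rewrite cardsC card_ord.
  have h2 : #|~: A :&: [set c1 x; c1 w]| + #|~: A :\: [set c1 x; c1 w]| = #|~: A|.
    exact: cardsID.
  have h3 : #|~: A :&: [set c1 x; c1 w]| <= 2.
    exact: leq_trans (subset_leq_card (subsetIr _ _)) le2.
  by move: h1 h2 h3; clear; lia.
have lF1 : #|c1 @: F1| <= #|F1| := leq_imset_card c1 F1.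
have lG1 : #|c1 @: G1| <= #|G1| := leq_imset_card c1 G1.
have lF2 : #|c2 @: F2| <= #|F2| := leq_imset_card c2 F2.
have lG2 : #|c2 @: G2| <= #|G2| := leq_imset_card c2 G2.
have hX : #|c2 @: F2| <= #|X|.
  have h : k <= #|X| + #|c1 @: F1| + 2 := cD (c1 @: F1).
  by move: h s1 lF1 lF2 mk; clear; lia.
have hY : #|c2 @: G2| <= #|Y|.
  have h : k <= #|Y| + #|c1 @: G1| + 2 := cD (c1 @: G1).
  by move: h s2 lG1 lG2 mk; clear; lia.
(* A color outside [X :|: Y] is that of [x] or [w], or occurs on both [F1] and [G1]. The bound then
   follows from the sum of the three inequalities of [recoloring_sizes]. *)
have hXY : #|c2 @: F2| + #|c2 @: G2| <= #|X :|: Y|.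
  have h : k <= #|X :|: Y| + #|c1 @: F1 :&: c1 @: G1| + 2.
    by rewrite -setDUl -setCI; apply: cD.
  have iF : #|c1 @: F1 :&: c1 @: G1| <= #|c1 @: F1| by apply/subset_leq_card/subsetIl.
  have iG : #|c1 @: F1 :&: c1 @: G1| <= #|c1 @: G1| by apply/subset_leq_card/subsetIr.
  by move: h iF iG s1 s2 s3 lF1 lG1 lF2 lG2 mk km; clear; lia.
have [X' [Y' [sX sY dXY cX cY]]] := ex_disjoint_subsets hX hY hXY.
have disj2 : [disjoint c2 @: F2 & c2 @: G2].
  rewrite -setI_eq0; apply/eqP/setP => c; rewrite !inE; apply/negP.
  case/andP=> /imsetP[a aF ->] /imsetP[b bG] cab.
  move: aF bG; rewrite !inE => /and3P[az aS af] /and3P[by_ bS bg].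
  by have := no_common af aS az bg bS; rewrite (c2_outer (inf af) (ing bg) aS bS cab).
have nyz : c2 y != c2 z.
  apply/eqP => /(c2_outer (ing yg) (inf zf) yS zS).
  by rewrite -(porbit_eq ryx) (negPf rzx).
have nF2 a : a \in F2 -> c2 a != c2 y /\ c2 a != c2 z.
  rewrite !inE => /and3P[az aS af]; split; apply/eqP.
    move/(c2_outer (inf af) (ing yg) aS yS) => ya.
    have xa : x = a.
      by apply: face_f => //; rewrite (porbit_eq ryx) porbit_sym.
    by rewrite -xa xS in aS.
  move/(c2_outer (inf af) (inf zf) aS zS) => /(face_f af zf) e.
  by rewrite e eqxx in az.
have nG2 a : a \in G2 -> c2 a != c2 y /\ c2 a != c2 z.
  rewrite !inE => /and3P[ay aS ag]; split; apply/eqP.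
    by move/(c2_outer (ing ag) (ing yg) aS yS) => /(face_g ag yg) e; rewrite e eqxx in ay.
  move/(c2_outer (ing ag) (inf zf) aS zS) => za.
  have wa : w = a.
    by apply: face_g => //; rewrite -(porbit_eq rwz) porbit_sym.
  by rewrite -wa wS in aS.
have nxw : c1 x != c1 w by apply/eqP/c1_f_w.
have notin c : c \in X' \/ c \in Y' -> c != c1 x /\ c != c1 w.
  by case=> [/(subsetP sX)|/(subsetP sY)]; rewrite !inE negb_or => /andP[/andP[]].
have [p] : exists p : {perm 'I_k},
    map p ([:: c2 y; c2 z] ++ enum (c2 @: F2) ++ enum (c2 @: G2)) =
    [:: c1 x; c1 w] ++ enum X' ++ enum Y'.
  apply: perm_matching.
  - rewrite !cat_uniq !enum_uniq /= !inE nyz /= andbT; apply/andP; split.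
      apply/hasPn => c; rewrite mem_cat !mem_enum => /orP[]/imsetP[a h ->].
        by rewrite !inE; case: (nF2 a h) => /negPf-> /negPf->.
      by rewrite !inE; case: (nG2 a h) => /negPf-> /negPf->.
    apply/hasPn => c; rewrite !mem_enum => cG.
    by apply/negP => cF; have := disjointFr disj2 cF; rewrite cG.
  - rewrite !cat_uniq !enum_uniq /= !inE nxw /= andbT; apply/andP; split.
      apply/hasPn => c; rewrite mem_cat !mem_enum !inE negb_or => /orP h.
      by case: (notin c h) => -> ->.
    apply/hasPn => c; rewrite !mem_enum => cG.
    by apply/negP => cF; have := disjointFr dXY cF; rewrite cG.
  - by rewrite !size_cat -!cardE cX cY.
rewrite map_cat /= => -[py pz]; rewrite map_cat => /eqP.
rewrite eqseq_cat ?size_map -?cardE // => /andP[/eqP pF /eqP pG].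
have inX a : a \in F2 -> p (c2 a) \in X'.
  by move=> aF; rewrite -mem_enum -pF map_f // mem_enum imset_f.
have inY a : a \in G2 -> p (c2 a) \in Y'.
  by move=> aF; rewrite -mem_enum -pG map_f // mem_enum imset_f.
exists p; split=> //.
- move=> d e dF /inX/(subsetP sX) + e1; rewrite e1 !inE => /andP[_ /negP[]].
  exact: imset_f.
- move=> d e dF /inY/(subsetP sY) + e1; rewrite e1 !inE => /andP[_ /negP[]].
  exact: imset_f.
- move=> e; rewrite in_setU => /orP h.
  have [|/eqP ? /eqP ?] := notin (p (c2 e)); last by split.
  by case: h => [/inX|/inY]; [left|right].
Qed.

Lemma colorable_glued : colorable t k r.
Proof.
have [p [py pz pF pG pO]] := recoloring_perm.
pose c d := if d \in S then c1 d else p (c2 d); exists c.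
have [sx sy sz sw] := swap2E q.
(* The corners of the curve get matching colors, so [c] does not see [swap2], by which [r] and the
   cut rotation differ. *)
have cs a : c (swap2 x y z w a) = c a.
  have [aq|/swap2D->//] := boolP (a \in [:: x; y; z; w]).
  have [cx cy cz cw] : [/\ c x = c1 x, c y = c1 x, c z = c1 w & c w = c1 w].
    by rewrite /c xS (negPf yS) (negPf zS) wS py pz.
  by move: aq; rewrite !inE => /or4P[]/eqP->; rewrite ?sx ?sy ?sz ?sw ?cx ?cy ?cz ?cw.
split=> [d|d e de].
  rewrite -cs -permM /swap2 mulgA -/(cut2 r x y z w) -/r2 /c stable_mem //.
  by case: ifPn => dS; rewrite ?c1_vertex ?c2_vertex.
have crossf a b : a \in f -> b \in f -> a \in S -> b \notin S -> c a <> c b.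
  move=> af bf aS bS; rewrite /c aS (negPf bS).
  have [->|bz] := eqVneq b z; first by rewrite pz; apply: c1_f_w.
  have bF : b \in F2 by rewrite !inE bz bS bf.
  have [->|ax] := eqVneq a x.
    by move/esym; apply: (proj1 (pO b _)); rewrite in_setU bF.
  by move/esym; apply: pF; rewrite // !inE ax af aS.
have crossg a b : a \in g -> b \in g -> a \in S -> b \notin S -> c a <> c b.
  move=> af bf aS bS; rewrite /c aS (negPf bS).
  have [->|bz] := eqVneq b y; first by rewrite py; apply: c1_g_x.
  have bG : b \in G2 by rewrite !inE bz bS bf.
  have [->|ax] := eqVneq a w.
    by move/esym; apply: (proj2 (pO b _)); rewrite in_setU bG orbT.
  by move/esym; apply: pG; rewrite // !inE ax af aS.
have [df|df] := boolP (d \in f).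
  have ef : e \in f by rewrite /f (porbit_eq df).
  have [dS|dS] := boolP (d \in S); have [eS|eS] := boolP (e \in S).
  - by rewrite /c dS eS; apply: c1_f.
  - by move/(crossf _ _ df ef dS eS).
  - by move/esym/(crossf _ _ ef df eS dS).
  - by rewrite /c (negPf dS) (negPf eS) => /perm_inj; apply: c2_outer; rewrite ?inf.
have [dg|dg] := boolP (d \in g).
  have eg : e \in g by rewrite /g (porbit_eq dg).
  have [dS|dS] := boolP (d \in S); have [eS|eS] := boolP (e \in S).
  - by rewrite /c dS eS; apply: c1_g.
  - by move/(crossg _ _ dg eg dS eS).
  - by move/esym/(crossg _ _ eg dg eS dS).
  - by rewrite /c (negPf dS) (negPf eS) => /perm_inj; apply: c2_outer; rewrite ?ing.
have fd := separated_face sep df dg; have fS := stable_phi tS r2S.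
have ed : e \in porbit (t * r2) d by rewrite fd.
have eS : (e \in S) = (d \in S).
  apply/idP/idP => h; last exact: (subsetP (stable_porbit fS h)).
  by apply: (subsetP (stable_porbit fS h)); rewrite porbit_sym.
rewrite /c eS; case: ifPn => dS.
  move=> cde; apply: (shrink_vertex tN sep); rewrite ?eS //; apply: (proj2 p1) cde.
  rewrite (shrink_face_out tK sep) ?restr_face //.
    by rewrite in_setI in_setU negb_and negb_or df dg.
  rewrite in_set2 negb_or; apply/andP; split.
    by apply: contraNneq dg => ->.
  by apply: contraTneq dS => ->; rewrite stable_mem.
move/perm_inj => cde; apply: (subsetP (cut2_vertex_sub q d)).
have [tS' r2S'] := (stableC tS, stableC r2S).
rewrite -(restr_porbit r2S') ?in_setC //; apply: (proj2 p2) cde.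
by rewrite restr_face ?in_setC.
Qed.

End OneReduction.

Lemma colorable_reducing r x y z w S : good t m r -> nonrepeating t r ->
  (forall r', good t m r' -> #|moved r'| < #|moved r| -> colorable t k r') ->
  reducing t r x y z w S -> colorable t k r.
Proof.
move=> gr nr IH; have [n] := ubnP (outer_size t r x y S).
elim: n x y z w S => // n IHn x y z w S; rewrite ltnS => os red.
have [sep d1 d2] := red; have [q _ _ _ _] := sep.
(* The two faces together have at most [2 * m] corners, so if one side has more than [m] of them,
   the other has fewer than [m]. *)
have [small|big] := leqP (outer_size t r x y S) m; last first.
  apply: IHn (reducing_sym red); apply: leq_trans os; apply: (leq_trans _ big).
  pose fg := porbit (t * r) x :|: porbit (t * r) y.
  have hx : #|porbit (t * r) x| <= m := nonrepeating_face x gr nr.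
  have hy : #|porbit (t * r) y| <= m := nonrepeating_face y gr nr.
  have hfg : #|fg| <= #|porbit (t * r) x| + #|porbit (t * r) y| by rewrite -cardsUI leq_addr.
  have hS : #|fg :&: S| + #|fg :\: S| = #|fg| := cardsID S fg.
  have big' : m < #|fg :\: S| := big.
  rewrite /outer_size [porbit _ y :|: _]setUC setDE setCK -/fg.
  by move: hx hy hfg hS big'; clear; lia.
have [/existsP[e /existsP[e' /and5P[ef eS ez e'g /andP[e'S ee']]]]|/existsPn none] := boolP
  [exists e, exists e', [&& e \in porbit (t * r) x, e \notin S, e != z,
     e' \in porbit (t * r) y, e' \notin S & e' \in porbit r e]].
  have [|x' [y' [z' [w' [S' [red' lt]]]]]] := reducing_smaller tK tN nr _ red ef eS ez e'g e'S ee'.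
    by case: gr.
  by apply: IHn red'; apply: leq_trans os.
have no_common e e' : e \in porbit (t * r) x -> e \notin S -> e != z ->
    e' \in porbit (t * r) y -> e' \notin S -> e' \notin porbit r e.
  move=> ef eS ez e'g e'S; have /existsPn/(_ e') := none e.
  by rewrite ef eS ez e'g e'S.
have [c1 p1] : colorable t k (shrink t r x y z w S).
  by apply: IH; [apply: shrink_good|apply: shrink_moved].
have [c2 p2] : colorable t k (restr_perm (~: S) (cut2 r x y z w)).
  by apply: IH; [apply: other_side_good|apply: other_side_moved].
exact: (colorable_glued gr nr sep small no_common p1 p2).
Qed.

End Recoloring.

(** * Irreducible maps *)

Section Irreducible.
Variables (D : finType) (t : {perm D}).
Hypotheses (tK : involutive t) (tN : forall d, t d != d).
Implicit Types (r : {perm D}) (x y z w d : D) (S : {set D}).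

Definition reducingb r x y z w S :=
  [&& quad t r x y z w, [forall a in S, t a \in S],
      [forall a in S, cut2 r x y z w a \in S], x \in S, y \notin S,
      [exists d in S, third t r x y d] & [exists d in ~: S, third t r x y d]].

Lemma reducingP r x y z w S :
  reflect (reducing t r x y z w S) (reducingb r x y z w S).
Proof.
apply: (iffP and5P).
  case=> q /forall_inP tS /forall_inP rS xS /and3P[yS].
  move=> /exists_inP[d1 d1S t1] /exists_inP[d2]; rewrite in_setC => d2S t2.
  by split; [split|exists d1|exists d2].
case=> -[q tS rS xS yS] [d1 d1S t1] [d2 d2S t2]; split=> //.
- exact/forall_inP.
- exact/forall_inP.
rewrite yS /=; apply/andP; split; apply/exists_inP; first by exists d1.
by exists d2; rewrite ?in_setC.
Qed.

Definition linked r := forall d e, d \in moved r -> e \in moved r -> conn t r d e.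

Record irreducible r : Prop := Irreducible {
  irr_planar : planar t r;
  irr_loopless : loopless_map t r;
  irr_nonrepeating : nonrepeating t r;
  irr_linked : linked r;
  irr_reducing : forall x y z w S, ~ reducing t r x y z w S;
  irr_faces : 3 < #|porbit (t * r) @: moved r|
}.

Lemma moved_stable r : stable r (moved r).
Proof. by move=> d; rewrite !inE (inj_eq perm_inj). Qed.

Lemma moved_stable_t r : nonrepeating t r -> stable t (moved r).
Proof. by move=> nr d; apply: nonrepeating_moved. Qed.

Lemma unmoved_face r d : nonrepeating t r -> d \notin moved r ->
  r d = d /\ porbit (t * r) d = [set d; t d].
Proof.
move=> nr dm; have fixed a : a \notin moved r -> r a = a by rewrite inE negbK => /eqP.
have tdm : t d \notin moved r by rewrite stable_mem //; apply: moved_stable_t.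
have e : (t * r) d = t d by rewrite permM fixed.
split; first exact: fixed.
by rewrite porbit_invol e // permM tK fixed.
Qed.

Lemma colorable_moved k r (c0 : D -> 'I_k) : nonrepeating t r -> 1 < k ->
  (forall d, d \in moved r -> c0 (r d) = c0 d) ->
  (forall d e, d \in moved r -> e \in porbit (t * r) d -> c0 d = c0 e -> e \in porbit r d) ->
  colorable t k r.
Proof.
move=> nr k2 c0r c0f; have sr := @moved_stable r; have st := moved_stable_t nr.
have sf := stable_phi st sr.
(* A removed edge only needs different colors at its ends; comparing the ranks of its two darts
   tells them apart. *)
pose c d := if d \in moved r then c0 d
  else if enum_rank d < enum_rank (t d) then Ordinal k2 else Ordinal (ltnW k2).
exists c; split=> [d|d e de].
  rewrite /c stable_mem //; case: ifPn => dm; first exact: c0r.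
  by have [-> _] := unmoved_face nr dm.
rewrite /c; have em : (e \in moved r) = (d \in moved r).
  apply/idP/idP => h; last exact: (subsetP (stable_porbit sf h)).
  by apply: (subsetP (stable_porbit sf h)); rewrite porbit_sym.
rewrite em; case: ifPn => dm; first exact: c0f.
move: de; have [_ ->] := unmoved_face nr dm.
rewrite in_set2 => /orP[/eqP->|/eqP->]; first by rewrite porbit_id.
rewrite tK; have : enum_rank d != enum_rank (t d) by rewrite (inj_eq enum_rank_inj) eq_sym.
by rewrite -val_eqE neq_ltn /= => /orP[] h; rewrite h ltnNge ltnW.
Qed.

Lemma colorable_few_faces k m r : k = (3 * m) %/ 2 -> good t m r -> nonrepeating t r ->
  #|porbit (t * r) @: moved r| <= 3 -> colorable t k r.
Proof.
move=> km gr nr few.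
have [D0|/card_gt0P[d0 _]] := posnP #|D|.
  have no d : False by have /card0_eq/(_ d) := D0.
  by exists (fun d => False_rect _ (no d)); split=> d; case: (no d).
have k2 : 1 < k := leq_trans (good_ge2 d0 gr) (leq_mk km).
have sr := @moved_stable r; have st := moved_stable_t nr; have sf := stable_phi st sr.
(* Corners are counted by vertices, each having at least the corners [d] and [r d], and by faces,
   each having at most [m]. *)
have eV : #|moved r| = \sum_(A in porbit r @: moved r) #|A|.
  exact: card_partition (porbit_partition sr).
have eF : #|moved r| = \sum_(A in porbit (t * r) @: moved r) #|A|.
  exact: card_partition (porbit_partition sf).
have leV : #|porbit r @: moved r| * 2 <= #|moved r|.
  rewrite eV -sum_nat_const; apply: leq_sum => _ /imsetP[d dm ->].
  have -> : 2 = #|[set d; r d]| by rewrite cards2 eq_sym; move: dm; rewrite inE => ->.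
  apply/subset_leq_card/subsetP => a; rewrite in_set2 => /orP[]/eqP->.
    exact: porbit_id.
  by rewrite -eq_porbit_mem porbit_step.
have leF : #|moved r| <= #|porbit (t * r) @: moved r| * m.
  rewrite eF -sum_nat_const; apply: leq_sum => _ /imsetP[d dm ->].
  exact: nonrepeating_face.
have lek : #|porbit r @: moved r| <= k.
  have h : #|porbit (t * r) @: moved r| * m <= 3 * m by rewrite leq_mul2r few orbT.
  by move: h leV leF km; clear; lia.
pose n d := index (porbit r d) (enum (porbit r @: moved r)).
have nk d : d \in moved r -> n d < k.
  by move=> dm; apply: leq_trans lek; rewrite cardE index_mem mem_enum imset_f.
(* The remainder modulo [k] makes the function total; on moved darts the index is already below
   [k]. *)
apply: (@colorable_moved _ _ (fun d => Ordinal (ltn_pmod (n d) (ltnW k2)))) => //.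
  by move=> d dm; apply: val_inj; rewrite /= /n porbit_step.
move=> d e dm de /(congr1 val) /=.
have em : e \in moved r by apply: (subsetP (stable_porbit sf dm)).
rewrite !modn_small ?nk // => eqi; have : porbit r d = porbit r e.
  have idx a : a \in moved r -> nth set0 (enum (porbit r @: moved r)) (n a) = porbit r a.
    by move=> am; rewrite nth_index // mem_enum imset_f.
  by rewrite -(idx d) // eqi idx.
by move=> ->; apply: porbit_id.
Qed.

Lemma colorable_all k m : k = (3 * m) %/ 2 ->
  (forall r, good t m r -> irreducible r -> colorable t k r) ->
  forall r, good t m r -> colorable t k r.
Proof.
move=> km base r; have [n] := ubnP #|moved r|; elim: n r => // n IHn r.
rewrite ltnS => mn gr.
have IH r' : good t m r' -> #|moved r'| < #|moved r| -> colorable t k r'.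
  by move=> gr' lt; apply: IHn => //; apply: leq_trans mn.
have [/exists_inP[d dm /exists_inP[e em]]|/exists_inPn lk] := boolP
  [exists d in moved r, exists e in moved r, ~~ conn t r d e].
  exact: colorable_disconnected IH dm em.
have [/existsP[x /existsP[y /and3P[xy ryx fyx]]]|/existsPn nrp] := boolP
  [exists x, exists y, [&& x != y, y \in porbit r x & y \in porbit (t * r) x]].
  exact: colorable_repeated IH xy ryx fyx.
have nr : nonrepeating t r.
  move=> x y ryx fyx; apply/eqP; have /existsPn/(_ y) := nrp x.
  by rewrite ryx fyx !andbT negbK.
have [/existsP[x /existsP[y /existsP[z /existsP[w /existsP[S /reducingP red]]]]]|none] := boolP
  [exists x, exists y, exists z, exists w, exists S, reducingb r x y z w S].
  exact: colorable_reducing IH red.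
have [few|many] := leqP #|porbit (t * r) @: moved r| 3.
  exact: (colorable_few_faces km gr nr few).
apply: base => //; case: (gr) => pl ll _; split=> // [d e dm em|x y z w S /reducingP red].
  by have /exists_inPn/(_ e em) := lk d dm; rewrite negbK.
case/negP: none; apply/existsP; exists x; apply/existsP; exists y; apply/existsP; exists z.
by apply/existsP; exists w; apply/existsP; exists S.
Qed.

(** * Irreducible maps without vertices of degree two *)

Section CubicLike.
Variable r : {perm D}.
Hypothesis irr : irreducible r.
Hypothesis deg3 : forall d, d \in moved r -> r (r d) != d.

Let pl := irr_planar irr.
Let ll := irr_loopless irr.
Let nr := irr_nonrepeating irr.
Let lk := irr_linked irr.

Lemma porbit_moved d e : e \in porbit r d -> d \in moved r -> e \in moved r.
Proof. by move=> ed dm; apply: (subsetP (stable_porbit (@moved_stable r) dm)). Qed.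

Let same_face a b c : a \in porbit (t * r) c -> b \in porbit (t * r) c ->
  b \in porbit r a -> a = b.
Proof. by move=> ac bc ab; apply: nr => //; rewrite -(porbit_eq ac). Qed.

(** If the end [t x] were not at the vertex of [z], all its corners, at least three, would be in [S]
    and hence on the two faces of the curve, although each face has at most one of them. The same
    uniqueness then identifies [t x] with [w] and makes [x] a fixed point of the cut rotation. *)
Lemma trivial_side x y z w S : separated t r x y z w S ->
  (forall d, d \in S -> ~~ third t r x y d) -> r x = y /\ t x = w.
Proof.
move=> sep no3; have wS := separated_w sep; have zS := separated_z sep.
have [mx my mz mw] := quad_moved sep.
have [q tS r2S xS yS] := sep; have [xf zf yg wg _] := quad_faces q.
have [ryx rwz rzx _ _] := and5P q; have [sx sy sz sw] := swap2E q.
pose f := porbit (t * r) x; pose g := porbit (t * r) y.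
have infg d : d \in S -> d \in moved r -> d \in f \/ d \in g.
  move=> dS dm; have := no3 d dS; rewrite /third dm /= negb_and !negbK.
  by case/orP; [left|right].
have tm := moved_stable_t nr mx.
have tz : t x \in porbit r z.
  apply: contraT => tz; have tx : t x \notin porbit r x := ll x.
  have r2t := cut2_vertex_out q tx tz.
  have sub := subsetP (stable_porbit r2S (tS _ xS)); rewrite r2t in sub.
  have t1 : r (t x) \in porbit r (t x) by rewrite -eq_porbit_mem porbit_step.
  have t2 : r (r (t x)) \in porbit r (t x) by rewrite -eq_porbit_mem !porbit_step.
  have t12 : r (r (t x)) \in porbit r (r (t x)) by rewrite -eq_porbit_mem porbit_step.
  have n1 : t x <> r (t x) by move=> e; move: tm; rewrite inE -e eqxx.
  have n12 : r (t x) <> r (r (t x)) by move/perm_inj.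
  have n2 : t x <> r (r (t x)) by move=> e; have := deg3 tm; rewrite -e eqxx.
  have i0 := infg _ (sub _ (porbit_id r _)) tm.
  have i1 := infg _ (sub _ t1) (porbit_moved t1 tm).
  have i2 := infg _ (sub _ t2) (porbit_moved t2 tm).
  by case: i0 => h0; case: i1 => h1; case: i2 => h2;
    do ?[case: (n1 (same_face h0 h1 t1))|case: (n2 (same_face h0 h2 t2))
        |case: (n12 (same_face h1 h2 t12))].
split; last first.
  case: (infg _ (tS _ xS) tm) => h.
    have e : z = t x by apply: same_face zf h tz.
    by rewrite e tS // in zS.
  by apply: same_face h wg _; rewrite -(porbit_eq tz).
have e2 : cut2 r x y z w x = swap2 x y z w (r x) by rewrite !permM.
have in2 : cut2 r x y z w x \in porbit r x.
  by apply: (subsetP (cut2_vertex_sub q x)); rewrite -eq_porbit_mem porbit_step.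
have eqx : cut2 r x y z w x = x.
  case: (infg _ (r2S _ xS) (porbit_moved in2 mx)) => h.
    by apply/esym/(same_face xf h).
  have e : y = cut2 r x y z w x by apply: same_face yg h _; rewrite -(porbit_eq ryx).
  by have := r2S _ xS; rewrite -e (negPf yS).
by apply: (@perm_inj _ (swap2 x y z w)); rewrite -e2 eqx sy.
Qed.

Lemma irreducible_quad x y z w : quad t r x y z w ->
  (r x = y /\ t x = w) \/ (r y = x /\ t y = z).
Proof.
move=> q; have [S sep] := quad_separated tK tN pl q.
have [/exists_inP d1|/exists_inPn no1] := boolP [exists d in S, third t r x y d]; last first.
  by left; apply: trivial_side sep _.
have [/exists_inP[d2 d2S t2]|/exists_inPn no2] :=
  boolP [exists d in ~: S, third t r x y d].
  case: (irr_reducing irr (And3 sep d1 _)).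
  by exists d2 => //; rewrite -in_setC.
right; apply: trivial_side (separated_sym sep) _ => d dS.
by rewrite third_sym no2.
Qed.

(** The closed curve follows the two parallel edges, each through the face of its dart. *)
Lemma parallel_quad x e : e != x -> e \in porbit r x -> t e \in porbit r (t x) ->
  (r x = e /\ t x = r (t e)) \/ (r e = x /\ t e = r (t x)).
Proof.
move=> ex rex rte; apply: irreducible_quad; rewrite /quad rex.
have rtx : porbit r (r (t x)) = porbit r (t x) by rewrite porbit_step.
rewrite rtx -eq_porbit_mem porbit_step eq_porbit_mem rte -eq_porbit_mem porbit_step.
rewrite eq_porbit_mem ll !mem_face_step /=.
by apply: contra ex => fex; rewrite eq_sym; apply/eqP/nr.
Qed.

(** Now the curve passes [e] on its other side. The edge alone on one side of it can only be that of
    [r e], which is thus a third parallel edge. *)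
Lemma parallel_third x e : e != x -> e \in porbit r x -> t e \in porbit r (t x) ->
  x \in moved r -> r x = e -> r (r e) = x /\ t (r e) = r (t x).
Proof.
move=> ex rex rte xm rxe.
have rree : r e \in porbit r x by rewrite -eq_porbit_mem porbit_step eq_porbit_mem.
have : quad t r x (r e) (r (t x)) (t e).
  rewrite /quad rree mem_face_step /= porbit_step rte -eq_porbit_mem porbit_step.
  rewrite eq_porbit_mem ll porbit_sym -{1}[e in r e]tK mem_face_step /=.
  apply/negP => h; have := deg3 xm; rewrite rxe => /eqP[]; apply/esym.
  exact: nr.
case/irreducible_quad => [[]|//]; rewrite rxe => ee _.
by have := porbit_moved rex xm; rewrite inE -ee eqxx.
Qed.

(** Applying [parallel_third] around the vertex yields three edges that follow each other at both
    ends. As the map is linked, they are all of it, and it has at most three faces, against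
    [irr_faces]. *)
Lemma parallel_eq x e : x \in moved r -> e \in porbit r x -> t e \in porbit r (t x) -> e = x.
Proof.
move=> xm rex rte; apply/eqP; apply: contraT => ex.
wlog rxe : x e xm rex rte ex / r x = e.
  move=> gen; case: (parallel_quad ex rex rte) => [[h _]|[h _]]; first exact: (gen x e).
  apply: (gen e x) => //; try by rewrite 1?porbit_sym // eq_sym.
  exact: porbit_moved rex xm.
have [r3 t3] := parallel_third ex rex rte xm rxe.
set e3 := r e in r3 t3; have em := porbit_moved rex xm.
have re3 : e3 \in porbit r e by rewrite -eq_porbit_mem porbit_step.
have e3m := porbit_moved re3 em.
have ne3 : e3 != e by move: em; rewrite inE.
have te3 : t e3 \in porbit r (t x) by rewrite t3 -eq_porbit_mem porbit_step.
have te3e : t e3 \in porbit r (t e) by rewrite -(porbit_eq rte).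
have [_ t1] := parallel_third ne3 re3 te3e em erefl.
have rx3 : x \in porbit r e3 by rewrite -r3 -eq_porbit_mem porbit_step.
have nx3 : x != e3 by rewrite -r3; move: e3m; rewrite inE.
have tx3 : t x \in porbit r (t e3) by rewrite porbit_sym.
have [_ t2] := parallel_third nx3 rx3 tx3 e3m r3.
rewrite -/e3 r3 in t1; rewrite rxe in t2.
pose Q := [set x; e; e3] :|: [set t x; t e; t e3].
have tQ : stable t Q.
  move=> a; rewrite !inE -!orbA => /or4P[/eqP->|/eqP->|/eqP->|/or3P[]/eqP->];
    by rewrite ?tK !eqxx ?orbT.
have rQ : stable r Q.
  move=> a; rewrite !inE -!orbA => /or4P[/eqP->|/eqP->|/eqP->|/or3P[]/eqP->];
    by rewrite ?rxe ?r3 -?t1 -?t2 -?t3 !eqxx ?orbT.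
have xQ : x \in Q by rewrite !inE eqxx.
have : porbit (t * r) @: moved r \subset
    [set porbit (t * r) x; porbit (t * r) e; porbit (t * r) e3].
  apply/subsetP => _ /imsetP[d dm ->].
  have fstep a b : r (t a) = b -> porbit (t * r) b = porbit (t * r) a.
    by move<-; rewrite -permM porbit_step.
  have fe3 := fstep x (t e3) (esym t3); have fx := fstep e (t x) (esym t1).
  have fe := fstep e3 (t e) (esym t2).
  have := stable_conn tQ rQ xQ (lk xm dm); rewrite !inE -!orbA.
  by case/or4P=> [/eqP->|/eqP->|/eqP->|/or3P[]/eqP->]; rewrite ?fe3 ?fx ?fe eqxx ?orbT.
move/subset_leq_card; rewrite leqNgt; case/negP.
apply: leq_ltn_trans (irr_faces irr); rewrite setUC cardsU1 cards2.
by case: (_ \notin _); case: (_ != _).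
Qed.

Section Cut.
(** [K] stands for the darts at no more than two vertices, which [K2] says without counting, and [X]
    for the darts at a union of components of what remains without these vertices. [Y0] says that
    something else remains. *)
Variables X K : {set D}.
Hypotheses (rX : stable r X) (rK : stable r K).
Hypotheses (Xm : X \subset moved r) (Km : K \subset moved r).
Hypothesis (XK : forall d, d \in X -> d \notin K).
Hypothesis (tX : forall d, d \in X -> t d \in X :|: K).
Hypothesis (K2 : forall a b c, a \in K -> b \in K -> c \in K ->
  b \notin porbit r a -> c \notin porbit r a -> c \in porbit r b).
Hypothesis (X0 : exists d, d \in X).
Hypothesis (Y0 : exists2 d, d \in moved r & (d \notin X) && (d \notin K)).

(** The edges with an end in [X]. Around a vertex or along a face, membership changes only at
    corners in [K]. *)
Let E := [set d | (d \in X) || (t d \in X)].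

Let tE : stable t E.
Proof. by move=> d; rewrite !inE tK orbC. Qed.

Let switch d : d \in moved r -> (d \in E) != (r d \in E) -> d \in K.
Proof.
move=> dm; apply: contraR => dK; have [dX|dX] := boolP (d \in X).
  by rewrite !inE dX rX.
have notE a : a \notin X -> a \notin K -> a \notin E.
  move=> aX aK; rewrite inE negb_or aX; apply/negP => /tX.
  by rewrite tK in_setU (negPf aX) (negPf aK).
by rewrite (negPf (notE d _ _)) // (negPf (notE (r d) _ _)) // stable_mem.
Qed.

(** At a vertex of [K] the rotation enters [E] at a corner [x] and leaves it at a corner [y]. On
    their faces membership changes again, at corners [z] and [w] that can only be at the second
    vertex of [K]. The resulting quad has a single edge on one side. Its ends are both in [K], so it
    is not in [E], and it is the edge of [y]. *)
Lemma cut_edge : exists y, [/\ y \in K, t y \in K, r y \in E & r (t y) \in E].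
Proof.
have [d0 d0X] := X0; have [d1 d1m /andP[d1X d1K]] := Y0.
have d0m := subsetP Xm _ d0X.
have d1E : d1 \notin E.
  rewrite inE negb_or d1X; apply/negP => /tX; rewrite tK in_setU.
  by rewrite (negPf d1X) (negPf d1K).
have d0E : d0 \in E by rewrite inE d0X.
have [d dm dsw] : exists2 d, d \in moved r & (d \in E) != (r d \in E).
  apply/exists_inP; apply: contraNT d1E => /exists_inPn none.
  suff : d1 \in E :&: moved r by rewrite in_setI => /andP[].
  have mst := moved_stable_t nr.
  apply: (stable_conn _ _ _ (lk d0m d1m)); rewrite ?in_setI ?d0E //.
    exact: stableI.
  move=> a; rewrite !in_setI => /andP[aE am]; rewrite moved_stable // andbT.
  by have := none a am; rewrite aE negbK => /eqP <-.
have dK := switch dm dsw.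
have rin a : r a \in porbit r a by rewrite -eq_porbit_mem porbit_step.
have [p [p' [pd p'd pE p'E]]] : exists p p',
    [/\ p \in porbit r d, p' \in porbit r d, p \in E & p' \notin E].
  case: (boolP (d \in E)) dsw => dE; rewrite eq_sym => h.
    by exists d, (r d); rewrite porbit_id rin dE; move: h; case: (r d \in E).
  by exists (r d), d; rewrite porbit_id rin dE; move: h; case: (r d \in E).
have p'p : p' \in porbit r p by rewrite -(porbit_eq pd).
have [a [ap aE raE]] := porbit_exit pE p'p p'E.
have [b [bp bE]] : exists b, [/\ b \in porbit r p', b \in ~: E & r b \notin ~: E].
  by apply: (porbit_exit (y := p)); rewrite ?in_setC ?p'E ?negbK // porbit_sym.
rewrite in_setC negbK => rbE; rewrite in_setC in bE.
have inK c : c \in porbit r d -> c \in K by apply: (subsetP (stable_porbit rK dK)).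
pose x := r b; pose y := r a.
have xd : x \in porbit r d.
  by rewrite (porbit_eq p'd) -eq_porbit_mem porbit_step eq_porbit_mem.
have yd : y \in porbit r d.
  by rewrite (porbit_eq pd) -eq_porbit_mem porbit_step eq_porbit_mem.
have xm := porbit_moved xd dm; have ym := porbit_moved yd dm.
have sf := stable_phi (moved_stable_t nr) (@moved_stable r).
have tbx : t b \in porbit (t * r) x.
  by rewrite /x -[b in r b]tK porbit_sym mem_face_step.
have tay : t a \in porbit (t * r) y.
  by rewrite /y -[a in r a]tK porbit_sym mem_face_step.
have swK c u : u \in moved r -> c \in porbit (t * r) u -> (c \in E) != ((t * r) c \in E) ->
    (t * r) c \in K.
  move=> um cu; rewrite permM -(stable_mem _ tE) => /switch tcK; apply: rK; apply: tcK.
  by apply: moved_stable_t => //; apply: (subsetP (stable_porbit sf um)).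
have [a1 [a1x a1E zE]] : exists a1, [/\ a1 \in porbit (t * r) x, a1 \in E & (t * r) a1 \notin E].
  by apply: porbit_exit rbE tbx _; rewrite stable_mem.
have [a2 [a2y a2E]] :
    exists a2, [/\ a2 \in porbit (t * r) y, a2 \in ~: E & (t * r) a2 \notin ~: E].
  apply: (porbit_exit _ tay); first by rewrite in_setC.
  by rewrite in_setC negbK stable_mem.
rewrite in_setC negbK => wE; rewrite in_setC in a2E.
set z := (t * r) a1 in zE; set w := (t * r) a2 in wE.
have zK : z \in K by apply: swK a1x _ => //; rewrite a1E -/z (negPf zE).
have wK : w \in K by apply: swK a2y _ => //; rewrite (negPf a2E) -/w wE.
have zx : z \in porbit (t * r) x by apply: stable_porbit_self.
have wy : w \in porbit (t * r) y by apply: stable_porbit_self.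
have exy : porbit r y = porbit r x by rewrite -(porbit_eq xd) -(porbit_eq yd).
have nzx : z \notin porbit r x by apply: contra zE => rz; rewrite -(nr rz zx).
have nwx : w \notin porbit r x.
  by rewrite -exy; apply: contraL wE => rw; rewrite -(nr rw wy).
have wz : w \in porbit r z by apply: K2 (inK _ xd) zK wK nzx nwx.
have yx : y \in porbit r x by rewrite -exy porbit_id.
have q : quad t r x y z w.
  rewrite /quad yx wz nzx zx wy /=; apply: contra raE => fy.
  by rewrite -/y -(nr yx fy).
case: (irreducible_quad q) => [[_ txw]|[ryx tyz]].
  have : x \in E := rbE; rewrite inE txw => /orP[] /XK; rewrite ?wK //.
  by rewrite (inK _ xd).
exists y; split; rewrite ?ryx ?tyz //; first exact: inK.
suff -> : r z = w by [].
apply: same_face wy _; first by rewrite -tyz mem_face_step.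
by rewrite porbit_step.
Qed.

End Cut.

(* A 2-cut would put one and the same edge in the middle of both of its sides. *)
Lemma no_cut (X K : {set D}) : stable r X -> stable r K ->
  X \subset moved r -> K \subset moved r ->
  (forall d, d \in X -> d \notin K) -> (forall d, d \in X -> t d \in X :|: K) ->
  (forall a b c, a \in K -> b \in K -> c \in K ->
    b \notin porbit r a -> c \notin porbit r a -> c \in porbit r b) ->
  X != set0 -> moved r \subset X :|: K.
Proof.
move=> rX rK Xm Km XK tX K2 /set0Pn X0; apply/subsetP => d dm; apply: contraT => nd.
pose Y := moved r :\: (X :|: K).
have Y0 : exists2 d, d \in moved r & (d \notin X) && (d \notin K).
  by exists d => //; rewrite -negb_or -in_setU.
have [y [yK tyK ryE rtyE]] := cut_edge rX rK Xm XK tX K2 X0 Y0.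
have tm := moved_stable_t nr.
have rY : stable r Y.
  by rewrite /Y setDE; apply: stableI; [exact: moved_stable|apply/stableC/stableU].
have tY a : a \in Y -> t a \in Y :|: K.
  rewrite !in_setU !in_setD !in_setU negb_or => /andP[/andP[aX aK] am].
  have [_|ntK] := boolP (t a \in K); first by rewrite orbT.
  rewrite !orbF tm // andbT.
  by apply/negP => /tX; rewrite tK in_setU (negPf aX) (negPf aK).
have YK a : a \in Y -> a \notin K by rewrite in_setD in_setU negb_or => /andP[/andP[]].
have dY : d \in Y by rewrite in_setD nd.
have X1 : exists2 d, d \in moved r & (d \notin Y) && (d \notin K).
  case: X0 => a aX; exists a; first exact: (subsetP Xm).
  by rewrite XK // in_setD in_setU aX.
have [] := cut_edge rY rK _ YK tY K2 (ex_intro _ d dY) X1; first exact: subsetDl.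
move=> y' [y'K ty'K ry'E rty'E].
have disj a : a \in [set d | (d \in X) || (t d \in X)] ->
    a \in [set d | (d \in Y) || (t d \in Y)] -> False.
  have XY b : b \in X -> b \in Y -> False by move=> bX; rewrite in_setD in_setU bX.
  have XtY b : b \in X -> t b \in Y -> False.
    by move=> /tX; rewrite in_setD => ->.
  rewrite in_set => /orP[] aX; rewrite in_set => /orP[] aY.
  - exact: XY aX aY.
  - exact: XtY aX aY.
  - by apply: XtY aX _; rewrite tK.
  - exact: XY aX aY.
have ym := subsetP Km _ yK.
(* Both edges join the two vertices of [K], so [parallel_eq] identifies them up to orientation; the
   dart that follows would then belong to both sides. *)
have [yy|nyy] := boolP (y' \in porbit r y).
  have ty : t y' \in porbit r (t y).
    by apply: K2 (ll y) _ => //; rewrite (porbit_eq yy) ll.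
  by rewrite (parallel_eq ym yy ty) in ry'E; case: (disj _ ryE ry'E).
have yty : y' \in porbit r (t y) by apply: K2 (ll y) nyy.
have ty : t y' \in porbit r (t (t y)).
  rewrite tK; apply: (K2 (t y)) => //; first by rewrite porbit_sym ll.
  by rewrite (porbit_eq yty) ll.
rewrite (parallel_eq (tm _ ym) yty ty) in ry'E.
by case: (disj _ rtyE ry'E).
Qed.

End CubicLike.
End Irreducible.

(** * Suppression of a vertex of degree two *)

Section Suppress.
Variables (D : finType) (t : {perm D}).
Hypotheses (tK : involutive t) (tN : forall d, t d != d).
Variables (r : {perm D}) (p : D).
Hypotheses (irr : irreducible t r) (pm : p \in moved r) (deg2 : r (r p) = p).
Let q := r p.

(* The vertex of [p] and [q] is removed by joining [t p] to [t q]; the darts [p]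
   and [q] are kept as a separate edge, fixed by the new rotation. *)
Definition suppress_flip : {perm D} := t ^ tperm p (t q).
Definition suppress_rot : {perm D} := r * tperm p q.
Let t' := suppress_flip.
Let r' := suppress_rot.

Let pl := irr_planar irr.
Let ll := irr_loopless irr.
Let nr := irr_nonrepeating irr.
Let lk := irr_linked irr.

Let pq : p != q. Proof. by move: pm; rewrite inE eq_sym. Qed.
Let rp : r p = q. Proof. by []. Qed.
Let rq : r q = p. Proof. exact: deg2. Qed.
Let porbp : porbit r p = [set p; q]. Proof. exact: porbit_invol. Qed.
Let qm : q \in moved r. Proof. by rewrite inE rq. Qed.
Let notloop a b : a \in [set p; q] -> b \in [set p; q] -> t a != b.
Proof.
rewrite -porbp => ap bp; apply: contraNneq (ll a) => ->.
by rewrite -(porbit_eq ap).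
Qed.
Let pin : p \in [set p; q]. Proof. by rewrite !inE eqxx. Qed.
Let qin : q \in [set p; q]. Proof. by rewrite !inE eqxx orbT. Qed.
Let tpN : t p \notin [set p; q].
Proof. by rewrite in_set2 negb_or !notloop. Qed.
Let tqN : t q \notin [set p; q].
Proof. by rewrite in_set2 negb_or !notloop. Qed.
Let rN a : a \notin [set p; q] -> r a \notin [set p; q].
Proof. by rewrite -porbp => h; rewrite stable_mem //; apply: stable_porbit_self. Qed.
Let N1 a : a \notin [set p; q] -> a != p /\ a != q.
Proof. by rewrite in_set2 negb_or => /andP[]. Qed.
Let ttN d : d != t p -> d != t q -> t d \notin [set p; q].
Proof.
move=> a b; rewrite in_set2 negb_or.
by rewrite (contraNneq _ a) ?(contraNneq _ b) // => <-; rewrite tK.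
Qed.
Let tptq : t p != t q. Proof. by rewrite (inj_eq perm_inj). Qed.

Let tE d : t' d = tperm p (t q) (t (tperm p (t q) d)).
Proof. by rewrite /t' /suppress_flip /conjg !permM tpermV. Qed.

Lemma suppress_flipE : [/\ t' p = q, t' q = p, t' (t p) = t q & t' (t q) = t p].
Proof.
have [[a1 a2] [b1 b2]] := (N1 tpN, N1 tqN).
split; rewrite tE.
- by rewrite tpermL tK tpermD // eq_sym.
- by rewrite (tpermD (z := q)) ?tpermR // eq_sym.
- by rewrite (tpermD (z := t p)) 1?eq_sym // tK tpermL.
- by rewrite tpermR tpermD // eq_sym.
Qed.

Lemma suppress_flipD d : d \notin [set p; q] -> d != t p -> d != t q -> t' d = t d.
Proof.
move=> /N1[dp dq] dtp dtq; rewrite tE (tpermD (z := d)) 1?eq_sym // tpermD //.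
  by rewrite -[p]tK (inj_eq perm_inj) eq_sym.
by rewrite (inj_eq perm_inj) eq_sym.
Qed.

Lemma suppress_flipK : involutive t'.
Proof. by move=> d; rewrite !tE tpermK tK tpermK. Qed.

Lemma suppress_flipN d : t' d != d.
Proof. by rewrite tE (can2_eq (@tpermK _ _ _) (@tpermK _ _ _)) tN. Qed.

Lemma suppress_rotE : r' p = p /\ r' q = q.
Proof. by rewrite !permM rp rq tpermR tpermL. Qed.

Lemma suppress_rotD d : d \notin [set p; q] -> r' d = r d.
Proof. by move=> /rN/N1[a b]; rewrite permM tpermD // eq_sym. Qed.

Lemma suppress_porbit d : d \notin [set p; q] -> porbit r' d = porbit r d.
Proof.
by rewrite -porbp => h; rewrite porbit_tperm_out // -?[porbit r q]porbit_step ?rq.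
Qed.

Let porb1 d : d \in [set p; q] -> porbit r' d = [set d].
Proof.
have [e1 e2] := suppress_rotE.
by rewrite in_set2 => /orP[]/eqP->; rewrite porbit_invol ?e1 ?e2 // setUid.
Qed.

Lemma suppress_moved : moved r' = moved r :\: [set p; q].
Proof.
apply/setP => d; rewrite in_setD; have [dp|dp] := boolP (d \in [set p; q]).
  have [e1 e2] := suppress_rotE; rewrite inE.
  by move: dp; rewrite in_set2 => /orP[]/eqP->; rewrite ?e1 ?e2 eqxx.
by rewrite !inE suppress_rotD.
Qed.

Let phiE : [/\ (t * r) (t p) = q, (t * r) (t q) = p, (t * r) p = r (t p) & (t * r) q = r (t q)].
Proof. by rewrite !permM !tK. Qed.

(** If the two neighbors coincided, [nonrepeating] would make [t p] and [t q] follow each other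
    there, and these four darts would be the whole map, with at most two faces. *)
Lemma suppress_ends : t q \notin porbit r (t p).
Proof.
apply/negP => h; have [f1 f2 f3 f4] := phiE.
have e1 : r (t p) = t q.
  apply: nr; first by rewrite porbit_step.
  by rewrite -eq_porbit_mem -[porbit _ (t q)]porbit_step f2 -f3 porbit_step.
have e2 : r (t q) = t p.
  apply: nr; first by rewrite porbit_step porbit_sym.
  by rewrite -eq_porbit_mem -[porbit _ (t p)]porbit_step f1 -f4 porbit_step.
pose Q := [set p; q] :|: [set t p; t q].
have tQ : stable t Q.
  move=> a; rewrite !inE -!orbA => /or4P[]/eqP->; by rewrite ?tK !eqxx ?orbT.
have rQ : stable r Q.
  move=> a; rewrite !inE -!orbA => /or4P[]/eqP->;
    by rewrite ?rp ?rq ?e1 ?e2 !eqxx ?orbT.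
have pQ : p \in Q by rewrite !inE eqxx.
have : porbit (t * r) @: moved r \subset [set porbit (t * r) p; porbit (t * r) q].
  apply/subsetP => _ /imsetP[d dm ->].
  have fp : porbit (t * r) (t q) = porbit (t * r) p by rewrite -[LHS]porbit_step f2.
  have fq : porbit (t * r) (t p) = porbit (t * r) q by rewrite -[LHS]porbit_step f1.
  have := stable_conn tQ rQ pQ (lk pm dm); rewrite !inE -!orbA.
  by case/or4P=> /eqP->; rewrite ?fp ?fq eqxx ?orbT.
move/subset_leq_card; rewrite leqNgt; case/negP.
apply: leq_ltn_trans (irr_faces irr); rewrite cards2.
by apply: (@leq_trans 2) => //; case: (_ != _).
Qed.

Let phi'E d : (t' * r') d = r' (t' d). Proof. exact: permM. Qed.

Let phi'D d : d \notin [set p; q] -> d != t p -> d != t q -> (t' * r') d = (t * r) d.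
Proof.
by move=> dp dtp dtq; rewrite phi'E suppress_flipD // permM suppress_rotD ?ttN.
Qed.

Let phi'4 : [/\ (t' * r') p = q, (t' * r') q = p, (t' * r') (t p) = r (t q)
  & (t' * r') (t q) = r (t p)].
Proof.
have [h1 h2 h3 h4] := suppress_flipE; have [e1 e2] := suppress_rotE.
by split; rewrite phi'E ?h1 ?h2 ?h3 ?h4 ?e1 ?e2 // suppress_rotD.
Qed.

Lemma suppress_phi :
  t' * r' = t * r * tperm q (r (t q)) * tperm p (r (t p)) * tperm p q.
Proof.
have [g1 g2 g3 g4] := phi'4; have [f1 f2 f3 f4] := phiE.
have [pp pq'] := N1 (rN tpN); have [qp qq] := N1 (rN tqN).
have npq : r (t p) != r (t q) by rewrite (inj_eq perm_inj).
have S (a b : D) : a != b -> b != a by rewrite eq_sym.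
have nD (a b c : D) : c != a -> c != b -> tperm a b c = c.
  by move=> ca cb; rewrite tpermD // eq_sym.
rewrite -permP => d; have [->|dp] := eqVneq d p.
  by rewrite g1 3!permM f3 (nD q _ _ pq' npq) tpermR tpermL.
have [->|dq] := eqVneq d q.
  by rewrite g2 3!permM f4 tpermR (nD p _ _ (S _ _ pq) (S _ _ pq')) tpermR.
have [->|dtp] := eqVneq d (t p).
  by rewrite g3 3!permM f1 tpermL (nD _ _ _ qp (S _ _ npq)) (nD _ _ _ qp qq).
have [->|dtq] := eqVneq d (t q).
  by rewrite g4 3!permM f2 (nD q _ _ pq (S _ _ qp)) tpermL (nD _ _ _ pp pq').
have dN : d \notin [set p; q] by rewrite in_set2 negb_or dp dq.
rewrite phi'D // !permM.
have [m1 m2] : r (t d) != p /\ r (t d) != q by apply/N1/rN/ttN.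
have m3 : r (t d) != r (t p) by rewrite !(inj_eq perm_inj).
have m4 : r (t d) != r (t q) by rewrite !(inj_eq perm_inj).
by rewrite (nD _ _ _ m2 m4) (nD _ _ _ m1 m3) (nD _ _ _ m1 m2).
Qed.

(** Of the three transpositions in [suppress_phi] two split and one merges; the net gain is the face
    of the separate edge. *)
Lemma suppress_card_faces : #|porbits (t' * r')| = #|porbits (t * r)|.+1.
Proof.
have [f1 f2 f3 f4] := phiE.
have [pp pq'] := N1 (rN tpN); have [qp qq] := N1 (rN tqN).
have npq : r (t p) != r (t q) by rewrite (inj_eq perm_inj).
rewrite suppress_phi; set s1 := t * r * tperm q (r (t q)).
set s2 := s1 * tperm p (r (t p)).
have c1 : #|porbits s1| = #|porbits (t * r)|.+1.
  by apply: card_porbits_split; rewrite 1?eq_sym // mem_face_step.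
have s1p : s1 p = r (t p) by rewrite permM f3 tpermD // eq_sym.
have c2 : #|porbits s2| = #|porbits s1|.+1.
  apply: card_porbits_split; first by rewrite eq_sym.
  by rewrite -s1p -eq_porbit_mem porbit_step.
have s2p : s2 p = p by rewrite permM s1p tpermR.
have : #|porbits s2| = #|porbits (s2 * tperm p q)|.+1.
  apply: card_porbits_merge.
  by rewrite porbit_invol ?s2p // setUid in_set1 eq_sym.
by rewrite c2 c1 => -[].
Qed.

Lemma suppress_planar : planar t' r'.
Proof.
have cl : nclass (step t' r') <= (nclass (step t r)).+1.
  have [h1 h2 h3 h4] := suppress_flipE.
  have ct a : conn t' r' a (t' a) := conn_t t' r' a.
  have cpq : conn t' r' p q by rewrite -h1.
  have cqp : conn t' r' q p by rewrite -h2.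
  have ctp : conn t' r' (t p) (t q) by rewrite -h3.
  have ctq : conn t' r' (t q) (t p) by rewrite -h4.
  have c0 a : conn t' r' a a := connect0 _ a.
  have m1 : p \in [:: p; t p] by rewrite !inE eqxx.
  have m2 : t p \in [:: p; t p] by rewrite !inE eqxx orbT.
  apply: (@nclass_link _ _ _ p (t p)); try exact: conn_sym.
  move=> a b /orP[]/eqP->; last first.
    left; have [|ap] := boolP (a \in [set p; q]).
      by rewrite in_set2 => /orP[]/eqP->; rewrite ?rp ?rq.
    by rewrite -suppress_rotD //; apply: conn_r.
  have [->|ap] := eqVneq a p; first by right; exists p, (t p); split.
  have [->|aq] := eqVneq a q; first by right; exists p, (t p); split.
  have [->|atp] := eqVneq a (t p); first by right; exists (t p), p; rewrite tK; split.
  have [->|atq] := eqVneq a (t q); first by right; exists (t p), p; rewrite tK; split.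
  have aN : a \notin [set p; q] by rewrite in_set2 negb_or ap aq.
  by left; rewrite -(suppress_flipD aN atp atq); apply: ct.
have cV : #|porbits r'| = #|porbits r|.+1.
  by apply: card_porbits_split => //; rewrite porbp.
have cF := suppress_card_faces.
have pl0 : #|D|./2 + (nclass (step t r)).*2 + 0 <= #|porbits r| + #|porbits (t * r)| := pl.
rewrite /planar /euler cF cV; move: pl0 cl; clear; lia.
Qed.

Lemma suppress_loopless : loopless_map t' r'.
Proof.
move=> d; have [h1 h2 h3 h4] := suppress_flipE.
have [dp|dN] := boolP (d \in [set p; q]).
  rewrite porb1 // in_set1; exact: suppress_flipN.
rewrite suppress_porbit //.
have [->|dtp] := eqVneq d (t p); first by rewrite h3 suppress_ends.
have [->|dtq] := eqVneq d (t q); first by rewrite h4 porbit_sym suppress_ends.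
by rewrite suppress_flipD.
Qed.

Let faceU d e : d \notin [set p; q] -> e \notin [set p; q] ->
  e \in porbit (t' * r') d -> e \in porbit (t * r) d.
Proof.
have [g1 g2 g3 g4] := phi'4; have [f1 f2 f3 f4] := phiE.
move=> dN eN; pose U := porbit (t * r) d :\: [set p; q].
suff /subsetP sub : porbit (t' * r') d \subset U by move=> /sub; rewrite in_setD => /andP[].
have two a : a \in porbit (t * r) d -> (t * r) ((t * r) a) \in porbit (t * r) d.
  by move=> ad; do 2!apply: stable_porbit_self.
apply: stable_porbit; last by rewrite in_setD dN porbit_id.
move=> a; rewrite !in_setD => /andP[aN ad].
have [e1|atp] := eqVneq a (t p).
  by rewrite e1 g3 rN // -f4 -f1; rewrite e1 in ad; apply: two.
have [e1|atq] := eqVneq a (t q).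
  by rewrite e1 g4 rN // -f3 -f2; rewrite e1 in ad; apply: two.
by rewrite phi'D // stable_porbit_self // andbT permM rN ?ttN.
Qed.

Let faceD d e : d \notin [set p; q] -> e \notin [set p; q] ->
  e \in porbit (t * r) d -> e \in porbit (t' * r') d.
Proof.
have [g1 g2 g3 g4] := phi'4; have [f1 f2 f3 f4] := phiE.
move=> dN eN; pose P := porbit (t' * r') d.
have PN a : a \in P -> a \notin [set p; q].
  suff /subsetP sub : P \subset ~: [set p; q] by move=> /sub; rewrite in_setC.
  apply: stable_porbit; last by rewrite in_setC.
  by apply: stableC => b; rewrite !in_set2 => /orP[]/eqP->; rewrite ?g1 ?g2 eqxx ?orbT.
(* On the old faces [p] comes right after [t q], and [q] right after [t p]. *)
pose U := [set a | if a == p then t q \in P else if a == q then t p \in P else a \in P].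
have PU a : a \in P -> a \in U.
  by move=> aP; have [/negPf ap /negPf aq] := N1 (PN _ aP); rewrite inE ap aq.
suff /subsetP sub : porbit (t * r) d \subset U.
  by move=> /sub; have [/negPf ep /negPf eq] := N1 eN; rewrite inE ep eq.
have st : stable (t' * r') P by apply: stable_porbit_self.
apply: stable_porbit; last by apply: PU; apply: porbit_id.
move=> a; rewrite inE; have [->|ap] := eqVneq a p.
  by rewrite f3 => /st; rewrite g4; apply: PU.
have [->|aq] := eqVneq a q; first by rewrite f4 => /st; rewrite g3; apply: PU.
move=> aP; have [e1|atp] := eqVneq a (t p).
  by rewrite e1 f1 inE eq_sym (negPf pq) eqxx -e1.
have [e1|atq] := eqVneq a (t q); first by rewrite e1 f2 inE eqxx -e1.
by apply: PU; rewrite -phi'D ?st // in_set2 negb_or ap aq.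
Qed.

Let faceE d e : d \notin [set p; q] -> e \notin [set p; q] ->
  (e \in porbit (t' * r') d) = (e \in porbit (t * r) d).
Proof. by move=> dN eN; apply/idP/idP; [apply: faceU|apply: faceD]. Qed.

Lemma suppress_nonrepeating : nonrepeating t' r'.
Proof.
move=> x y; have [xp|xN] := boolP (x \in [set p; q]).
  by rewrite porb1 // in_set1 => /eqP->.
rewrite suppress_porbit // => yx.
have yN : y \notin [set p; q].
  by rewrite -porbp porbit_sym -(porbit_eq yx) porbit_sym porbp.
by rewrite faceE //; apply: nr.
Qed.

(** In the suppressed map [p] and [q] form a component of their own, so [S] does not tell where the
    suppressed vertex was; it goes to the side of the edge from [t p] to [t q], which it
    subdivided. *)
Definition lift_side (S : {set D}) := [set d | if d \in [set p; q] then t p \in S else d \in S].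

Let lift_out S d : d \notin [set p; q] -> (d \in lift_side S) = (d \in S).
Proof. by move=> /negPf dN; rewrite inE dN. Qed.

Let lift_t S : stable t' S -> stable t (lift_side S).
Proof.
move=> tS; have [h1 h2 h3 h4] := suppress_flipE.
have tpq : (t q \in S) = (t p \in S) by rewrite -h3 stable_mem.
have inp a : a \in [set p; q] -> (a \in lift_side S) = (t p \in S).
  by move=> ap; rewrite inE ap.
move=> d; have [dp|dN] := boolP (d \in [set p; q]).
  rewrite (inp _ dp); move: dp; rewrite in_set2 => /orP[]/eqP->; rewrite lift_out //.
  by rewrite tpq.
rewrite (lift_out _ dN).
have [->|dtp] := eqVneq d (t p); first by rewrite tK inp.
have [->|dtq] := eqVneq d (t q); first by rewrite tK inp // tpq.
by move=> dS; rewrite lift_out ?ttN // -suppress_flipD ?tS.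
Qed.

Let lift_r S (s : {perm D}) : s p = p -> s q = q ->
  stable (r' * s) S -> stable (r * s) (lift_side S).
Proof.
move=> sp sq rS.
have sN a : a \notin [set p; q] -> s a \notin [set p; q].
  move=> /N1[ap aq]; rewrite in_set2 negb_or -[X in _ != X]sp (inj_eq perm_inj) ap.
  by rewrite -[X in _ != X]sq (inj_eq perm_inj) aq.
move=> d; have [dp|dN] := boolP (d \in [set p; q]).
  rewrite inE dp => h; move: dp; rewrite in_set2 => /orP[]/eqP->.
    by rewrite permM rp sq inE qin.
  by rewrite permM rq sp inE pin.
rewrite (lift_out _ dN) => /rS; rewrite !permM -(permM r (tperm p q)) suppress_rotD //.
by rewrite lift_out // sN ?rN.
Qed.

Lemma suppress_linked : linked t' r'.
Proof.
move=> d e; rewrite suppress_moved !in_setD => /andP[dN dm] /andP[eN em].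
have tS := @component_t _ t' r' d; have rS := @component_r _ t' r' d.
have : e \in lift_side (component t' r' d).
  apply: (stable_conn (lift_t tS) _ _ (lk dm em)).
    by have := @lift_r (component t' r' d) 1; rewrite !perm1 !mulg1; apply.
  by rewrite lift_out // component_id.
by rewrite lift_out // inE.
Qed.

Lemma suppress_reducing x y z w S : ~ reducing t' r' x y z w S.
Proof.
case=> sep [d1 d1S t1] [d2 d2S t2]; have [mx my mz mw] := quad_moved sep.
case: (sep) => qd tS rS xS yS.
have mN a : a \in moved r' -> a \notin [set p; q].
  by rewrite suppress_moved in_setD => /andP[].
have [xN yN zN wN] : [/\ x \notin [set p; q], y \notin [set p; q], z \notin [set p; q]
  & w \notin [set p; q]] by rewrite !mN.
have qd' : quad t r x y z w.
  by move: qd; rewrite /quad !suppress_porbit // !faceE.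
have th d : third t' r' x y d -> d \notin [set p; q] /\ third t r x y d.
  case/and3P=> dm dx dy; have dN := mN _ dm; split=> //.
  move: dm; rewrite suppress_moved in_setD => /andP[_ dm].
  by rewrite /third dm -!faceE // dx dy.
have [d1N t1'] := th _ t1; have [d2N t2'] := th _ t2.
apply: (irr_reducing irr (x := x) (y := y) (z := z) (w := w) (S := lift_side S)).
have sD a : a \in [set p; q] -> swap2 x y z w a = a.
  move=> ap; apply: swap2D; rewrite !inE !negb_or.
  by apply/and4P; split; apply: contraTneq ap => ->.
split; [split=> //| |].
- exact: lift_t.
- by rewrite /cut2 -mulgA; apply: lift_r; rewrite ?sD // mulgA.
- by rewrite lift_out.
- by rewrite lift_out.
- by exists d1; rewrite ?lift_out.
- by exists d2; rewrite ?lift_out.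
Qed.

Lemma suppress_faces : 3 < #|porbit (t' * r') @: moved r'|.
Proof.
apply: leq_trans (irr_faces irr) _; have [f1 f2 f3 f4] := phiE.
(* A corner at the suppressed vertex is replaced by the preceding corner of its face. *)
pose h a := if a == p then t q else if a == q then t p else a.
have hN a : h a \notin [set p; q].
  rewrite /h; have [//|ap] := eqVneq a p; have [//|aq] := eqVneq a q.
  by rewrite in_set2 negb_or ap aq.
have hf a : porbit (t * r) (h a) = porbit (t * r) a.
  rewrite /h; have [->|ap] := eqVneq a p; first by rewrite -[LHS]porbit_step f2.
  by have [->|aq] := eqVneq a q; first by rewrite -[LHS]porbit_step f1.
have tm := moved_stable_t tK nr.
apply: (@card_imset_le _ _ _ _ _ _ _ _ h) => [a am|a b _ _ e].
  rewrite suppress_moved in_setD hN /h /=.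
  by have [_|_] := eqVneq a p; [apply: tm|have [_|_] := eqVneq a q; [apply: tm|]].
rewrite -(hf a) -(hf b); apply/eqP; rewrite eq_porbit_mem -faceE //.
by rewrite -e porbit_id.
Qed.

Lemma suppress_irreducible : irreducible t' r'.
Proof.
split; [exact: suppress_planar|exact: suppress_loopless|exact: suppress_nonrepeating
  |exact: suppress_linked|exact: suppress_reducing|exact: suppress_faces].
Qed.

End Suppress.

(** * From maps to plane graphs and back *)

Section MapGraph.
Variables (D : finType) (t : {perm D}).
Hypotheses (tK : involutive t) (tN : forall d, t d != d).
Variable r : {perm D}.
Hypothesis irr : irreducible t r.

Let ll := irr_loopless irr.
Let nr := irr_nonrepeating irr.
Let lk := irr_linked irr.
Let st : stable t (moved r) := moved_stable_t tK nr.
Let sr : stable r (moved r) := @moved_stable _ r.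
Let sf : stable (t * r) (moved r) := stable_phi st sr.

Definition map_vertex := {A : {set D} | A \in porbit r @: moved r}.
Definition map_dart := {d : D | d \in moved r}.
Definition map_face := {A : {set D} | A \in porbit (t * r) @: moved r}.

Definition map_source (d : map_dart) : map_vertex :=
  exist (fun A => A \in porbit r @: moved r) _ (imset_f (porbit r) (valP d)).
Definition map_side (d : map_dart) : map_face :=
  exist (fun A => A \in porbit (t * r) @: moved r) _ (imset_f (porbit (t * r)) (valP d)).
Definition map_flip (d : map_dart) : map_dart :=
  exist (fun d => d \in moved r) _ (st (valP d)).
Definition map_next (d : map_dart) : map_dart :=
  exist (fun d => d \in moved r) _ (sr (valP d)).

Lemma map_flipK : involutive map_flip.
Proof. by move=> d; apply: val_inj; rewrite /= tK. Qed.

Lemma map_sourceE d e : (map_source d == map_source e) = (val e \in porbit r (val d)).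
Proof. by rewrite -val_eqE /= eq_porbit_mem porbit_sym. Qed.

Lemma map_sideE d e : (map_side d == map_side e) = (val e \in porbit (t * r) (val d)).
Proof. by rewrite -val_eqE /= eq_porbit_mem porbit_sym. Qed.

Lemma map_loopless d : map_source (map_flip d) != map_source d.
Proof. by rewrite map_sourceE porbit_sym ll. Qed.

Definition map_graph : graph :=
  @Graph map_vertex map_dart map_source map_flip map_flipK map_loopless.

Lemma map_vertexP (v : map_vertex) : exists d, map_source d = v.
Proof.
case: v => A PA; case/imsetP: (PA) => d dm e.
by exists (exist _ d dm); apply: val_inj; rewrite /= e.
Qed.

Lemma map_faceP (f : map_face) : exists d, map_side d = f.
Proof.
case: f => A PA; case/imsetP: (PA) => d dm e.
by exists (exist _ d dm); apply: val_inj; rewrite /= e.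
Qed.

Lemma map_nextP (d e : dart map_graph) : fconnect map_next d e = (source d == source e).
Proof.
have it i (a : map_dart) : val (iter i map_next a) = (r ^+ i) (val a).
  by elim: i => [|i IHi]; rewrite ?expg0 ?perm1 //= IHi expgSr permM.
rewrite [RHS]map_sourceE; apply/idP/porbitP => [/iter_findex <-|[i ei]].
  by exists (findex map_next d e); rewrite it.
suff -> : e = iter i map_next d by apply: fconnect_iter.
by apply: val_inj; rewrite /= it.
Qed.

Lemma map_sideP (d : dart map_graph) : map_side (map_next (flip d)) = map_side d.
Proof. by apply: val_inj; rewrite /= -permM porbit_step. Qed.

Lemma map_dart_exists : exists d : map_dart, true.
Proof.
have : 0 < #|porbit (t * r) @: moved r| by apply: leq_trans (irr_faces irr).
by case/card_gt0P => A /imsetP[d dm _]; exists (exist _ d dm).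
Qed.

Definition map_embedding : embedded_graph :=
  @EmbeddedGraph map_graph map_next map_nextP map_face map_side map_sideP
    (fun _ => map_side (xchoose map_dart_exists)).

Lemma map_incident (v : vertex map_embedding) (f : face map_embedding) :
  incident v f = [exists d : map_dart, (map_source d == v) && (map_side d == f)].
Proof.
rewrite /incident; suff -> : isolated v = false by rewrite orbF.
by apply/negP => /forallP h; have [d e] := map_vertexP v; have := h d; rewrite -e eqxx.
Qed.

Lemma porbits_stable (s : {perm D}) S : stable s S ->
  #|porbits s| = #|porbit s @: S| + #|porbit s @: (~: S)|.
Proof.
move=> sS; rewrite -cardsUI.
have -> : (porbit s @: S) :&: (porbit s @: (~: S)) = set0.
  apply/setP => A; rewrite !inE; apply/negP => /andP[/imsetP[a aS ->] /imsetP[b bS e]].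
  have := subsetP (stable_porbit sS aS) b; rewrite e porbit_id => /(_ isT) h.
  by rewrite in_setC h in bS.
rewrite cards0 addn0 -imsetU setUCr.
by apply: eq_card => A; apply/imsetP/imsetP => -[x _ ->]; exists x.
Qed.

(** Each removed edge is a component with two vertices and one face, which cancels from Euler's
    formula; the moved darts form the one component that remains. *)
Lemma map_euler :
  #|porbit r @: moved r| + #|porbit (t * r) @: moved r| = #|moved r|./2 + 2.
Proof.
have eul := planar_eq tK tN (irr_planar irr).
have eV : #|porbits r| = #|porbit r @: moved r| + #|~: moved r|.
  rewrite (porbits_stable sr); congr (_ + _); apply: card_in_imset => a b.
  rewrite !in_setC => /(unmoved_face tK nr)[ra _] /(unmoved_face tK nr)[rb _].
  by rewrite !porbit_invol ?ra ?rb // !setUid => /set1_inj.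
have eF := porbits_stable sf.
have phiC d : d \in ~: moved r -> (t * r) d = t d.
  move=> dm; have := stableC st dm; rewrite in_setC => /(unmoved_face tK nr)[e _].
  by rewrite permM e.
have e2 : #|porbit (t * r) @: (~: moved r)|.*2 = #|~: moved r|.
  apply: card_porbits_invol; first exact: stableC.
  move=> d dm; rewrite !phiC ?tK ?tN //; exact: stableC dm.
have eD : #|moved r| + #|~: moved r| = #|D| := cardsC _.
have eC : nclass (step t r) = #|porbit (t * r) @: (~: moved r)|.+1.
  rewrite nclassE; last exact: conn_sym.
  have -> : [set [set y | connect (step t r) x y] | x in D] =
      moved r |: porbit (t * r) @: (~: moved r).
    have inC x : x \in moved r -> [set y | connect (step t r) x y] = moved r.
      move=> xm; apply/setP => y; rewrite in_set; apply/idP/idP; last exact: lk.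
      exact: stable_conn st sr xm.
    have outC x : x \in ~: moved r -> [set y | connect (step t r) x y] = porbit (t * r) x.
      move=> xm; apply/setP => y; rewrite in_set; apply/idP/idP; last exact: conn_face.
      apply: stable_conn; rewrite ?porbit_id // => a ax.
        have am := subsetP (stable_porbit (stableC sf) xm) _ ax.
        by rewrite -phiC // stable_porbit_self.
      have am := subsetP (stable_porbit (stableC sf) xm) _ ax.
      by rewrite in_setC in am; have [-> _] := unmoved_face tK nr am.
    apply/setP => A; rewrite in_setU1; apply/imsetP/orP.
      case=> x _ ->; have [xm|xm] := boolP (x \in moved r); first by left; rewrite inC ?eqxx.
      by right; rewrite outC ?in_setC // imset_f ?in_setC.
    have [d _] := map_dart_exists.
    case=> [/eqP->|/imsetP[x xm ->]]; first by exists (val d); rewrite ?inC ?(valP d).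
    by exists x; rewrite ?outC.
  rewrite cardsU1; suff -> : moved r \notin porbit (t * r) @: (~: moved r) by rewrite add1n.
  apply/negP => /imsetP[x xm e]; have := porbit_id (t * r) x.
  by rewrite -e; apply/negP; rewrite -in_setC.
by move: eul eV eF e2 eD eC; clear; lia.
Qed.

Lemma map_connected : forall d e : map_dart,
  connect (@incidence_rel map_embedding) (inl (map_source d)) (inl (map_source e)).
Proof.
move=> d e; set R := @incidence_rel map_embedding.
have vf (a : map_dart) : incident (G := map_embedding) (map_source a) (map_side a).
  by rewrite map_incident; apply/existsP; exists a; rewrite !eqxx.
pose S := [set val a |
  a in [set a : map_dart | connect R (inl (map_source d)) (inl (map_source a))]].
have tS : stable t S.
  move=> _ /imsetP[a ca ->]; apply/imsetP; exists (map_flip a) => //.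
  rewrite !in_set in ca *; apply: connect_trans ca _.
  apply: (connect_trans (y := inr (map_side a))).
    by apply: connect1; apply: vf.
  apply: connect1; change (incident (G := map_embedding) (map_source (map_flip a)) (map_side a)).
  rewrite map_incident; apply/existsP; exists (map_next (map_flip a)).
  have -> : map_source (map_next (map_flip a)) = map_source (map_flip a).
    by apply: val_inj; rewrite /= porbit_step.
  by rewrite eqxx; apply/eqP; apply: map_sideP.
have rS : stable r S.
  move=> _ /imsetP[a ca ->]; apply/imsetP; exists (map_next a) => //.
  rewrite !in_set in ca *; suff -> : map_source (map_next a) = map_source a by [].
  by apply: val_inj; rewrite /= porbit_step.
have dS : val d \in S by apply: imset_f; rewrite in_set connect0.
have := stable_conn tS rS dS (lk (valP d) (valP e)).
by case/imsetP => a ca /val_inj ->; rewrite in_set in ca.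
Qed.

Lemma map_adj_sym : symmetric (@adj map_graph).
Proof.
suff imp u v : @adj map_graph u v -> @adj map_graph v u by move=> u v; apply/idP/idP; apply: imp.
case/existsP=> d /andP[/eqP du /eqP dv]; apply/existsP; exists (flip d).
by rewrite -dv -du /target flipK !eqxx.
Qed.

Lemma map_graph_connected (u v : map_vertex) : connect (@adj map_graph) u v.
Proof.
have [d <-] := map_vertexP u; have [e <-] := map_vertexP v.
pose S := [set val a |
  a in [set a : map_dart | connect (@adj map_graph) (map_source d) (map_source a)]].
have tS : stable t S.
  move=> _ /imsetP[a ca ->]; apply/imsetP; exists (map_flip a) => //.
  rewrite !in_set in ca *; apply: connect_trans ca _.
  by apply: connect1; apply/existsP; exists a; rewrite !eqxx.
have rS : stable r S.
  move=> _ /imsetP[a ca ->]; apply/imsetP; exists (map_next a) => //.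
  rewrite !in_set in ca *; suff -> : map_source (map_next a) = map_source a by [].
  by apply: val_inj; rewrite /= porbit_step.
have dS : val d \in S by apply: imset_f; rewrite in_set connect0.
have := stable_conn tS rS dS (lk (valP d) (valP e)).
by case/imsetP => a ca /val_inj ->; rewrite in_set in ca.
Qed.

Lemma map_spherical : spherical map_embedding.
Proof.
split.
  have toV (x : vertex map_embedding + face map_embedding) : exists d : map_dart,
      connect (@incidence_rel map_embedding) x (inl (map_source d)) /\
      connect (@incidence_rel map_embedding) (inl (map_source d)) x.
    case: x => [v|f].
      by have [d <-] := map_vertexP v; exists d; rewrite connect0.
    have [d e] := map_faceP f; exists d.
    have h : incident (G := map_embedding) (map_source d) f.
      by rewrite map_incident; apply/existsP; exists d; rewrite e !eqxx.
    by split; apply: connect1.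
  move=> x y; have [d [xd _]] := toV x; have [e [_ ey]] := toV y.
  apply: connect_trans xd _; apply: connect_trans ey; exact: map_connected.
have [d _] := map_dart_exists.
have -> : n_comp (@adj map_embedding) predT = 1%N.
  rewrite -(n_comp_connect (sym_connect_sym map_adj_sym) (map_source d)).
  by apply: eq_n_comp_r => v; rewrite !inE; apply/esym/map_graph_connected.
have eV : #|vertex map_embedding| = #|porbit r @: moved r| by rewrite card_sig; apply: eq_card.
have eF : #|face map_embedding| = #|porbit (t * r) @: moved r|.
  by rewrite card_sig; apply: eq_card.
have eD : #|dart map_embedding| = #|moved r| by rewrite card_sig; apply: eq_card.
by rewrite eV eF eD map_euler -addnA.
Qed.

Definition map_plane : plane_graph := PlaneGraph map_spherical.

Lemma map_max_face_degree m : good t m r -> max_face_degree map_plane <= m.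
Proof.
case=> _ _ deg; apply/bigmax_leqP => f _; have [d <-] := map_faceP f.
apply: leq_trans (deg (val d)); rewrite /face_degree /degree.
rewrite -(card_imset _ (val_inj : injective (val : map_vertex -> {set D}))).
apply/subset_leq_card/subsetP => _ /imsetP[v vf ->]; move: vf; rewrite in_set map_incident.
case/existsP => e /andP[/eqP <- ed]; rewrite /=; apply: imset_f.
by move: ed; rewrite map_sideE porbit_sym.
Qed.

Lemma map_colorable k : 1 < k -> cyclically_colorable map_plane k -> colorable t k r.
Proof.
move=> k2 /existsP[c /forallP cc].
pose c0 d := if insub d is Some d' then c (map_source d') else Ordinal k2.
have c0E (d : map_dart) : c0 (val d) = c (map_source d) by rewrite /c0 valK.
apply: (@colorable_moved _ _ tK tN _ _ c0) => // [d dm|d e dm de].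
  pose d' : map_dart := exist _ d dm; rewrite -[r d]/(val (map_next d')) -[d]/(val d') !c0E.
  by congr (c _); apply: val_inj; rewrite /= porbit_step.
have em : e \in moved r by apply: (subsetP (stable_porbit sf dm)).
pose d' : map_dart := exist _ d dm; pose e' : map_dart := exist _ e em.
rewrite -[d]/(val d') -[e]/(val e') !c0E => cde.
rewrite -map_sourceE; apply: contraT => nde.
have /forallP/(_ (map_source d'))/forallP/(_ (map_source e')) := cc (map_side d').
rewrite cde eqxx implybF nde /= !map_incident; case/negP; apply/andP; split.
  by apply/existsP; exists d'; rewrite !eqxx.
by apply/existsP; exists e'; rewrite eqxx eq_sym map_sideE.
Qed.

End MapGraph.

(** * Simplicity and 3-connectedness *)

Section ThreeConnected.
Variables (D : finType) (t : {perm D}).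
Hypotheses (tK : involutive t) (tN : forall d, t d != d).
Variable r : {perm D}.
Hypothesis irr : irreducible t r.
Hypothesis deg3 : forall d, d \in moved r -> r (r d) != d.
Let G := map_graph tK irr.

Lemma map_simple : simple_graph G.
Proof.
move=> d e /eqP sde /eqP tde; apply/esym/val_inj.
apply: (parallel_eq tK tN irr deg3 (valP d)).
  by rewrite -map_sourceE.
by move: tde; rewrite /target map_sourceE.
Qed.

(** By [deg3] a vertex has three distinct darts, and by simplicity they lead to distinct
    neighbors. *)
Lemma map_card_vertex : 3 < #|vertex G|.
Proof.
have [d _] := map_dart_exists irr.
pose d1 : dart G := d; pose d2 : dart G := map_next d1; pose d3 : dart G := map_next d2.
have src : source d2 = source d1 /\ source d3 = source d1.
  by split; apply: val_inj; rewrite /= ?porbit_step.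
have [s2 s3] := src.
have n12 : d2 != d1 by rewrite -val_eqE; have := valP d; rewrite inE.
have n23 : d3 != d2 by rewrite -val_eqE /= (inj_eq perm_inj); have := valP d; rewrite inE.
have n13 : d3 != d1 by rewrite -val_eqE; apply: deg3 (valP d).
have tneq (a b : dart G) : source a = source b -> a != b -> target a != target b.
  by move=> sab; apply: contraNneq => tab; rewrite (map_simple sab tab).
have ln (a : dart G) : source a = source d1 -> source d1 != target a.
  by move=> <-; rewrite eq_sym; apply: loopless.
have un : uniq [:: source d1; target d1; target d2; target d3].
  rewrite /= !inE !negb_or; apply/and4P; split=> //.
  - by rewrite !ln.
  - by rewrite ![target d1 == _]eq_sym !tneq.
  - by rewrite eq_sym tneq // s2 s3.
by rewrite cardE; apply: (uniq_leq_size un) => x _; rewrite mem_enum.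
Qed.

Lemma map_three_connected : three_connected G.
Proof.
split=> [|S S2]; first exact: map_card_vertex.
split.
  apply/existsP; apply: contraT => /existsPn all.
  have le : #|vertex G| <= #|S|.
    by apply/subset_leq_card/subsetP => v _; have := all v; rewrite negbK.
  by have := leq_ltn_trans le S2; rewrite ltnNge (ltnW map_card_vertex).
move=> u v uS vS; set R := [rel x y | _].
(* [X] collects the darts at vertices reachable from [u] outside [S], and [K] those at [S]; by
   [no_cut] there are no others. *)
pose X := [set val a | a in [set a : dart G | connect R u (source a)]].
pose K := [set val a | a in [set a : dart G | source a \in S]].
have inX (a : dart G) : (val a \in X) = connect R u (source a).
  by rewrite mem_imset ?in_set //; apply: val_inj.
have inK (a : dart G) : (val a \in K) = (source a \in S).
  by rewrite mem_imset ?in_set //; apply: val_inj.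
have rsrc (a : dart G) : source (map_next a : dart G) = source a.
  by apply: val_inj; rewrite /= porbit_step.
have outS x : connect R u x -> x \notin S.
  case/connectP=> p; case/lastP: p => [_ ->//|p y].
  by rewrite rcons_path last_rcons => /andP[_ /and3P[_ yS _]] ->.
have sub : moved r \subset X :|: K.
  apply: (no_cut tK tN irr deg3).
  - move=> _ /imsetP[a ca ->]; rewrite in_set in ca.
    by rewrite -[r _]/(val (map_next a)) inX rsrc.
  - move=> _ /imsetP[a ca ->]; rewrite in_set in ca.
    by rewrite -[r _]/(val (map_next a)) inK rsrc.
  - by apply/subsetP => _ /imsetP[a _ ->]; apply: valP.
  - by apply/subsetP => _ /imsetP[a _ ->]; apply: valP.
  - by move=> _ /imsetP[a ca ->]; rewrite in_set in ca; rewrite inK outS.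
  - move=> _ /imsetP[a ca ->]; rewrite in_set in ca.
    have -> : t (val a) = val (@flip G a) by [].
    rewrite in_setU inX inK; have [_|nS] := boolP (source (@flip G a) \in S).
      by rewrite orbT.
    rewrite orbF; apply: (connect_trans ca); apply: connect1.
    rewrite /R /=; apply/and3P; split=> //; first exact: outS ca.
    by apply/existsP; exists a; rewrite /target !eqxx.
  - move=> _ _ _ /imsetP[a aS ->] /imsetP[b bS ->] /imsetP[c cS ->].
    rewrite !in_set in aS bS cS; rewrite -!map_sourceE => ab ac.
    apply: contraT => bc; move: S2; rewrite ltnNge; case/negP.
    have un : uniq [:: @source G a; @source G b; @source G c].
      by rewrite /= !inE negb_or; apply/and3P; split=> //; apply/andP.
    rewrite cardE; apply: (uniq_leq_size un) => x; rewrite mem_enum !inE.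
    by case/or3P=> /eqP->.
  - have [d e] := map_vertexP u; apply/set0Pn; exists (val d).
    by rewrite (inX d) [source _]e connect0.
have [d e] := map_vertexP v.
have := subsetP sub _ (valP d); rewrite in_setU (inX d) (inK d).
by rewrite [source _]e (negPf vS) orbF.
Qed.

End ThreeConnected.

(** * Suppression as the inverse of subdivision *)

Lemma inj_surj_bij (T1 T2 : finType) (f : T1 -> T2) :
  injective f -> (forall y, exists x, f x = y) -> bijective f.
Proof.
move=> fi fs; apply: inj_card_bij => //.
rewrite -(card_codom fi); apply/subset_leq_card/subsetP => y _.
by have [x <-] := fs y; apply: codom_f.
Qed.

Lemma graph_iso_refl G : graph_iso G G.
Proof. by exists id, id; split=> //; exists id. Qed.

Section SuppressSubdivision.
Variables (D : finType) (t : {perm D}).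
Hypotheses (tK : involutive t) (tN : forall d, t d != d).
Variables (r : {perm D}) (p : D).
Hypotheses (irr : irreducible t r) (pm : p \in moved r) (deg2 : r (r p) = p).
Let q := r p.
Let t' := suppress_flip t r p.
Let r' := suppress_rot r p.
Let t'K : involutive t' := @suppress_flipK _ t tK r p.
Let irr' : irreducible t' r' := suppress_irreducible tK tN irr pm deg2.
Let G := map_graph tK irr.
Let G' := map_graph t'K irr'.

Let mE : moved r' = moved r :\: [set p; q] := suppress_moved deg2.

Lemma suppress_moved_sub d : d \in moved r' -> d \in moved r /\ d \notin [set p; q].
Proof. by rewrite mE in_setD => /andP[]. Qed.

Lemma suppress_d0 : t p \in moved r'.
Proof.
rewrite mE in_setD (moved_stable_t tK (irr_nonrepeating irr) pm) andbT.
have : t p \notin porbit r p by apply: irr_loopless irr p.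
by rewrite porbit_invol.
Qed.

Definition suppress_dart0 : dart G' := exist (fun d => d \in moved r') _ suppress_d0.
Let d0 := suppress_dart0.

Let qm : q \in moved r. Proof. exact: moved_stable. Qed.

(** The flip of [inr false] is [inl d0], and [d0] is [t p], so [inr false] must become [p]; likewise
    [inr true] becomes [q]. *)
Definition unsuppress_dart (x : dart (subdivide d0)) : dart G :=
  match x with
  | inl d => exist (fun d => d \in moved r) _ (proj1 (suppress_moved_sub (valP d)))
  | inr b => if b then exist (fun d => d \in moved r) _ qm
             else exist (fun d => d \in moved r) _ pm
  end.

Lemma suppress_vertex_sub (A : {set D}) : A \in porbit r' @: moved r' ->
  A \in porbit r @: moved r.
Proof.
case/imsetP=> d /suppress_moved_sub[dm dN] ->.
by rewrite suppress_porbit ?imset_f.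
Qed.

Definition unsuppress_vertex (v : vertex (subdivide d0)) : vertex G :=
  match v with
  | Some v => exist (fun A => A \in porbit r @: moved r) _ (suppress_vertex_sub (valP v))
  | None => exist (fun A => A \in porbit r @: moved r) _ (imset_f (porbit r) pm)
  end.

Lemma suppress_iso : graph_iso (subdivide d0) G.
Proof.
have pq : p != q by move: pm; rewrite inE eq_sym.
have porbp : porbit r p = [set p; q] by apply: porbit_invol.
have [h1 h2 h3 h4] := suppress_flipE tK irr pm deg2.
have dN (d : dart G') : val d != p /\ val d != q.
  by have [_] := suppress_moved_sub (valP d); rewrite in_set2 negb_or => /andP[].
have srcN (d : dart G') : porbit r (val d) != porbit r p.
  have [_ nd] := suppress_moved_sub (valP d).
  by rewrite eq_porbit_mem porbp.
exists unsuppress_vertex, unsuppress_dart; split.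
- apply: inj_surj_bij.
    have key (v : vertex G') : val v != porbit r p.
      have [d <-] := map_vertexP v; rewrite /= suppress_porbit ?srcN //.
      by case: (suppress_moved_sub (valP d)).
    move=> [u|] [v|] // /(congr1 val) /= e.
    + by congr Some; apply: val_inj.
    + by case/eqP: (key u).
    + by case/eqP: (key v).
  move=> v; have [d dv] := map_vertexP v.
  have [dp|dp] := boolP (val d \in [set p; q]).
    by exists None; rewrite -dv; apply: val_inj => /=; apply: porbit_eq; rewrite porbp.
  have dm' : val d \in moved r' by rewrite mE in_setD dp; apply: valP.
  exists (Some (map_source (exist _ (val d) dm'))); rewrite -dv; apply: val_inj => /=.
  by rewrite suppress_porbit.
- apply: inj_surj_bij.
    move=> [d|b] [e|b'] /(congr1 val) /=.
    + by move=> de; congr inl; apply: val_inj.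
    + by have [/eqP np /eqP nq] := dN d; case: b' => [/nq|/np].
    + by have [/eqP np /eqP nq] := dN e; case: b => [/esym/nq|/esym/np].
    + by case: b; case: b' => // e; case/eqP: pq; first [exact: e | exact: esym e].
  move=> d; have [dp|dp] := boolP (val d \in [set p; q]).
    move: dp; rewrite in_set2 => /orP[]/eqP e; [exists (inr false)|exists (inr true)];
      by apply: val_inj.
  have dm' : val d \in moved r' by rewrite mE in_setD dp; apply: valP.
  by exists (inl (exist _ (val d) dm')); apply: val_inj.
- move=> [d|[]]; apply: val_inj => /=; rewrite ?porbit_step //.
  by rewrite suppress_porbit //; case: (suppress_moved_sub (valP d)).
- move=> x; apply: val_inj; case: x => [d|[]] /=; rewrite ?tK //.
  have [e|ne] := eqVneq d d0; first by rewrite e /= tK.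
  have [e|ne'] := eqVneq d (flip d0); first by rewrite e /= h3 tK.
  rewrite /= -/t' suppress_flipD //; first by case: (suppress_moved_sub (valP d)).
  by apply: contra ne' => /eqP h; apply/eqP/val_inj; rewrite /= [LHS]h h3.
Qed.

End SuppressSubdivision.

(** Suppression changes the flip as well as the rotation, so the induction quantifies over both; it
    ends when no vertex of degree two is left. *)
Lemma irreducible_subdivision (D : finType) (t : {perm D}) (tK : involutive t) r
    (irr : irreducible t r) : (forall d, t d != d) ->
  exists H : plane_graph,
    [/\ simple_graph H, three_connected H & subdivision_of H (map_graph tK irr)].
Proof.
have [n] := ubnP #|moved r|; elim: n t tK r irr => // n IHn t tK r irr.
rewrite ltnS => mn tN.
have [/exists_inP[p pm /eqP deg2]|/exists_inPn deg3] := boolP [exists p in moved r, r (r p) == p].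
  pose irr' := suppress_irreducible tK tN irr pm deg2.
  have [||H [sH cH subH]] := IHn _ (@suppress_flipK _ t tK r p) _ irr'.
  - apply: leq_trans mn; rewrite suppress_moved //.
    by apply/proper_card/properP; split; [exact: subsetDl|exists p; rewrite // !inE eqxx].
  - exact: suppress_flipN.
  exists H; split=> //; apply: Subdivision_step subH (suppress_iso tK tN irr pm deg2).
exists (map_plane tK tN irr); split.
- exact: map_simple.
- exact: map_three_connected.
- exact/Subdivision_refl/graph_iso_refl.
Qed.

(** * The map of a connected plane graph *)

Section PlaneMap.
Variable G : plane_graph.
Hypothesis Gc : connected_graph G.
Variable d0 : dart G.

Let rot_source (d : dart G) : source (Defs.rot d) = source d.
Proof. by apply/esym/eqP; rewrite -rotP fconnect1. Qed.

(** By [rotP] each dart is reachable from its own image, so the rotation is surjective, hence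
    injective by finiteness. *)
Lemma plane_rot_inj : injective (@Defs.rot G).
Proof.
have surj : [set: dart G] \subset (@Defs.rot G) @: [set: dart G].
  apply/subsetP => d _; have : fconnect (@Defs.rot G) (Defs.rot d) d by rewrite rotP rot_source.
  move/iter_findex; case: (findex _ _ _) => [|n] /= e.
    by rewrite -e imset_f ?in_setT.
  by rewrite -e imset_f ?in_setT.
have /imset_injP inj : #|(@Defs.rot G) @: [set: dart G]| == #|[set: dart G]|.
  by rewrite eqn_leq leq_imset_card subset_leq_card.
by move=> a b; apply: inj; rewrite in_setT.
Qed.

Definition plane_flip : {perm dart G} := perm (can_inj (@flipK G)).
Definition plane_rot : {perm dart G} := perm plane_rot_inj.
Let t := plane_flip.
Let r := plane_rot.

Let tE d : t d = flip d. Proof. by rewrite permE. Qed.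
Let rE d : r d = Defs.rot d. Proof. by rewrite permE. Qed.
Lemma plane_flipK : involutive t.
Proof. by move=> d; rewrite !tE flipK. Qed.
Lemma plane_flipN d : t d != d.
Proof. by rewrite tE; apply/eqP => e; have := loopless d; rewrite e eqxx. Qed.

Let porbitE d e : (e \in porbit r d) = (source d == source e).
Proof.
rewrite -rotP; have it i : (r ^+ i) d = iter i (@Defs.rot G) d.
  by elim: i => [|i IHi]; rewrite ?expg0 ?perm1 // expgSr permM IHi rE.
apply/porbitP/idP => [[i ->]|/iter_findex <-]; first by rewrite it fconnect_iter.
by exists (findex (@Defs.rot G) d e); rewrite it.
Qed.

Let side_face d e : e \in porbit (t * r) d -> side e = side d.
Proof.
case/porbitP=> i ->; elim: i => [|i IHi]; first by rewrite expg0 perm1.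
by rewrite expgSr permM permM rE tE sideP.
Qed.

Let vertex_dart (v : vertex G) : exists d : dart G, source d == v.
Proof.
case: Gc => _ /(_ v); rewrite in_set0.
have [[d dv]|none] : (exists d : dart G, source d == v) \/
    forall d : dart G, source d != v.
  have [/existsP h|/existsPn h] := boolP [exists d : dart G, source d == v]; last by right.
  by left.
- by exists d.
move/(_ (source d0)); rewrite in_set0 => /(_ isT isT)/connectP[[|u p] /=].
  by move=> _ e; have := none d0; rewrite e eqxx.
case/andP=> /and3P[_ _ /existsP[d /andP[dv _]]] _ _.
by exists d.
Qed.

Let not_isolated (v : vertex G) : isolated v = false.
Proof. by apply/negP => /forallP h; have [d dv] := vertex_dart v; have := h d; rewrite dv. Qed.

Let incidentE (v : vertex G) (f : face G) :
  incident v f = [exists d : dart G, (source d == v) && (side d == f)].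
Proof. by rewrite /incident not_isolated orbF. Qed.

Let face_dart (f : face G) : exists d : dart G, side d = f.
Proof.
have [/(_ (inr f) (inl (source d0)))/connectP[[|[v|g] p] //= /andP[vf _] _] _] := plane_spherical G.
by move: vf; rewrite incidentE => /existsP[d /andP[_ /eqP <-]]; exists d.
Qed.

Let linkedG d e : conn t r d e.
Proof.
pose S := component t r d.
have [tS rS] : stable t S /\ stable r S by split; [apply: component_t|apply: component_r].
have src a b : source a = source b -> a \in S -> b \in S.
  by move=> /eqP; rewrite -porbitE => ab aS; apply: (subsetP (stable_porbit rS aS)).
suff : e \in S by rewrite inE.
have [_ /(_ (source d) (source e))] := Gc; rewrite !in_set0 => /(_ isT isT)/connectP[p].
have : d \in S := component_id t r d.
move: {1 2 3}d; elim: p => [|v p IHp] a aS /=; first by move=> _ ea; apply: src aS.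
case/andP=> /and3P[_ _ /existsP[b /andP[/eqP ba /eqP bv]]].
have bS : b \in S by apply: src aS.
by rewrite -bv /target -tE; apply: IHp; apply: tS.
Qed.

Let nclass1 : nclass (step t r) <= 1.
Proof.
apply/card_le1_eqP => a b; rewrite !in_set => /eqP <- /eqP <-.
by apply/(rootP (@conn_sym _ t r)); apply: linkedG.
Qed.

Let n_comp1 : 0 < n_comp (@adj G) predT.
Proof.
apply/card_gt0P; exists (root (@adj G) (source d0)); rewrite !inE andbT.
apply: roots_root; apply: sym_connect_sym => u v.
by apply/idP/idP => /existsP[d /andP[/eqP <- /eqP <-]]; apply/existsP; exists (flip d);
   rewrite /target flipK !eqxx.
Qed.

Let card_vertices : #|vertex G| <= #|porbits r|.
Proof.
rewrite -[#|vertex G|]cardsT; have -> : [set: vertex G] = (@source G) @: [set: dart G].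
  apply/setP => v; rewrite in_setT; have [d /eqP <-] := vertex_dart v.
  by rewrite imset_f ?in_setT.
apply: leq_trans (_ : _ <= #|porbit r @: [set: dart G]|) _.
  apply: (@card_imset_le _ _ _ _ _ _ _ _ id) => // a b _ _ /= e.
  by apply/eqP; rewrite -porbitE e porbit_id.
by apply/subset_leq_card/subsetP => _ /imsetP[d _ ->]; apply: imset_f.
Qed.

Let faces_image : (@side G) @: [set: dart G] = [set: face G].
Proof.
apply/setP => f; rewrite in_setT; have [d <-] := face_dart f.
by rewrite imset_f ?in_setT.
Qed.

(** For a connected graph, [spherical] is an equality against the inequality [euler_le]; as there
    are at least as many orbits of [r] as vertices, there are at most as many boundary walks as
    faces. *)
Let card_faces : #|porbits (t * r)| <= #|face G|.
Proof.
have [_ eul] := plane_spherical G; have le := euler_le plane_flipK plane_flipN r.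
by move: eul le nclass1 n_comp1 card_vertices; clear; lia.
Qed.

(** Boundary walks are mapped onto the faces and are not more numerous, so no face has two of
    them. *)
Let side_inj d e : side d = side e -> e \in porbit (t * r) d.
Proof.
pose g (A : {set dart G}) := omap (@side G) [pick x in A].
have gE a : g (porbit (t * r) a) = Some (side a).
  rewrite /g; case: pickP => [b /side_face <- //|/(_ a)].
  by rewrite porbit_id.
have img : g @: porbits (t * r) = Some @: [set: face G].
  rewrite -faces_image; apply/setP => o; apply/imsetP/imsetP.
    case=> _ /imsetP[a _ ->] ->; exists (side a); rewrite ?gE ?imset_f ?in_setT //.
  case=> _ /imsetP[a _ ->] ->; exists (porbit (t * r) a); rewrite ?gE //.
  exact: imset_f.
have /imset_injP inj : #|g @: porbits (t * r)| == #|porbits (t * r)|.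
  rewrite eqn_leq leq_imset_card img card_imset ?cardsT ?card_faces //.
  by move=> a b [].
move=> sde; suff -> : porbit (t * r) d = porbit (t * r) e by apply: porbit_id.
by apply: inj; rewrite ?imset_f // !gE sde.
Qed.

Lemma plane_map_good : good t (max_face_degree G) r.
Proof.
split.
- have [_ eul] := plane_spherical G; rewrite /planar /euler.
  have cf : #|face G| <= #|porbits (t * r)|.
    rewrite -[#|face G|]cardsT -faces_image.
    apply: leq_trans (_ : _ <= #|porbit (t * r) @: [set: dart G]|) _.
      apply: (@card_imset_le _ _ _ _ _ _ _ _ id) => // a b _ _ /= e.
      by apply: side_face; rewrite -e porbit_id.
    by apply/subset_leq_card/subsetP => _ /imsetP[d _ ->]; apply: imset_f.
  by move: eul cf nclass1 n_comp1 card_vertices; clear; lia.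
- by move=> d; rewrite porbitE tE eq_sym; apply: loopless.
- move=> d; apply: leq_trans (leq_bigmax (side d)); rewrite /degree /face_degree.
  apply: leq_trans (_ : _ <= #|(@source G) @: porbit (t * r) d|) _.
    apply: (@card_imset_le _ _ _ _ _ _ _ _ id) => // a b _ _ /= e.
    by apply: porbit_eq; rewrite porbitE e.
  apply/subset_leq_card/subsetP => _ /imsetP[a ad ->]; rewrite in_set incidentE.
  by apply/existsP; exists a; rewrite eqxx (side_face ad) eqxx.
Qed.

Lemma plane_map_colorable k : colorable t k r -> cyclically_colorable G k.
Proof.
case=> c pc; pose c' := [ffun v => c (xchoose (vertex_dart v))].
have c'E d : c' (source d) = c d.
  rewrite ffunE; apply: (proper_orbit pc); rewrite porbitE eq_sym.
  exact: xchooseP (vertex_dart (source d)).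
apply/existsP; exists c'; apply/forallP => f; apply/forallP => u; apply/forallP => v.
apply/implyP; rewrite !incidentE => /and3P[uv /existsP[d /andP[/eqP du /eqP df]]].
move=> /existsP[e /andP[/eqP ev /eqP ef]]; rewrite -du -ev !c'E.
rewrite (proper_face pc) ?porbitE ?du ?ev //.
by apply: side_inj; rewrite df ef.
Qed.

End PlaneMap.

(** * Chromatic numbers, connectedness of subdivisions, and the equivalence *)

Lemma chromatic_le (G : plane_graph) k :
  cyclically_colorable G k -> cyclic_chromatic_number G <= k.
Proof. by rewrite /cyclic_chromatic_number; case: ex_minnP => m _; apply. Qed.

Lemma chromatic_colorable (G : plane_graph) k :
  cyclic_chromatic_number G <= k -> cyclically_colorable G k.
Proof.
rewrite /cyclic_chromatic_number; case: ex_minnP => m /existsP[c cc] _ mk.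
apply/existsP; exists [ffun v => widen_ord mk (c v)].
apply/forallP => f; apply/forallP => u; apply/forallP => v; apply/implyP => uv.
have /forallP/(_ u)/forallP/(_ v) := forallP cc f; rewrite uv !ffunE -!val_eqE.
by [].
Qed.

Lemma graph_iso_connected G H : graph_iso G H -> connected_graph G -> connected_graph H.
Proof.
case=> fV [fD [[gV fK gK] [gD _ gDK] fs ff]] [[v0 _] con].
split; first by exists (fV v0); rewrite in_set0.
move=> u v _ _; have := con (gV u) (gV v); rewrite !in_set0 => /(_ isT isT).
rewrite -{2}(gK u) -{2}(gK v); case/connectP=> p pth ->.
elim: p (gV u) pth => [|b p IHp] a /=; first by rewrite connect0.
case/andP=> /and3P[_ _ /existsP[d /andP[/eqP da /eqP db]]] /IHp.
apply: connect_trans; apply: connect1; rewrite /= !in_set0 /=.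
by apply/existsP; exists (fD d); rewrite /target fs ff fs -da -db !eqxx.
Qed.

Lemma subdivide_connected G (d : dart G) : connected_graph G -> connected_graph (subdivide d).
Proof.
case=> [[v0 _] con]; split; first by exists None; rewrite in_set0.
set R := [rel x y | _].
have edge (x : dart (subdivide d)) : connect R (source x) (target x).
  by apply: connect1; rewrite /R /= !in_set0 /=; apply/existsP; exists x; rewrite !eqxx.
have toN (b : bool) :
    connect R (source (inl (if b then flip d else d) : dart (subdivide d))) None.
  have := edge (inl (if b then flip d else d)); rewrite /target /=.
  case: b => /=; rewrite ?eqxx //.
  by case: eqP => //= e; have := loopless d; rewrite e eqxx.
have fromN (b : bool) :
    connect R None (source (inl (if b then flip d else d) : dart (subdivide d))).
  by have := edge (inr b); rewrite /target /=; case: b.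
have adjS (a : dart G) : connect R (Some (source a)) (Some (target a)).
  have [->|ad] := eqVneq a d; first exact: connect_trans (toN false) (fromN true).
  have [->|ad'] := eqVneq a (flip d).
    by rewrite /target flipK; apply: connect_trans (toN true) (fromN false).
  by have := edge (inl a); rewrite /target /= (negPf ad) (negPf ad').
have SS u v : connect R (Some u) (Some v).
  have := con u v; rewrite !in_set0 => /(_ isT isT)/connectP[p pth ->].
  elim: p u pth => [|b p IHp] a /=; first by rewrite connect0.
  case/andP=> /and3P[_ _ /existsP[e /andP[/eqP ea /eqP eb]]] /IHp.
  by apply: connect_trans; rewrite -ea -eb.
move=> [u|] [v|] _ _ //.
- exact: connect_trans (SS u (source d)) (toN false).
- exact: connect_trans (fromN false) (SS _ v).
Qed.

Lemma subdivision_connected H G : subdivision_of H G -> connected_graph H -> connected_graph G.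
Proof.
move=> sub cH; elim: sub => [G' iso|G1 d G2 _ c1 iso]; first exact: graph_iso_connected iso cH.
by apply: graph_iso_connected iso _; apply: subdivide_connected.
Qed.

Local Close Scope group_scope.

Theorem theorem4 :
  (forall G : plane_graph, connected_graph G ->
     cyclic_chromatic_number G <= (3 * max_face_degree G) %/ 2)
  <->
  (forall G : plane_graph,
     (exists H : plane_graph,
        [/\ simple_graph H, three_connected H & subdivision_of H G]) ->
     cyclic_chromatic_number G <= (3 * max_face_degree G) %/ 2).
Proof.
split=> [all G [H [_ [_ c3] sub]]|sub3 G Gc].
  by apply/all/(subdivision_connected sub)/c3; rewrite cards0.
(* Without darts the graph is a single vertex. Its [home] face makes the maximum face degree
   positive, so at least one color is available. *)
apply: chromatic_le; have [D0|/card_gt0P[d0 _]] := posnP #|dart G|.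
  have [[v0 _] con] := Gc.
  have one (u v : vertex G) : u = v.
    have := con u v; rewrite !in_set0 => /(_ isT isT)/connectP[[|w p] //= /andP[+ _] _].
    by case/and3P=> _ _ /existsP[d _]; have /card0_eq/(_ d) := D0.
  have deg1 : 0 < max_face_degree G.
    apply: leq_trans (leq_bigmax (home v0)); apply/card_gt0P; exists v0.
    rewrite in_set /incident eqxx andbT; apply/orP; right; apply/forallP => d.
    by have /card0_eq/(_ d) := D0.
  have k0 : 0 < (3 * max_face_degree G) %/ 2 by move: deg1; clear; lia.
  apply/existsP; exists [ffun _ => Ordinal k0].
  apply/forallP => f; apply/forallP => u; apply/forallP => v.
  by rewrite (one u v) eqxx.
set k := _ %/ 2; have km : k = (3 * max_face_degree G) %/ 2 by [].
have gr := plane_map_good Gc d0.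
pose t := plane_flip G.
have tK : involutive t := @plane_flipK G; have tN d : t d != d := @plane_flipN G d.
apply: (plane_map_colorable Gc d0).
apply: (colorable_all tK tN km) gr => r' gr' irr.
have k2 : 1 < k := leq_trans (good_ge2 d0 gr') (leq_mk km).
apply: (map_colorable (tK := tK) (tN := tN) (irr := irr) k2).
(* The maximum face degree of the irreducible map may be smaller than that of [G]; the bound is
   monotone in it. *)
apply: chromatic_colorable; apply: leq_trans (sub3 _ _) _.
  exact: irreducible_subdivision.
by rewrite km leq_div2r // leq_mul2l map_max_face_degree.
Qed.
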